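(* Let $\Sigma$ be an alphabet, $\mathcal F$ a searchable family of graphs over $\Sigma$, and $k\ge1$. Then, on $\mathcal F$, the graph languages accepted by deterministic $k$-head graph-walking automata with nested pebbles are exactly those definable by closed formulas of FO+DTC$^k$: for every such automaton $\mathcal A$ there is a closed FO+DTC$^k$ formula $\phi$ with $\{g\in\mathcal F\mid g\in L(\mathcal A)\}=\{g\in\mathcal F\mid g\models\phi\}$, and for every closed FO+DTC$^k$ formula $\phi$ there is such an automaton $\mathcal A$ with the same property. That is, $\mathrm{DPTWA}^k=\mathrm{FO{+}DTC}^k$ on $\mathcal F$.
   Context: Graphs: nonempty finite directed graphs, weakly connected, whose nodes and edges are labelled from a common alphabet $\Sigma$, such that no node has two outgoing edges with the same label nor two incoming edges with the same label (parallel edges and loops allowed). Logic for graphs: node variables; atomic formulas $\mathrm{lab}_\sigma(x)$, $\mathrm{edg}_\sigma(x,y)$ ($\sigma$-labelled edge from $x$ to $y$), $x=y$; closed under $\neg,\wedge,\vee,\exists,\forall$. $k$-ary transitive closure: for $\phi$ with $k$-tuples $\bar x,\bar y$ of distinct free variables (other free variables fixed), $g\models\phi^*(\bar u,\bar v)$ iff there are $k$-tuples $\bar u_0=\bar u,\dots,\bar u_n=\bar v$ ($n\ge0$) with $g\models\phi(\bar u_i,\bar u_{i+1})$ for all $i<n$; deterministic if $\phi$ is functional (for every graph, valuation of the other variables and $\bar u$, at most one $\bar v$ satisfies $\phi(\bar u,\bar v)$). FO+DTC$^k$ allows only deterministic $k$-ary transitive closure. Automata: a $k$-head graph-walking automaton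 with nested pebbles is $\mathcal A=(Q,\Sigma,X,q_0,A,I)$ with finite states, finite pebble set $X$, initial state $q_0$, accepting states $A$, and instructions $\langle p,\chi,q\rangle$ where $\chi$ is $\mathrm{inmove}_{i,\sigma}$ / $\mathrm{outmove}_{i,\sigma}$ (move head $i$ backwards along its incoming / forwards along its outgoing $\sigma$-labelled edge), $\mathrm{drop}_i(x)$ (push $(x,u[i])$ on the pebble stack if $x$ is not on it), $\mathrm{retrieve}(x)$ (pop the top pair if its pebble is $x$, regardless of head positions), or a test $\mathrm{lab}_{i,\sigma}$, $\mathrm{peb}_i(x)$, $\mathrm{inedge}_{i,\sigma}$, $\mathrm{outedge}_{i,\sigma}$ on the node under head $i$ (label is $\sigma$; pebble $x$ lies there; has an incoming / outgoing $\sigma$-edge), or its negation. Configurations are $[p,\bar u,\alpha]$; halting if no instruction applies. $\mathrm{acc}(u)$ means that from $[q_0,(u,\dots,u),\varepsilon]$ some halting $[q,\bar v,\varepsilon]$ with $q\in A$ is reachable; automata are required to satisfy, for every graph over $\Sigma$, $\mathrm{acc}(u_1)\Rightarrow\mathrm{acc}(u_2)$ for all nodes $u_1,u_2$, and $L(\mathcal A)$ is the set of graphs $g$ with $\mathrm{acc}(u)$ for all nodes $u$. $\mathcal A$ is deterministic if any two distinct instructions from the same state have $\chi_1=\neg\chi_2$ or $\chi_2=\neg\chi_1$. Searchable: a family $\mathcal F$ is searchable if there is a fixed single-head deterministic graph-walking automaton with nested pebbles (the guide) such that for every graph in $\mathcal F$ and every node of it, when started at that node in its initial state, it halts after a walk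 during which every node of the graph is visited at least once. *)

(* Defs.v *)
From Stdlib Require Import Relation_Operators.
From mathcomp Require Import all_boot.

Set Implicit Arguments.
Unset Strict Implicit.
Unset Printing Implicit Defensive.

(* Since no node has two outgoing edges with the same label, an edge is
   determined by its source, label and target, so the edges form one relation
   per label; parallel edges are edges with different labels. *)
Record graph (Sigma : finType) := Graph {
  node :> finType;
  edge : Sigma -> rel node;
  label : node -> Sigma;
  graph_nonempty : 0 < #|node|;
  edge_out_inj : forall s (x y z : node), edge s x y -> edge s x z -> y = z;
  edge_in_inj : forall s (x y z : node), edge s y x -> edge s z x -> y = z;
  weakly_connected : forall x y : node,
    connect (fun a b => [exists s, edge s a b || edge s b a]) x y
}.

(* Variables are natural numbers.  [FTC xs ys phi us vs] is phi^*(us, vs),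
   the closure being taken with respect to the variables xs, ys, which it
   binds in phi. *)
Inductive formula (Sigma : Type) (k : nat) : Type :=
  | FLab of Sigma & nat
  | FEdg of Sigma & nat & nat
  | FEq of nat & nat
  | FNot of formula Sigma k
  | FAnd of formula Sigma k & formula Sigma k
  | FOr of formula Sigma k & formula Sigma k
  | FEx of nat & formula Sigma k
  | FAll of nat & formula Sigma k
  | FTC (xs ys : k.-tuple nat) (phi : formula Sigma k) (us vs : k.-tuple nat).

Fixpoint fv (Sigma : Type) (k : nat) (phi : formula Sigma k) : seq nat :=
  match phi with
  | FLab _ x => [:: x]
  | FEdg _ x y => [:: x; y]
  | FEq x y => [:: x; y]
  | FNot p => fv p
  | FAnd p q => fv p ++ fv q
  | FOr p q => fv p ++ fv q
  | FEx x p => [seq z <- fv p | z != x]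
  | FAll x p => [seq z <- fv p | z != x]
  | FTC xs ys p us vs => [seq z <- fv p | z \notin xs ++ ys] ++ us ++ vs
  end.

Definition closed_formula (Sigma : Type) (k : nat) (phi : formula Sigma k) : Prop :=
  fv phi = [::].

(* Outside xs, [index z xs] is [size xs], so [nth] returns its default nu z
   when xs and a have the same length. *)
Definition upd (T : Type) (nu : nat -> T) (xs : seq nat) (a : seq T) : nat -> T :=
  fun z => nth (nu z) a (index z xs).

Fixpoint sat (Sigma : finType) (k : nat) (g : graph Sigma) (nu : nat -> g)
    (phi : formula Sigma k) : Prop :=
  match phi with
  | FLab s x => label (nu x) = s
  | FEdg s x y => edge s (nu x) (nu y)
  | FEq x y => nu x = nu y
  | FNot p => ~ sat nu p
  | FAnd p q => sat nu p /\ sat nu q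
  | FOr p q => sat nu p \/ sat nu q
  | FEx x p => exists a : g, sat (upd nu [:: x] [:: a]) p
  | FAll x p => forall a : g, sat (upd nu [:: x] [:: a]) p
  | FTC xs ys p us vs =>
      clos_refl_trans (k.-tuple g)
        (fun a b => sat (upd nu (xs ++ ys) (a ++ b)) p)
        (map_tuple nu us) (map_tuple nu vs)
  end.

Definition functional (Sigma : finType) (k : nat) (xs ys : k.-tuple nat)
    (phi : formula Sigma k) : Prop :=
  forall (g : graph Sigma) (nu : nat -> g) (a b b' : k.-tuple g),
    sat (upd nu (xs ++ ys) (a ++ b)) phi ->
    sat (upd nu (xs ++ ys) (a ++ b')) phi -> b = b'.

Fixpoint FO_DTC (Sigma : finType) (k : nat) (phi : formula Sigma k) : Prop :=
  match phi with
  | FLab _ _ | FEdg _ _ _ | FEq _ _ => True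
  | FNot p => FO_DTC p
  | FAnd p q => FO_DTC p /\ FO_DTC q
  | FOr p q => FO_DTC p /\ FO_DTC q
  | FEx _ p => FO_DTC p
  | FAll _ p => FO_DTC p
  | FTC xs ys p _ _ =>
      [/\ uniq (xs ++ ys), {subset xs ++ ys <= fv p}, functional xs ys p
        & FO_DTC p]
  end.

Definition models (Sigma : finType) (k : nat) (g : graph Sigma)
    (phi : formula Sigma k) : Prop :=
  forall nu : nat -> g, sat nu phi.

Inductive test (Sigma X : Type) (k : nat) : Type :=
  | TLab of 'I_k & Sigma
  | TPeb of 'I_k & X
  | TInEdge of 'I_k & Sigma
  | TOutEdge of 'I_k & Sigma.

Inductive action (Sigma X : Type) (k : nat) : Type :=
  | InMove of 'I_k & Sigma
  | OutMove of 'I_k & Sigma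
  | Drop of 'I_k & X
  | Retrieve of X
  | Pos of test Sigma X k
  | Neg of test Sigma X k.

Arguments Retrieve {Sigma X k}.

(* [instr p chi q] means that <p, chi, q> is an instruction. *)
Record pre_automaton (Sigma : finType) (k : nat) := PreAutomaton {
  state : finType;
  pebble : finType;
  init : state;
  final : {set state};
  instr : state -> action Sigma pebble k -> state -> bool
}.

Section Semantics.

Variables (Sigma : finType) (k : nat) (A : pre_automaton Sigma k).
Variable g : graph Sigma.

Definition stack : Type := seq (pebble A * g).

(* The top of the pebble stack is the head of the list. *)
Record config := Config {
  cstate : state A;
  heads : k.-tuple g;
  pebbles : stack
}.

Definition holds (t : test Sigma (pebble A) k) (u : k.-tuple g) (al : stack) :
    Prop :=
  match t with
  | TLab i s => label (tnth u i) = s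
  | TPeb i x => (x, tnth u i) \in al
  | TInEdge i s => exists v : g, edge s v (tnth u i)
  | TOutEdge i s => exists v : g, edge s (tnth u i) v
  end.

Definition move_head (u : k.-tuple g) (i : 'I_k) (v : g) : k.-tuple g :=
  [tuple if j == i then v else tnth u j | j < k].

Definition effect (chi : action Sigma (pebble A) k)
    (u : k.-tuple g) (al : stack) (u' : k.-tuple g) (al' : stack) : Prop :=
  match chi with
  | InMove i s =>
      exists v : g, [/\ edge s v (tnth u i), u' = move_head u i v & al' = al]
  | OutMove i s =>
      exists v : g, [/\ edge s (tnth u i) v, u' = move_head u i v & al' = al]
  | Drop i x =>
      [/\ x \notin map fst al, u' = u & al' = (x, tnth u i) :: al]
  | Retrieve x => u' = u /\ exists v : g, al = (x, v) :: al'
  | Pos t => [/\ holds t u al, u' = u & al' = al]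
  | Neg t => [/\ ~ holds t u al, u' = u & al' = al]
  end.

Definition step (c c' : config) : Prop :=
  exists2 chi, instr (cstate c) chi (cstate c')
             & effect chi (heads c) (pebbles c) (heads c') (pebbles c').

Definition halting (c : config) : Prop := forall c', ~ step c c'.

Definition start (u : g) : config := Config (init A) (nseq_tuple k u) [::].

Definition acc (u : g) : Prop :=
  exists (q : state A) (v : k.-tuple g),
    [/\ q \in final A,
        clos_refl_trans config step (start u) (Config q v [::])
      & halting (Config q v [::])].

End Semantics.

Record automaton (Sigma : finType) (k : nat) := Automaton {
  pre_aut :> pre_automaton Sigma k;
  start_independent : forall (g : graph Sigma) (u1 u2 : g),
    acc pre_aut u1 -> acc pre_aut u2
}.

Definition accepts (Sigma : finType) (k : nat) (A : automaton Sigma k)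
    (g : graph Sigma) : Prop :=
  forall u : g, acc A u.

Definition opposite (Sigma X : Type) (k : nat) (chi1 chi2 : action Sigma X k) :
    Prop :=
  exists t, (chi1 = Neg t /\ chi2 = Pos t) \/ (chi1 = Pos t /\ chi2 = Neg t).

Definition deterministic (Sigma : finType) (k : nat) (A : automaton Sigma k) :
    Prop :=
  forall (p : state A) chi1 q1 chi2 q2,
    instr p chi1 q1 -> instr p chi2 q2 -> (chi1, q1) <> (chi2, q2) ->
    opposite chi1 chi2.

Definition guides (Sigma : finType) (A : automaton Sigma 1) (g : graph Sigma)
    (u : g) : Prop :=
  exists (n : nat) (c : nat -> config A g),
    [/\ c 0 = start A u,
        forall i, i < n -> step (c i) (c i.+1),
        halting (c n)
      & forall v : g, exists2 i, i <= n & tnth (heads (c i)) ord0 = v].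

Definition searchable (Sigma : finType) (F : graph Sigma -> Prop) : Prop :=
  exists2 A : automaton Sigma 1, deterministic A
    & forall g : graph Sigma, F g -> forall u : g, guides A u.

(* Main.v *)
(** From automata to formulas: what a deterministic automaton does between
    dropping a pebble and retrieving it leaves the stack below unchanged, so it
    counts as one macro step at the level below; macro steps are definable by
    induction on the number of pebbles still available.  Runs of macro steps are
    handled by eliminating states as in Kleene's theorem: the only closures
    needed are those of the relations "first return to state r", which are
    functional because the automaton is deterministic.

    From formulas to automata: formulas are evaluated recursively, with a pebble
    on the value of each variable.  A quantifier runs through all nodes by
    simulating the guide with fresh pebbles.  For phi^*(u, v), following phi from
    u might loop.  As phi is functional, however, the tuples that lead to v form
    a tree with root v, which is searched for u depth first; only the current
    tuple has to be remembered when pebbles are retrieved, and the k heads do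
    that.  The children of a tuple are ordered by the first visits of the guide.

    Acceptance must not depend on the initial node, even on graphs on which the
    guide fails.  Hence the automaton first checks that from every node the guide
    halts and visits all nodes, and goes on only if this is so: as graphs are
    connected, it is enough that the set of visited nodes is closed under
    adjacency. *)

From Stdlib Require Import Relation_Operators Operators_Properties.
From Stdlib Require List.
Require Import Defs.
From mathcomp Require Import all_boot.
From mathcomp Require Import boolp.

Set Implicit Arguments.
Unset Strict Implicit.
Unset Printing Implicit Defensive.

(** * Machines over an unbounded supply of pebbles *)

(** Programs are machines whose pebbles are natural numbers and whose exits return values; [den] is
    their input-output relation, so that correctness is proved compositionally and automata appear
    only in one compilation step. A program working at level l may use all pebbles from l on and
    gives the stack back as it found it. As a head cannot jump, it is brought to a pebbled node by
    walking it along the guide until it meets the pebble.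

    Both directions show that a class of predicates is closed under first-order operations
    ([closed_family]); predicates on k-tuples are handled through blocks of k variables. The moves
    of the depth-first search (first child, next sibling, parent) are first-order in phi and the
    order of tuples, so evaluating them needs no new programs.

    Conversely, a configuration consists of a state and k heads, but a closure of arity k has room
    for the heads only: this is why states have to be eliminated. The arity stays k at every nesting
    level because dropped pebbles become individual free variables, fixed during the inner
    computation. *)

Section Instructions.

Variables (Sigma : finType) (k : nat) (g : graph Sigma).

(** The semantics is restated without states and for any type of pebbles, so that one instruction
    can be read with the pebbles of an automaton, with natural numbers, or after a renaming. *)
Definition cfg (X : Type) : Type := k.-tuple g * seq (X * g).

Definition pholds (X : eqType) (t : test Sigma X k) (c : cfg X) : Prop :=
  match t with
  | TLab i s => label (tnth c.1 i) = s
  | TPeb i x => (x, tnth c.1 i) \in c.2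
  | TInEdge i s => exists v : g, edge s v (tnth c.1 i)
  | TOutEdge i s => exists v : g, edge s (tnth c.1 i) v
  end.

Definition peffect (X : eqType) (chi : action Sigma X k) (c c' : cfg X) :
    Prop :=
  match chi with
  | InMove i s =>
      exists v : g,
        [/\ edge s v (tnth c.1 i), c'.1 = move_head c.1 i v & c'.2 = c.2]
  | OutMove i s =>
      exists v : g,
        [/\ edge s (tnth c.1 i) v, c'.1 = move_head c.1 i v & c'.2 = c.2]
  | Drop i x =>
      [/\ x \notin map fst c.2, c'.1 = c.1 & c'.2 = (x, tnth c.1 i) :: c.2]
  | Retrieve x => c'.1 = c.1 /\ exists v : g, c.2 = (x, v) :: c'.2
  | Pos t => [/\ pholds t c, c'.1 = c.1 & c'.2 = c.2]
  | Neg t => [/\ ~ pholds t c, c'.1 = c.1 & c'.2 = c.2]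
  end.

Lemma peffect_fun (X : eqType) (chi : action Sigma X k) c c1 c2 :
  peffect chi c c1 -> peffect chi c c2 -> c1 = c2.
Proof.
case: c => u al; case: c1 => u1 al1; case: c2 => u2 al2.
case: chi => [i s|i s|i x|x|t|t] /=.
- move=> [v [e -> ->]] [w [e' -> ->]].
  by rewrite (edge_in_inj e e').
- move=> [v [e -> ->]] [w [e' -> ->]].
  by rewrite (edge_out_inj e e').
- by move=> [_ -> ->] [_ -> ->].
- by move=> [-> [v ->]] [-> [w [_ ->]]].
- by move=> [_ -> ->] [_ -> ->].
- by move=> [_ -> ->] [_ -> ->].
Qed.

Definition test_map (X Y : Type) (f : X -> Y) (t : test Sigma X k) :
    test Sigma Y k :=
  match t with
  | TLab i s => TLab Y i s
  | TPeb i x => TPeb Sigma i (f x)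
  | TInEdge i s => TInEdge Y i s
  | TOutEdge i s => TOutEdge Y i s
  end.

Definition action_map (X Y : Type) (f : X -> Y) (chi : action Sigma X k) :
    action Sigma Y k :=
  match chi with
  | InMove i s => InMove Y i s
  | OutMove i s => OutMove Y i s
  | Drop i x => Drop Sigma i (f x)
  | Retrieve x => Retrieve (f x)
  | Pos t => Pos (test_map f t)
  | Neg t => Neg (test_map f t)
  end.

Definition stack_map (X Y : Type) (f : X -> Y) (al : seq (X * g)) :
    seq (Y * g) := [seq (f xv.1, xv.2) | xv <- al].

Section Map.

Variables (X Y : eqType) (f : X -> Y).
Hypothesis f_inj : injective f.

Lemma test_map_inj : injective (test_map f).
Proof.
move=> [i s|i x|i s|i s] [j s'|j y|j s'|j s'] //= [].
- by move=> -> ->.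
- by move=> -> /f_inj ->.
- by move=> -> ->.
- by move=> -> ->.
Qed.

Lemma action_map_inj : injective (action_map f).
Proof.
move=> [i s|i s|i x|x|t|t] [j s'|j s'|j y|y|t'|t'] //= [].
- by move=> -> ->.
- by move=> -> ->.
- by move=> -> /f_inj ->.
- by move=> /f_inj ->.
- by move=> /test_map_inj ->.
- by move=> /test_map_inj ->.
Qed.

Lemma mem_stack_map x v al :
  ((f x, v) \in stack_map f al) = ((x, v) \in al).
Proof.
rewrite -(mem_map (_ : injective (fun xv : X * g => (f xv.1, xv.2)))) //.
by move=> [y w] [y' w'] /= [/f_inj -> ->].
Qed.

Lemma pholds_map t u al :
  pholds (test_map f t) (u, stack_map f al) <-> pholds t (u, al).
Proof. by case: t => [i s|i x|i s|i s] //=; rewrite mem_stack_map. Qed.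

Lemma stack_map_fst al : map fst (stack_map f al) = map f (map fst al).
Proof. by rewrite -!map_comp. Qed.

(** Injectivity keeps fresh pebbles fresh and the top pebble recognisable. The resulting stack is
    again a renamed one, so a renamed run never leaves the image of [stack_map]. *)
Lemma peffect_map chi u al u' al1 :
  peffect (action_map f chi) (u, stack_map f al) (u', al1) <->
  exists2 al', al1 = stack_map f al' & peffect chi (u, al) (u', al').
Proof.
case: chi => [i s|i s|i x|x|t|t] /=.
- split=> [[v [e -> ->]]|[al' -> [v [e -> ->]]]]; last by exists v.
  by exists al => //; exists v.
- split=> [[v [e -> ->]]|[al' -> [v [e -> ->]]]]; last by exists v.
  by exists al => //; exists v.
- rewrite stack_map_fst mem_map //.
  split=> [[n -> ->]|[al' -> [n -> ->]]]; last by [].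
  by exists ((x, tnth u i) :: al).
- split=> [[-> [v E]]|[al' -> [-> [v ->]]]]; last by split=> //; exists v.
  case: al E => [//|[y w] al] /= [/f_inj -> -> <-].
  by exists al => //; split=> //; exists v.
- split=> [[/pholds_map h -> ->]|[al' -> [h -> ->]]]; first by exists al.
  by split=> //; apply/pholds_map.
- split=> [[h -> ->]|[al' -> [h -> ->]]].
    by exists al => //; split=> // /pholds_map.
  by split=> // /pholds_map.
Qed.

End Map.

End Instructions.

Section StepPeffect.

Variables (Sigma : finType) (k : nat) (A : pre_automaton Sigma k).
Variable g : graph Sigma.

Definition cfg_of (c : config A g) : cfg k g (pebble A) := (heads c, pebbles c).

Lemma stepE (c c' : config A g) :
  step c c' <-> exists2 chi, instr (cstate c) chi (cstate c')
                           & peffect chi (cfg_of c) (cfg_of c').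
Proof. by split=> -[chi i e]; exists chi => //; case: chi i e => // -[]. Qed.

End StepPeffect.

(** Distinct instructions at a state are a test and its negation, which never both apply; a single
    instruction has one effect at most, by [peffect_fun]. *)
Lemma step_det (Sigma : finType) (k : nat) (A : automaton Sigma k)
    (Adet : deterministic A) (g : graph Sigma) (c c1 c2 : config A g) :
  step c c1 -> step c c2 -> c1 = c2.
Proof.
move=> /stepE [chi1 i1 e1] /stepE [chi2 i2 e2].
have [[E1 E2]|/Adet -/(_ _ i1 i2) [t]] :=
  EM ((chi1, cstate c1) = (chi2, cstate c2)).
  rewrite {}E1 in e1; have := peffect_fun e1 e2.
  by case: c1 c2 {i1 i2 e1 e2} E2 => [? ? ?] [? ? ?] /= -> [-> ->].
by move=> [] [E1 E2]; move: e1 e2; rewrite E1 E2 => -[h _ _] [h' _ _].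
Qed.

(** * Machines with several exits, their runs and their combinators *)

Section Machines.

Variables (Sigma : finType) (k : nat).

(** A state carries one action or one two-way test, so determinism is a matter of syntax. Successors
    in [O] are exits: leaving through [o] returns the value [o]. *)
Inductive code (S O : Type) : Type :=
  | CAct of action Sigma nat k & S + O
  | CTst of test Sigma nat k & S + O & S + O.

Record machine (O : Type) := Machine {
  mstate : finType;
  mentry : mstate;
  mcode : mstate -> code mstate O
}.

Definition code_map (S O S' O' : Type) (h : S + O -> S' + O') (d : code S O) :
    code S' O' :=
  match d with
  | CAct chi n => CAct chi (h n)
  | CTst t n1 n2 => CTst t (h n1) (h n2)
  end.

Section Run.

Variable g : graph Sigma.
Local Notation cfg := (cfg k g nat).

Definition cstep (S O : Type) (d : code S O) (c : cfg) (n : S + O) (c' : cfg) :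
    Prop :=
  match d with
  | CAct chi n0 => n = n0 /\ peffect chi c c'
  | CTst t n1 n2 => c' = c /\ (pholds t c /\ n = n1 \/ ~ pholds t c /\ n = n2)
  end.

Lemma cstep_map S O S' O' (h : S + O -> S' + O') (d : code S O) c n c' :
  cstep (code_map h d) c n c' <-> exists2 m, n = h m & cstep d c m c'.
Proof.
case: d => [chi n0|t n1 n2] /=.
  by split=> [[-> e]|[m -> [-> e]]] //; exists n0.
split=> [[-> [[p ->]|[p ->]]]|[m -> [-> [[p ->]|[p ->]]]]].
- by exists n1 => //; split=> //; left.
- by exists n2 => //; split=> //; right.
- by split=> //; left.
- by split=> //; right.
Qed.

Lemma cstep_det S O (d : code S O) c n1 c1 n2 c2 :
  cstep d c n1 c1 -> cstep d c n2 c2 -> (n1, c1) = (n2, c2).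
Proof.
case: d => [chi n0|t m1 m2] /=.
  by move=> [-> e1] [-> /(peffect_fun e1) ->].
by move=> [-> [[p ->]|[p ->]]] [-> [[p' ->]|[p' ->]]].
Qed.

Inductive mrun (S O : Type) (d : S -> code S O) :
    S + O -> cfg -> O -> cfg -> Prop :=
  | mrun_exit o c : mrun d (inr o) c o c
  | mrun_step q c n c' o c'' :
      cstep (d q) c n c' -> mrun d n c' o c'' -> mrun d (inl q) c o c''.

Lemma mrun_inv S O (d : S -> code S O) n c o c' :
  mrun d n c o c' <->
  match n with
  | inl q => exists n' c1, cstep (d q) c n' c1 /\ mrun d n' c1 o c'
  | inr o' => o' = o /\ c = c'
  end.
Proof.
split; first by case=> // q {}c n' c1 o' c'' s r; exists n', c1.
case: n => [q [n' [c1 [s r]]]|o' [<- <-]]; first exact: mrun_step s r.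
exact: mrun_exit.
Qed.

(** Only completed runs are related; a run that diverges or gets stuck is simply absent. *)
Definition den (O : Type) (m : machine O) (c : cfg) (o : O) (c' : cfg) : Prop :=
  mrun (@mcode O m) (inl (mentry m)) c o c'.

Lemma mrun_det S O (d : S -> code S O) n c o1 c1 o2 c2 :
  mrun d n c o1 c1 -> mrun d n c o2 c2 -> o1 = o2 /\ c1 = c2.
Proof.
move=> r1; elim: r1 o2 c2 => {n c o1 c1} [o c|q c n c' o c'' s _ IH] o2 c2.
  by case/mrun_inv.
case/mrun_inv=> n' [c1 [s' r]].
by case: (cstep_det s s') => E1 E2; apply: IH; rewrite E1 E2.
Qed.

Lemma den_det O (m : machine O) c o1 c1 o2 c2 :
  den m c o1 c1 -> den m c o2 c2 -> o1 = o2 /\ c1 = c2.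
Proof. exact: mrun_det. Qed.

End Run.

(* There is no idling instruction; a test of an arbitrary pebble serves. *)
Variable i0 : 'I_k.

Definition mret (O : Type) (o : O) : machine O :=
  @Machine O unit tt (fun _ => CTst (TPeb Sigma i0 0) (inr o) (inr o)).

Definition mact (chi : action Sigma nat k) : machine unit :=
  @Machine unit unit tt (fun _ => CAct chi (inr tt)).

Definition mtst (t : test Sigma nat k) : machine bool :=
  @Machine bool unit tt (fun _ => CTst t (inr true) (inr false)).

Section Bind.

Variables (O : finType) (O' : Type) (m : machine O) (f : O -> machine O').

(** One copy of the second machine for each value returned by the first: the value is remembered in
    the control, which is why [O] has to be finite. *)
Definition bind_state : finType := (mstate m + {o : O & mstate (f o)})%type.

Definition bind_snd (o : O) (n : mstate (f o) + O') : bind_state + O' :=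
  match n with
  | inl q => inl (inr (Tagged (fun o => mstate (f o)) q))
  | inr o' => inr o'
  end.

Definition bind_fst (n : mstate m + O) : bind_state + O' :=
  match n with
  | inl q => inl (inl q)
  | inr o => bind_snd (inl (mentry (f o)))
  end.

Definition mbind : machine O' :=
  @Machine O' bind_state (inl (mentry m))
    (fun q => match q with
     | inl q => code_map bind_fst (mcode q)
     | inr q => code_map (@bind_snd (tag q)) (mcode (tagged q))
     end).

End Bind.

Section Loop.

Variables (S : finType) (O : Type) (f : S -> machine (S + O)).

(** The loop variable [s] lives in the control: [inl s'] repeats the body with [s'], [inr o] leaves
    the loop. *)
Definition loop_next (s : S) (n : mstate (f s) + (S + O)) :
    {s : S & mstate (f s)} + O :=
  match n with
  | inl q => inl (Tagged (fun s => mstate (f s)) q)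
  | inr (inl s') => inl (Tagged (fun s => mstate (f s)) (mentry (f s')))
  | inr (inr o) => inr o
  end.

Definition mloop (s : S) : machine O :=
  @Machine O {s : S & mstate (f s)}
    (Tagged (fun s => mstate (f s)) (mentry (f s)))
    (fun q => code_map (@loop_next (tag q)) (mcode (tagged q))).

End Loop.

Section Den.

Variable g : graph Sigma.
Local Notation cfg := (cfg k g nat).

Lemma den_ret O (o : O) (c : cfg) o' c' :
  den (mret o) c o' c' <-> o' = o /\ c' = c.
Proof.
rewrite /den mrun_inv /=; split=> [[n [c1 [[-> s]]]]|[-> ->]].
  by case: s => -[_ ->] /mrun_inv [-> ->].
exists (inr o), c; split; last exact: mrun_exit.
by split=> //; have [p|p] := EM ((0, tnth c.1 i0) \in c.2); [left | right].
Qed.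

Lemma den_act chi (c : cfg) o c' : den (mact chi) c o c' <-> peffect chi c c'.
Proof.
rewrite /den mrun_inv /=; split=> [[n [c1 [[-> s]]]]|e].
  by case/mrun_inv=> _ <-.
by case: o; exists (inr tt), c'; split=> //; apply: mrun_exit.
Qed.

Lemma den_tst t (c : cfg) (b : bool) c' :
  den (mtst t) c b c' <-> (b <-> pholds t c) /\ c' = c.
Proof.
rewrite /den mrun_inv /=; split=> [[n [c1 [[-> s]]]]|[E ->]].
  by case: s => -[p ->] /mrun_inv [<- <-].
exists (inr b), c; split; last exact: mrun_exit.
by split=> //; case: b E => -[p q]; [left | right]; split=> //; auto.
Qed.

Section DenBind.

Variables (O : finType) (O' : Type) (m : machine O) (f : O -> machine O').

Lemma mrun_bind_snd o n (c : cfg) o' c' :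
  mrun (@mcode _ (mbind m f)) (bind_snd m n) c o' c' <->
  mrun (@mcode _ (f o)) n c o' c'.
Proof.
split=> [r|].
  move: {-3}(bind_snd m n) r (erefl (bind_snd m n)) => n1 r.
  elim: r n => {n1 c o' c'} [o' c|q c n1 c1 o' c' s _ IH] [q'|o1] //.
    by move=> [->]; apply: mrun_exit.
  move=> [E]; move: s; rewrite E /= cstep_map => -[n E' s].
  by apply: mrun_step s _; apply: IH.
elim=> {n c o' c'} [o' c|q c n c1 o' c' s _ IH]; first exact: mrun_exit.
by apply: mrun_step IH; rewrite /= cstep_map; exists n.
Qed.

Lemma mrun_bind_fst n (c : cfg) o' c' :
  mrun (@mcode _ (mbind m f)) (bind_fst f n) c o' c' <->
  exists o c1, mrun (@mcode _ m) n c o c1 /\ den (f o) c1 o' c'.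
Proof.
split=> [r|[o [c1 [r1 r2]]]].
  move: {-3}(bind_fst f n) r (erefl (bind_fst f n)) => n1 r.
  elim: r n => {n1 c o' c'} [o' c|q c n1 c1 o' c' s r IH] [q'|o1] //.
    move=> [E]; move: s; rewrite E /= cstep_map => -[n E' s].
    have [o [c2 [r1 r2]]] := IH _ E'.
    by exists o, c2; split=> //; apply: mrun_step r1.
  move=> [E]; exists o1, c; split; first exact: mrun_exit.
  rewrite /den -mrun_bind_snd /= /Tagged -E.
  by apply: mrun_step r.
elim: r1 r2 => {n c o c1} [o c|q c n c1 o c2 s _ IH] r2.
  by apply/mrun_bind_snd.
by apply: mrun_step (IH r2); rewrite /= cstep_map; exists n.
Qed.

Lemma den_bind (c : cfg) o' c' :
  den (mbind m f) c o' c' <->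
  exists o c1, den m c o c1 /\ den (f o) c1 o' c'.
Proof. by rewrite -mrun_bind_fst. Qed.

End DenBind.

Section DenLoop.

Variables (S : finType) (O : Type) (f : S -> machine (S + O)).

Inductive loop_den : S -> cfg -> O -> cfg -> Prop :=
  | loop_stop s c o c' : den (f s) c (inr o) c' -> loop_den s c o c'
  | loop_cont s c s' c1 o c' :
      den (f s) c (inl s') c1 -> loop_den s' c1 o c' -> loop_den s c o c'.

Lemma mrun_loop s n (c : cfg) o c' s0 :
  mrun (@mcode _ (mloop f s0)) (loop_next n) c o c' <->
  exists r c1, mrun (@mcode _ (f s)) n c r c1 /\
    match r with
    | inl s' => loop_den s' c1 o c'
    | inr o' => o' = o /\ c1 = c'
    end.
Proof.
split=> [r|].
  move: {-3}(loop_next n) r (erefl (loop_next n)) => n1 r.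
  elim: r s n => {n1 c o c'} [o c|q c n1 c1 o c' st r IH] s [q'|[s'|o1]] //.
  - by move=> [->]; exists (inr o1), c; split=> //; apply: mrun_exit.
  - move=> [E]; move: st; rewrite E /= cstep_map => -[n E' st].
    have [r' [c3 [r1 r2]]] := IH _ _ E'.
    by exists r', c3; split=> //; apply: mrun_step r1.
  - move=> [E]; move: st; rewrite E /= cstep_map => -[n E' st].
    have [r' [c3 [r1 r2]]] := IH _ _ E'.
    exists (inl s'), c; split; first exact: mrun_exit.
    have {}r1 : den (f s') c r' c3 by apply: mrun_step r1.
    case: r' r1 r2 => [s1|o1] r1 r2; first exact: loop_cont r2.
    by case: r2 r1 => -> ->; apply: loop_stop.
have H s1 n1 (c1 : cfg) r c2 o1 c3 : mrun (@mcode _ (f s1)) n1 c1 r c2 ->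
   mrun (@mcode _ (mloop f s0))
     (loop_next (inr r : mstate (f s1) + (S + O))) c2 o1 c3 ->
   mrun (@mcode _ (mloop f s0)) (loop_next n1) c1 o1 c3.
  elim=> {n1 c1 r c2} [//|q c1 n1 c2 r c4 st _ IH] /IH {}IH.
  by apply: mrun_step IH; rewrite /= cstep_map; exists n1.
have H' s1 (c1 : cfg) o1 c2 : loop_den s1 c1 o1 c2 ->
   mrun (@mcode _ (mloop f s0)) (loop_next (inl (mentry (f s1)))) c1 o1 c2.
  elim=> {s1 c1 o1 c2} [s1 c1 o1 c2 r|s1 c1 s2 c2 o1 c3 r _ IH].
    by apply: H r _; apply: mrun_exit.
  by apply: H r _; apply: IH.
move=> [r [c1 [r1]]] r2; apply: H r1 _.
case: r r2 => [s'|o']; first exact: H'.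
by move=> [-> ->]; apply: mrun_exit.
Qed.

Lemma den_loop s (c : cfg) o c' :
  den (mloop f s) c o c' <-> loop_den s c o c'.
Proof.
rewrite /den (mrun_loop (inl (mentry (f s)))); split.
  move=> [[s'|o'] [c1 [r]]]; first exact: loop_cont r.
  by move=> [<- <-]; apply: loop_stop.
case=> {s c o c'} [s c o c' r|s c s' c1 o c' r l].
  by exists (inr o), c'.
by exists (inl s'), c1.
Qed.

End DenLoop.

End Den.

End Machines.

(** * Compilation into automata *)

Section Compile.

Variables (Sigma : finType) (k : nat) (m : machine Sigma k bool).

Definition test_pebble (t : test Sigma nat k) : nat :=
  if t is TPeb _ x then x else 0.

Definition code_pebble (S O : Type) (d : code Sigma k S O) : nat :=
  match d with
  | CAct (Drop _ x) _ | CAct (Retrieve x) _ => x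
  | CAct (Pos t) _ | CAct (Neg t) _ | CTst t _ _ => test_pebble t
  | _ => 0
  end.

Definition max_pebble : nat := \max_(q : mstate m) code_pebble (mcode q).

Notation peb := 'I_max_pebble.+1.

(** Actions are compared after mapping pebbles into [nat], so that no preimage has to be chosen. A
    test yields a [Pos] and a [Neg] instruction, the only branching that [deterministic] permits;
    exits get no instruction and therefore halt. *)
Definition compiled_instr (q : mstate m + bool) (chi : action Sigma peb k)
    (q' : mstate m + bool) : bool :=
  if q is inl q0 then
    match mcode q0 with
    | CAct a n => `[< action_map val chi = a >] && (q' == n)
    | CTst t n1 n2 => `[< action_map val chi = Pos t >] && (q' == n1) ||
                      `[< action_map val chi = Neg t >] && (q' == n2)
    end
  else false.

Definition compiled : pre_automaton Sigma k :=
  @PreAutomaton Sigma k (mstate m + bool)%type peb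
    (inl (mentry m)) [set inr true] compiled_instr.

Lemma test_map_val_surj (t : test Sigma nat k) :
  test_pebble t <= max_pebble ->
  exists t' : test Sigma peb k, t = test_map val t'.
Proof.
case: t => [i s|i x|i s|i s] /= le.
- by exists (TLab _ i s).
- by exists (TPeb Sigma i (Ordinal (le : x < _.+1))).
- by exists (TInEdge _ i s).
- by exists (TOutEdge _ i s).
Qed.

Lemma action_map_val_surj S O (a : action Sigma nat k) (n : S + O) :
  code_pebble (CAct a n) <= max_pebble ->
  exists a' : action Sigma peb k, a = action_map val a'.
Proof.
case: a => [i s|i s|i x|x|t|t] /= le.
- by exists (InMove _ i s).
- by exists (OutMove _ i s).
- by exists (Drop Sigma i (Ordinal (le : x < _.+1))).
- by exists (Retrieve (Ordinal (le : x < _.+1))).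
- by have [t' ->] := test_map_val_surj le; exists (Pos t').
- by have [t' ->] := test_map_val_surj le; exists (Neg t').
Qed.

Lemma compiled_det p chi1 q1 chi2 q2 :
  compiled_instr p chi1 q1 -> compiled_instr p chi2 q2 ->
  (chi1, q1) <> (chi2, q2) -> opposite chi1 chi2.
Proof.
have posE (chi : action Sigma peb k) t : action_map val chi = Pos t ->
    exists2 t', chi = Pos t' & test_map val t' = t.
  by case: chi => // t' [<-]; exists t'.
have negE (chi : action Sigma peb k) t : action_map val chi = Neg t ->
    exists2 t', chi = Neg t' & test_map val t' = t.
  by case: chi => // t' [<-]; exists t'.
have inj := action_map_inj (@val_inj _ _ peb).
case: p => //= p; case: (mcode p) => [a n|t n1 n2].
  by move=> /andP[/asboolP <- /eqP ->] /andP[/asboolP /inj -> /eqP ->].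
move=> /orP[|] /andP[/asboolP E1 /eqP ->] /orP[|] /andP[/asboolP E2 /eqP ->].
- by case; congr pair; apply: inj; rewrite E1.
- have [t1 -> Et] := posE _ _ E1.
  have [t2 ->] := negE _ _ E2; rewrite -Et => /(test_map_inj val_inj) ->;
  by exists t1; right.
- have [t1 -> Et] := negE _ _ E1.
  have [t2 ->] := posE _ _ E2; rewrite -Et => /(test_map_inj val_inj) ->;
  by exists t1; left.
- by case; congr pair; apply: inj; rewrite E1.
Qed.

Variable g : graph Sigma.

Lemma compiled_step q u (al : stack compiled g) n u' al1 :
  cstep (@mcode _ _ _ m q) (u, stack_map val al) n (u', al1) <->
  exists2 al', al1 = stack_map val al' &
    step (@Config _ _ compiled g (inl q) u al)
      (@Config _ _ compiled g n u' al').
Proof.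
have le : code_pebble (mcode q) <= max_pebble by apply: (leq_bigmax q).
split.
  case E: (mcode q) le => [a n0|t n1 n2] le.
    have [a' Ea] := action_map_val_surj le.
    move=> [En]; rewrite Ea peffect_map; last exact: val_inj.
    move=> [al' -> e]; exists al' => //; apply/stepE; exists a' => //=.
    by rewrite /compiled_instr /= E Ea En eqxx andbT; apply/asboolP.
  have [t' Et] := test_map_val_surj le.
  move=> [[-> ->]]; rewrite Et pholds_map; last exact: val_inj.
  move=> h; exists al => //; apply/stepE; case: h => -[h En].
    exists (Pos t') => //=; rewrite /compiled_instr /= E Et En eqxx.
    by apply/orP; left; rewrite andbT; apply/asboolP.
  exists (Neg t') => //=; rewrite /compiled_instr /= E Et En eqxx.
  by apply/orP; right; rewrite andbT; apply/asboolP.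
move=> [al' -> /stepE [chi /= i e]]; move: i.
have {}e : peffect (action_map val chi) (u, stack_map val al)
    (u', stack_map val al').
  by apply/peffect_map; [exact: val_inj | exists al'].
rewrite /compiled_instr /=; case: (mcode q) => [a n0|t n1 n2].
  by move=> /andP[/asboolP <- /eqP ->].
move=> /orP[|] /andP[/asboolP E /eqP ->].
  by rewrite E in e; case: e => h /= -> ->; split=> //; left.
by rewrite E in e; case: e => h /= -> ->; split=> //; right.
Qed.

Lemma compiled_mrun n u (al : stack compiled g) b u' al1 :
  mrun (@mcode _ _ _ m) n (u, stack_map val al) b (u', al1) <->
  exists2 al', al1 = stack_map val al' &
    clos_refl_trans _ (@step _ _ compiled g) (@Config _ _ compiled g n u al)
      (@Config _ _ compiled g (inr b) u' al').
Proof.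
split=> [r|[al' -> /clos_rt_rt1n_iff r]].
  move Ec: (u, stack_map val al) r => c; move Ec': (u', al1) => c' r.
  elim: r u al Ec u' al1 Ec' => {n c b c'} [b c|q c n c1 b c' st r IH] u al.
    move=> <- u' al1 [-> ->]; exists al => //; exact: rt_refl.
  move=> Ec u' al1 Ec'; move: st; rewrite -{}Ec.
  case: c1 r IH => u1 al2 _ IH /compiled_step [al3 E3 st].
  have [al' E r] := IH _ _ (congr1 (pair u1) (esym E3)) _ _ Ec'.
  by exists al' => //; apply: rt_trans r; apply: rt_step.
move Ec: (@Config _ _ compiled g n u al) r => c.
move Ec': (@Config _ _ compiled g (inr b) u' al') => c' r.
elim: r n u al Ec Ec' => {c c'} [c|c c1 c' st r IH] n u al Ec Ec'.
  by move: Ec'; rewrite -Ec => -[<- <- <-]; apply: mrun_exit.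
case: c1 r IH st => q1 u1 al1' r IH.
rewrite -Ec; case: n Ec => [q|b'] Ec st; last first.
  by case/stepE: st.
apply: mrun_step (IH _ _ _ erefl Ec').
by apply/compiled_step; exists al1'.
Qed.

Lemma compiled_acc (u : g) :
  acc compiled u <->
  exists v, den m (nseq_tuple k u, [::]) true (v, [::]).
Proof.
split=> [[q [v []]]|[v]].
  rewrite inE => /eqP -> r _; exists v.
  by apply/(compiled_mrun _ _ [::]); exists [::].
rewrite /den => /(compiled_mrun _ _ [::]) [[|//] _ r].
exists (inr true), v; split=> //; first by rewrite inE.
by move=> c /stepE [].
Qed.

End Compile.

(** * Simulation of the guide *)

(** A deterministic state has at most two instructions: a third would have to be opposite to both
    [Pos t] and [Neg t]. The list lets the simulation try all instructions, and lets formulas be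
    finite disjunctions over them. *)
Lemma instr_finite (Sigma : finType) (k : nat) (A : automaton Sigma k)
    (Adet : deterministic A) (p : state A) :
  exists l : seq (action Sigma (pebble A) k * state A),
    forall chi q, instr p chi q <-> List.In (chi, q) l.
Proof.
have [[c1 [q1 h1]]|none] := EM (exists chi q, instr p chi q); last first.
  by exists [::] => chi q; split=> // h; case: none; exists chi, q.
have [[c2 [q2 [h2 d12]]]|none] :=
  EM (exists chi q, instr p chi q /\ (c1, q1) <> (chi, q)); last first.
  exists [:: (c1, q1)] => chi q /=; split=> [h|[[<- <-]|]] //.
  by left; apply: contrapT => d; apply: none; exists chi, q.
exists [:: (c1, q1); (c2, q2)] => chi q /=.
split=> [h|[[<- <-]|[[<- <-]|]]] //.
apply: contrapT => /not_orP[n1] /not_orP[n2 _].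
have [t1 o1] := Adet _ _ _ _ _ h1 h2 d12.
have [t2 o2] := Adet _ _ _ _ _ h1 h n1.
have [t3 o3] := Adet _ _ _ _ _ h2 h n2.
by case: o1 o2 o3 => -[-> ->] [[]|[]] // [->] -> [[]|[]].
Qed.

Lemma move_head_id (Sigma : finType) k (g : graph Sigma) (u : k.-tuple g) i :
  move_head u i (tnth u i) = u.
Proof.
by apply: eq_from_tnth => j; rewrite tnth_mktuple; case: eqP => [->|].
Qed.

Lemma tnth_move_head (Sigma : finType) k (g : graph Sigma) (u : k.-tuple g) i v
    j :
  tnth (move_head u i v) j = if j == i then v else tnth u j.
Proof. by rewrite tnth_mktuple. Qed.

Lemma move_headK (Sigma : finType) k (g : graph Sigma) (u : k.-tuple g) i v w :
  move_head (move_head u i v) i w = move_head u i w.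
Proof. by apply: eq_from_tnth => j; rewrite !tnth_mktuple; case: eqP. Qed.

(** * Stack discipline: the pebbles from level l on are free *)

Section Stacks.

Variable T : eqType.

Definition okst (l : nat) (al : seq (nat * T)) : bool :=
  uniq (map fst al) && all (fun x => x < l) (map fst al).

Lemma okst_lt l al x v : okst l al -> (x, v) \in al -> x < l.
Proof.
by move=> /andP[_ /allP h] /(map_f fst) /h.
Qed.

Lemma okst_fun l al x v w :
  okst l al -> (x, v) \in al -> (x, w) \in al -> v = w.
Proof.
move=> /andP[+ _]; elim: al => //= -[y z] al IH /= /andP[nin un].
rewrite !inE => /orP[/eqP[E1 E2]|h1] /orP[/eqP[E3 E4]|h2].
- by rewrite E2 E4.
- by case/negP: nin; rewrite -E1; exact: (map_f fst h2).
- by case/negP: nin; rewrite -E3; exact: (map_f fst h1).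
- exact: IH.
Qed.

Lemma okst_cat l l' be al :
  okst l al -> uniq (map fst be) ->
  all (fun x => l <= x < l') (map fst be) -> l <= l' -> okst l' (be ++ al).
Proof.
move=> /andP[un lt] unb ran le; rewrite /okst map_cat cat_uniq unb un andbT /=.
rewrite all_cat; apply/and3P; split.
- apply/hasPn => x /(allP lt); apply: contraTN => /(allP ran) /andP[h _].
  by rewrite -leqNgt.
- by apply: sub_all ran => x /andP[].
- by apply: sub_all lt => x /leq_trans; apply.
Qed.

Lemma okst_cons l l' x v al :
  okst l al -> l <= x < l' -> okst l' ((x, v) :: al).
Proof.
move=> ok /andP[h1 h2]; rewrite -cat1s; apply: (okst_cat ok) => //=.
  by rewrite h1 h2.
by rewrite (leq_trans h1 (ltnW h2)).
Qed.

Lemma okst_notin l al x : okst l al -> l <= x -> x \notin map fst al.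
Proof.
by move=> /andP[_ /allP h] le; apply/negP => /h; rewrite ltnNge le.
Qed.

End Stacks.

Section DenIntro.

Variables (Sigma : finType) (k : nat) (i0 : 'I_k) (g : graph Sigma).
Implicit Types (c : cfg k g nat) (u : k.-tuple g).

Lemma den_bindI (O : finType) O' (m : machine Sigma k O)
    (f : O -> machine Sigma k O') c o c1 o' c' :
  den m c o c1 -> den (f o) c1 o' c' -> den (mbind m f) c o' c'.
Proof. by move=> h1 h2; apply/den_bind; exists o, c1. Qed.

Lemma den_retI O (o : O) c : den (mret Sigma i0 o) c o c.
Proof. exact/den_ret. Qed.

Lemma den_tst_ex t c : exists b : bool,
  (b <-> pholds t c) /\ den (mtst t) c b c.
Proof.
exists `[< pholds t c >]; split; first by split=> /asboolP.
by apply/den_tst; split=> //; split=> /asboolP.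
Qed.

Lemma den_drop i x u (al : seq (nat * g)) :
  x \notin map fst al ->
  den (mact (Drop Sigma i x)) (u, al) tt (u, (x, tnth u i) :: al).
Proof. by move=> h; apply/den_act. Qed.

Lemma den_retrieve x v u (al : seq (nat * g)) :
  den (mact (Retrieve x)) (u, (x, v) :: al) tt (u, al).
Proof. by apply/den_act; split=> //; exists v. Qed.

Lemma den_drop_inv i x u (al : seq (nat * g)) o u' al' :
  den (mact (Drop Sigma i x)) (u, al) o (u', al') ->
  [/\ x \notin map fst al, u' = u & al' = (x, tnth u i) :: al].
Proof. by move/den_act. Qed.

Lemma den_retrieve_inv x u y v (al : seq (nat * g)) o u' al' :
  den (mact (Retrieve x)) (u, (y, v) :: al) o (u', al') ->
  [/\ y = x, u' = u & al' = al].
Proof. by move/den_act => /= [-> [w [-> _ ->]]]. Qed.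

End DenIntro.

Section Guide.

Variables (Sigma : finType) (G : automaton Sigma 1).
Hypothesis Gdet : deterministic G.
Variables (k : nat) (i0 : 'I_k).

Notation X := (pebble G).
Notation machine := (machine Sigma k).
Notation ret := (mret Sigma i0).

Definition gpeb (l : nat) (x : X) : nat := l + enum_rank x.

Lemma gpeb_inj l : injective (gpeb l).
Proof. by move=> x y /addnI /ord_inj /enum_rank_inj. Qed.

Lemma gpeb_ran l x : l <= gpeb l x < l + #|X|.
Proof. by rewrite leq_addr ltn_add2l ltn_ord. Qed.

Definition emb (g : graph Sigma) l (be : stack G g) : seq (nat * g) :=
  stack_map (gpeb l) be.

Lemma emb_ok (g : graph Sigma) l (be : stack G g) al :
  okst l al -> uniq (map fst be) -> okst (l + #|X|) (emb l be ++ al).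
Proof.
move=> ok un; apply: (okst_cat ok); last by rewrite leq_addr.
  by rewrite stack_map_fst map_inj_uniq //; apply: gpeb_inj.
rewrite stack_map_fst; apply/allP => _ /mapP[x _ ->]; exact: gpeb_ran.
Qed.

Definition instrs (p : state G) : seq (action Sigma X 1 * state G) :=
  projT1 (cid (instr_finite Gdet p)).

Lemma instrsP p chi q : instr p chi q <-> List.In (chi, q) (instrs p).
Proof. exact: (projT2 (cid (instr_finite Gdet p))). Qed.

Section Step.

Variables (i : 'I_k) (l : nat).

Definition gtest (t : test Sigma X 1) : test Sigma nat k :=
  match t with
  | TLab _ s => TLab nat i s
  | TPeb _ x => TPeb Sigma i (gpeb l x)
  | TInEdge _ s => TInEdge nat i s
  | TOutEdge _ s => TOutEdge nat i s
  end.

(** The simulation has to notice when the guide halts, so applicability is decided before an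
    instruction is executed; for [Drop] and [Retrieve] the names [ns], top first, decide. *)
Definition genabled (ns : seq X) (chi : action Sigma X 1) : machine bool :=
  match chi with
  | InMove _ s => mtst (TInEdge nat i s)
  | OutMove _ s => mtst (TOutEdge nat i s)
  | Drop _ x => ret (x \notin ns)
  | Retrieve x => ret (ohead ns == Some x)
  | Pos t => mtst (gtest t)
  | Neg t => mbind (mtst (gtest t)) (fun b => ret (~~ b))
  end.

Definition gexec (chi : action Sigma X 1) : machine unit :=
  match chi with
  | InMove _ s => mact (InMove nat i s)
  | OutMove _ s => mact (OutMove nat i s)
  | Drop _ x => mact (Drop Sigma i (gpeb l x))
  | Retrieve x => mact (Retrieve (gpeb l x))
  | Pos _ | Neg _ => ret tt
  end.

Definition gnames (ns : seq X) (chi : action Sigma X 1) : seq X :=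
  match chi with
  | Drop _ x => x :: ns
  | Retrieve _ => behead ns
  | _ => ns
  end.

(* Which pebble is on top of the stack cannot be tested, so the names of the
   pebbles that the guide has dropped are recorded in the state. *)
Definition gstate : finType := (state G * #|X|.-bseq X)%type.

Fixpoint gtry (ns : seq X) (ins : seq (action Sigma X 1 * state G)) :
    machine (option gstate) :=
  match ins with
  | [::] => ret None
  | (chi, q) :: ins' =>
      mbind (genabled ns chi) (fun b : bool =>
        if b then mbind (gexec chi) (fun _ =>
          ret (Some (q, insub_bseq #|X| (gnames ns chi))))
        else gtry ns ins')
  end.

Definition gstep (s : gstate) : machine (option gstate) :=
  gtry s.2 (instrs s.1).

(** A walk can end while pebbles of the guide are still on the stack; they are exactly the recorded
    ones and are popped top first. *)
Fixpoint gclean (ns : seq X) : machine unit :=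
  if ns is x :: ns' then
    mbind (mact (Retrieve (gpeb l x))) (fun _ => gclean ns')
  else ret tt.

(* The guide moves head i and uses the pebbles from l to l + #|X| - 1; body is
   executed at each node visited, and ends the walk by returning Some o. *)
Definition walk_body (O : finType) (body : machine (option O)) (s : gstate) :
    machine (gstate + option O) :=
  mbind body (fun r => match r with
    | Some o => mbind (gclean s.2) (fun _ => ret (inr (Some o)))
    | None => mbind (gstep s) (fun r' => match r' with
        | Some s' => ret (inl s')
        | None => mbind (gclean s.2) (fun _ => ret (inr None))
        end)
    end).

Definition walk (O : finType) (body : machine (option O)) :
    machine (option O) :=
  mloop (walk_body body) (init G, insub_bseq #|X| [::]).

Definition gfind (x : nat) : machine (option unit) :=
  walk (mbind (mtst (TPeb Sigma i x)) (fun b : bool =>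
    ret (if b then Some tt else None))).

Section Graph.

Variable g : graph Sigma.
Variable al : seq (nat * g).
Hypothesis al_ok : okst l al.

Local Notation pos c := (tnth (heads c) ord0).

Lemma gtest_holds t u (w : 1.-tuple g) (be : stack G g) :
  tnth w ord0 = tnth u i ->
  pholds (gtest t) (u, emb l be ++ al) <-> pholds t (w, be).
Proof.
move=> E; case: t => [j s|j x|j s|j s] /=; rewrite ?[j]ord1 E //.
rewrite mem_cat mem_stack_map; last exact: gpeb_inj.
rewrite orb_idr // => /(okst_lt al_ok).
by rewrite ltnNge leq_addr.
Qed.

Lemma genabled_den chi u (w : 1.-tuple g) (be : stack G g) :
  tnth w ord0 = tnth u i ->
  exists b : bool, (b <-> exists c', peffect chi (w, be) c') /\
    den (genabled (map fst be) chi) (u, emb l be ++ al) b (u, emb l be ++ al).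
Proof.
move=> E; case: chi => [j s|j s|j x|x|t|t] /=; rewrite ?[j]ord1.
- have [b [Eb d]] := den_tst_ex (TInEdge nat i s) (u, emb l be ++ al).
  exists b; split=> //; rewrite Eb /= E; split=> [[v e]|[c' [v [e _ _]]]].
    by exists (move_head w ord0 v, be), v.
  by exists v.
- have [b [Eb d]] := den_tst_ex (TOutEdge nat i s) (u, emb l be ++ al).
  exists b; split=> //; rewrite Eb /= E; split=> [[v e]|[c' [v [e _ _]]]].
    by exists (move_head w ord0 v, be), v.
  by exists v.
- exists (x \notin map fst be); split; last exact: den_retI.
  split=> [h|[c' []]] //.
  by exists (w, (x, tnth w ord0) :: be).
- exists (ohead (map fst be) == Some x); split; last exact: den_retI.
  case: be => [|[y v] be] /=; split=> //.
  + by case=> c' [_ [v]].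
  + by move=> /eqP[->]; exists (w, be); split=> //; exists v.
  + by case=> c' [_ [v' [-> _ _]]]; rewrite eqxx.
- have [b [Eb d]] := den_tst_ex (gtest t) (u, emb l be ++ al).
  exists b; split=> //; rewrite Eb (gtest_holds _ _ E).
  by split=> [h|[c' []]] //; exists (w, be).
- have [b [Eb d]] := den_tst_ex (gtest t) (u, emb l be ++ al).
  exists (~~ b); split; last by apply: den_bindI d _; apply: den_retI.
  rewrite (gtest_holds _ _ E) in Eb; split.
    by move=> nb; exists (w, be); split=> // /Eb; apply/negP.
  by move=> [c' [h _ _]]; apply/negP => /Eb.
Qed.

Lemma gexec_den chi u (w w' : 1.-tuple g) (be be' : stack G g) :
  tnth w ord0 = tnth u i -> peffect chi (w, be) (w', be') ->
  den (gexec chi) (u, emb l be ++ al) tt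
    (move_head u i (tnth w' ord0), emb l be' ++ al) /\
  gnames (map fst be) chi = map fst be'.
Proof.
move=> E; case: chi => [j s|j s|j x|x|t|t] /=; rewrite ?[j]ord1.
- move=> [v [e -> ->]]; split=> //; apply/den_act; exists v.
  by rewrite -E tnth_move_head.
- move=> [v [e -> ->]]; split=> //; apply/den_act; exists v.
  by rewrite -E tnth_move_head.
- move=> [nin -> ->]; split=> //; rewrite E move_head_id; apply: den_drop.
  rewrite map_cat mem_cat stack_map_fst mem_map; last exact: gpeb_inj.
  rewrite negb_or nin; apply: okst_notin al_ok _; exact: leq_addr.
- move=> [-> [v ->]]; split=> //; rewrite E move_head_id.
  exact: den_retrieve.
- by move=> [_ -> ->]; rewrite E move_head_id; split=> //; apply: den_retI.
- by move=> [_ -> ->]; rewrite E move_head_id; split=> //; apply: den_retI.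
Qed.

Lemma step_uniq (c c' : config G g) :
  step c c' -> uniq (map fst (pebbles c)) -> uniq (map fst (pebbles c')).
Proof.
move=> [chi _]; case: chi => [j s|j s|j x|x|t|t] /=.
- by move=> [v [_ _ ->]].
- by move=> [v [_ _ ->]].
- by move=> [nin _ ->] /= ->; rewrite nin.
- by move=> [_ [v ->]] /= /andP[].
- by move=> [_ _ ->].
- by move=> [_ _ ->].
Qed.

Definition gmatch (s : gstate) (c : config G g) : Prop :=
  [/\ s.1 = cstate c, s.2 = map fst (pebbles c) :> seq X
    & uniq (map fst (pebbles c))].

(** Distinct names are at most #|X| many, so [insub_bseq] never falls back on its default. *)
Lemma insub_bseq_uniq (ns : seq X) :
  uniq ns -> insub_bseq #|X| ns = ns :> seq X.
Proof.
move=> un; rewrite /insub_bseq val_insubd /= -(card_uniqP un).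
by rewrite (max_card (mem ns)).
Qed.

Lemma gtry_none (c : config G g) ins u :
  pos c = tnth u i ->
  (forall chi q, List.In (chi, q) ins ->
     ~ exists c', peffect chi (heads c, pebbles c) c') ->
  den (gtry (map fst (pebbles c)) ins) (u, emb l (pebbles c) ++ al) None
    (u, emb l (pebbles c) ++ al).
Proof.
move=> E; elim: ins => [|[chi q] ins IH] none /=; first exact: den_retI.
have [b [Eb d]] := genabled_den chi (pebbles c) E.
apply: den_bindI d _; case: b Eb => Eb.
  by case: (none chi q (or_introl erefl)); apply/Eb.
by apply: IH => chi' q' h; apply: (none chi' q'); right.
Qed.

(** The step found need not lead to [c'] at this stage, since an earlier instruction of the list may
    apply; [gstep_some] identifies the two steps by determinism. *)
Lemma gtry_some (c : config G g) ins chi q c' u :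
  pos c = tnth u i -> uniq (map fst (pebbles c)) ->
  (forall chi q, List.In (chi, q) ins -> instr (cstate c) chi q) ->
  List.In (chi, q) ins -> peffect chi (heads c, pebbles c) c' ->
  exists c1 s1, [/\ step c c1, gmatch s1 c1 &
    den (gtry (map fst (pebbles c)) ins) (u, emb l (pebbles c) ++ al) (Some s1)
    (move_head u i (pos c1), emb l (pebbles c1) ++ al)].
Proof.
move=> E un; elim: ins => [//|[chi1 q1] ins IH] sub h e.
have [b [Eb d]] := genabled_den chi1 (pebbles c) E.
case: b Eb d => Eb d.
  have [[w1 be1] e1] := proj1 Eb isT.
  have [d1 En] := gexec_den E e1.
  have st : step c (@Config _ _ G g q1 w1 be1).
    apply/stepE; exists chi1; last exact: e1.
    by apply: sub; left.
  have un1 := step_uniq st un.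
  exists (@Config _ _ G g q1 w1 be1), (q1, insub_bseq #|X| (map fst be1)).
  split=> //; first by split=> //=; rewrite insub_bseq_uniq.
  by apply: den_bindI d _; apply: den_bindI d1 _; rewrite En; apply: den_retI.
have [] := IH _ _ e.
- by move=> chi2 q2 h2; apply: sub; right.
- case: h => // -[E1 _]; have := proj2 Eb.
  by rewrite E1 => /(_ (ex_intro _ c' e)).
move=> c1 [s1 [st m1 d1]]; exists c1, s1; split=> //.
exact: den_bindI d _.
Qed.

Lemma gstep_some s (c c' : config G g) u :
  gmatch s c -> pos c = tnth u i -> step c c' ->
  exists2 s', gmatch s' c' &
    den (gstep s) (u, emb l (pebbles c) ++ al) (Some s')
      (move_head u i (pos c'), emb l (pebbles c') ++ al).
Proof.
move=> [E1 E2 un] E st; have /stepE[chi ins e] := st.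
have [c1 [s1 [st1 m1 d1]]] : exists c1 s1, [/\ step c c1, gmatch s1 c1 &
    den (gtry (map fst (pebbles c)) (instrs (cstate c)))
      (u, emb l (pebbles c) ++ al) (Some s1)
      (move_head u i (pos c1), emb l (pebbles c1) ++ al)].
  apply: (gtry_some E un _ _ e); first by move=> chi1 q1 /instrsP.
  by apply/instrsP; exact: ins.
rewrite /gstep E1 E2; exists s1; last by rewrite (step_det Gdet st st1).
by rewrite (step_det Gdet st st1).
Qed.

Lemma gstep_none s (c : config G g) u :
  gmatch s c -> pos c = tnth u i -> halting c ->
  den (gstep s) (u, emb l (pebbles c) ++ al) None (u, emb l (pebbles c) ++ al).
Proof.
move=> [E1 E2 un] E h; rewrite /gstep E1 E2; apply: gtry_none => //.
move=> chi q /instrsP ins [[w be] e].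
by apply: (h (@Config _ _ G g q w be)); apply/stepE; exists chi.
Qed.

Lemma gclean_den (be : stack G g) u :
  den (gclean (map fst be)) (u, emb l be ++ al) tt (u, al).
Proof.
elim: be => [|[x v] be IH] /=; first exact: den_retI.
by apply: den_bindI IH; apply: den_retrieve.
Qed.

(** Order and repetitions are kept because first visits will be compared. Having a [vrun] includes
    that the guide halts. *)
Inductive vrun : config G g -> seq g -> Prop :=
  | vrun_halt (c : config G g) : halting c -> vrun c [:: pos c]
  | vrun_step (c c' : config G g) vs :
      step c c' -> vrun c' vs -> vrun c (pos c :: vs).

(** Meaningful even if the guide never halts: on an unchecked graph a successful search shows no
    more than this. *)
Definition gvisits (c : config G g) (v : g) : Prop :=
  exists2 c' : config G g, clos_refl_trans _ (@step _ _ G g) c c' & pos c' = v.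

Lemma vrun_visits (c : config G g) vs v : vrun c vs -> gvisits c v -> v \in vs.
Proof.
move=> r [c' /clos_rt_rt1n_iff st <-]; elim: st vs r.
  by move=> {}c vs []; move=> *; rewrite mem_head.
move=> c1 c2 c3 st _ IH vs r; case: r st => [c0 h /h//|c0 c0' {}vs st0 r st].
by rewrite inE IH ?orbT //; rewrite (step_det Gdet st st0).
Qed.

Lemma gvisits_step (c c' : config G g) v :
  step c c' -> gvisits c' v -> gvisits c v.
Proof.
by move=> st [c1 r E]; exists c1 => //; apply: rt_trans r; apply: rt_step.
Qed.

Lemma gmatch_start (v : g) : gmatch (init G, insub_bseq #|X| [::]) (start G v).
Proof. by split=> //=; rewrite insub_bseq_uniq. Qed.

Lemma start_pos (v : g) : pos (start G v) = v.
Proof. by []. Qed.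

Section Walk.

Variables (O : finType) (body : machine (option O)).
Variables (J : k.-tuple g -> Prop) (R0 : g -> Prop).
Variable R1 : g -> O -> k.-tuple g -> Prop.
Hypothesis J_move : forall u v, J u -> J (move_head u i v).

Definition above (al' : seq (nat * g)) : Prop :=
  okst (l + #|X|) al' /\ exists be : seq (nat * g), al' = be ++ al.

(** Loop rule: [J] is an invariant of the heads, [R0] holds at the nodes that the body lets pass,
    [R1] at the node where it stops. A body that returns [None] must leave head [i] on its node,
    since the guide resumes from there. *)
Lemma walk_total u vs :
  (forall u al', J u -> above al' ->
     exists o u', [/\ den body (u, al') o (u', al'), J u' &
       match o with
       | None => tnth u' i = tnth u i /\ R0 (tnth u i)
       | Some b => R1 (tnth u i) b u'
       end]) ->
  J u -> vrun (start G (tnth u i)) vs ->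
  exists o u', [/\ den (walk body) (u, al) o (u', al), J u' &
    match o with
    | None => forall v, v \in vs -> R0 v
    | Some b => exists vs1 v vs2, [/\ vs = vs1 ++ v :: vs2,
                  forall v', v' \in vs1 -> R0 v' & R1 v b u']
    end].
Proof.
move=> hbody Ju r.
suff H s (c : config G g) : vrun c vs -> gmatch s c -> pos c = tnth u i ->
  exists o u', [/\ loop_den (walk_body body) s (u, emb l (pebbles c) ++ al)
     o (u', al), J u' &
    match o with
    | None => forall v, v \in vs -> R0 v
    | Some b => exists vs1 v vs2, [/\ vs = vs1 ++ v :: vs2,
                  forall v', v' \in vs1 -> R0 v' & R1 v b u']
    end].
  have [//|o [u' [d Ju' h]]] := H _ _ r (gmatch_start _).
  by exists o, u'; split=> //; apply/den_loop.
move=> {}r; elim: r s u Ju => {c vs} [c hc|c c' vs st r IH] s u Ju m E.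
  have [_ E2 un] := m.
  have [|o [u1 [d1 J1 h1]]] := hbody u (emb l (pebbles c) ++ al) Ju.
    by split; [apply: emb_ok | exists (emb l (pebbles c))].
  case: o d1 h1 => [b|] d1 h1.
    exists (Some b), u1; split=> //.
      apply: loop_stop; apply: den_bindI d1 _; rewrite E2.
      by apply: den_bindI (gclean_den _ _) _; apply: den_retI.
    by exists [::], (pos c), [::]; rewrite E.
  case: h1 => E1 h1; exists None, u1; split=> //.
    apply: loop_stop; apply: den_bindI d1 _.
    have m1 : pos c = tnth u1 i by rewrite E1.
    apply: den_bindI (gstep_none m m1 hc) _; rewrite E2.
    by apply: den_bindI (gclean_den _ _) _; apply: den_retI.
  by move=> v; rewrite inE => /eqP ->; rewrite E.
have [_ E2 un] := m.
have [|o [u1 [d1 J1 h1]]] := hbody u (emb l (pebbles c) ++ al) Ju.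
  by split; [apply: emb_ok | exists (emb l (pebbles c))].
case: o d1 h1 => [b|] d1 h1.
  exists (Some b), u1; split=> //.
    apply: loop_stop; apply: den_bindI d1 _; rewrite E2.
    by apply: den_bindI (gclean_den _ _) _; apply: den_retI.
  by exists [::], (pos c), vs; rewrite E.
case: h1 => E1 h1.
have m1 : pos c = tnth u1 i by rewrite E1.
have [s' m' d2] := gstep_some m m1 st.
have [||o [u2 [d3 J2 h2]]] := IH s' (move_head u1 i (pos c')) _ m'.
- exact: J_move.
- by rewrite tnth_move_head eqxx.
exists o, u2; split=> //.
  apply: loop_cont d3; apply: den_bindI d1 _; apply: den_bindI d2 _.
  exact: den_retI.
case: o h2 {d3} => [b [vs1 [v [vs2 [-> h3 h4]]]]|h2].
  exists (pos c :: vs1), v, vs2; split=> // v'.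
  by rewrite inE => /orP[/eqP -> //|/h3//]; rewrite E.
by move=> v; rewrite inE => /orP[/eqP -> //|/h2//]; rewrite E.
Qed.

(** The inverse rule, for graphs on which the guide may fail: halting is not assumed but read off
    from the completed walk. An interrupted walk only shows that its last node is visited. *)
Lemma walk_partial u o u' al1 :
  (forall u al' o u' al'', J u -> above al' ->
     den body (u, al') o (u', al'') ->
     [/\ al'' = al', J u' &
       match o with
       | None => tnth u' i = tnth u i /\ R0 (tnth u i)
       | Some b => R1 (tnth u i) b u'
       end]) ->
  J u -> den (walk body) (u, al) o (u', al1) ->
  [/\ al1 = al, J u' &
    match o with
    | None => exists2 vs, vrun (start G (tnth u i)) vs &
                          forall v, v \in vs -> R0 v
    | Some b => exists2 v, gvisits (start G (tnth u i)) v & R1 v b u'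
    end].
Proof.
move=> hbody Ju /den_loop d.
suff H s c c1 o1 c2 : loop_den (walk_body body) s c1 o1 c2 ->
    forall u, J u -> gmatch s c -> pos c = tnth u i ->
    c1 = (u, emb l (pebbles c) ++ al) ->
  [/\ c2.2 = al, J c2.1 &
    match o1 with
    | None => exists2 vs, vrun c vs & forall v, v \in vs -> R0 v
    | Some b => exists2 v, gvisits c v & R1 v b c2.1
    end].
  exact: (H _ _ _ _ _ d _ Ju (gmatch_start _) (start_pos _)).
move=> {d}; move=> d; elim: d c => {s c1 o1 c2}.
  move=> s c1 o1 c2 d c {Ju}u Ju m E Ec1; have [_ E2 un] := m.
  move: d; rewrite {}Ec1 => /den_bind[o2 [[u2 al2] [/hbody d1 d2]]].
  have {d1} [||Ea J2 h] := d1 => //.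
    by split; [apply: emb_ok | exists (emb l (pebbles c))].
  rewrite {}Ea in d2; case: o2 h d2 => [b|] h.
    (* The given run is inverted by exhibiting one and comparing the two by determinism. *)
    move=> d2; have [[E1] ->] : inr o1 = inr (Some b) :> gstate + option O /\
      c2 = (u2, al).
      apply: den_det d2 _; rewrite E2.
      by apply: den_bindI (gclean_den _ _) _; apply: den_retI.
    split=> //; rewrite E1; exists (tnth u i) => //.
    by exists c => //; apply: rt_refl.
  case: h => Eu h; have m1 : pos c = tnth u2 i by rewrite Eu.
  have [[c' st]|nh] := EM (exists c', step c c').
    have [s' m' dg] := gstep_some m m1 st.
    move=> /den_bind[o3 [c3 [/(den_det dg) [<- <-]]]].
    by move=> /den_ret [].
  have hc : halting c by move=> c' st; apply: nh; exists c'.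
  move=> d2; have [[E1] ->] : inr o1 = inr None :> gstate + option O /\
      c2 = (u2, al).
    apply: den_det d2 _; apply: den_bindI (gstep_none m m1 hc) _; rewrite E2.
    by apply: den_bindI (gclean_den _ _) _; apply: den_retI.
  split=> //; rewrite E1; exists [:: pos c]; first exact: vrun_halt.
  by move=> v; rewrite inE => /eqP ->; rewrite E.
move=> s c1 s1 c3 o1 c2 d _ IH c {Ju}u Ju m E Ec1; have [_ E2 un] := m.
move: d; rewrite {}Ec1 => /den_bind[o2 [[u2 al2] [/hbody d1 d2]]].
have {d1} [||Ea J2 h] := d1 => //.
  by split; [apply: emb_ok | exists (emb l (pebbles c))].
move: d2; rewrite {}Ea; case: o2 h => [b|] h.
  by move=> /den_bind[o3 [c4 [_ /den_ret []]]].
case: h => Eu h; have m1 : pos c = tnth u2 i by rewrite Eu.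
have [[c' st]|nh] := EM (exists c', step c c'); last first.
  have hc : halting c by move=> c' st; apply: nh; exists c'.
  move=> /den_bind[o3 [c4 [/(den_det (gstep_none m m1 hc)) [<- <-]]]].
  by move=> /den_bind[o4 [c5 [_ /den_ret []]]].
have [s' m' dg] := gstep_some m m1 st.
move=> /den_bind[o3 [c4 [/(den_det dg) [<- <-]]]].
move=> /den_ret [[Es1] Ec3]; rewrite Es1 in IH.
have [||E3 J3 h3] := IH c' _ _ m' _ Ec3.
- exact: J_move.
- by rewrite tnth_move_head eqxx.
split=> //; case: o1 h3 {IH} => [b [v vis h3]|[vs r h3]].
  by exists v => //; apply: gvisits_step vis.
exists (pos c :: vs); first exact: vrun_step r.
by move=> v; rewrite inE => /orP[/eqP ->|/h3//]; rewrite E.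
Qed.

End Walk.

End Graph.

End Step.

End Guide.

(** * Checking the guide *)

Section Check.

Variables (Sigma : finType) (G : automaton Sigma 1).
Hypothesis Gdet : deterministic G.
Variables (k : nat) (i0 : 'I_k).

Notation machine := (machine Sigma k).
Notation ret := (mret Sigma i0).
Notation act := (@mact Sigma k).
Notation "m1 ;; m2" := (mbind m1 (fun _ => m2))
  (at level 100, m2 at level 200, right associativity).
Notation nX := #|pebble G|.

Definition visits_all (g : graph Sigma) (v : g) : Prop :=
  exists2 vs, vrun (start G v) vs & forall w, w \in vs.

Definition all_good (g : graph Sigma) : Prop := forall v : g, visits_all v.

Lemma guides_visits_all (g : graph Sigma) (v : g) : guides G v -> visits_all v.
Proof.
move=> [n [c [E0 st h all_v]]].
(* Induction on the distance [j] to the end, since a [vrun] grows backwards from its halting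
   configuration. *)
have H j : j <= n -> exists2 vs, vrun (c (n - j)) vs &
    forall i, n - j <= i <= n -> tnth (heads (c i)) ord0 \in vs.
  elim: j => [|j IH] le.
    rewrite subn0; exists [:: tnth (heads (c n)) ord0]; first exact: vrun_halt.
    by move=> i; rewrite -eqn_leq => /eqP <-; rewrite mem_head.
  have [vs r vis] := IH (ltnW le).
  have E : n - j = (n - j.+1).+1 by rewrite subnS prednK // subn_gt0.
  exists (tnth (heads (c (n - j.+1))) ord0 :: vs).
    by apply: vrun_step r; rewrite E; apply: st; rewrite -E leq_subr.
  move=> i; rewrite inE leq_eqVlt => /andP[/orP[/eqP <-|lt] le'].
    by rewrite eqxx.
  by rewrite vis ?orbT // E lt.
have [vs r vis] := H _ (leqnn n); rewrite subnn E0 in r vis.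
by exists vs => // w; have [i le <-] := all_v w; apply: vis.
Qed.

Lemma vrun_det (g : graph Sigma) (c : config G g) vs1 vs2 :
  vrun c vs1 -> vrun c vs2 -> vs1 = vs2.
Proof.
move=> r; elim: r vs2 => {c vs1} [c h|c c1 vs st _ IH] vs2 r.
  by case: r h => // c0 c' vs st _ h; case: (h _ st).
case: r st => [c0 h st|c0 c2 vs' st r st']; first by case: (h _ st).
by congr cons; apply: IH; rewrite (step_det Gdet st' st).
Qed.

Section Find.

Variables (g : graph Sigma) (l : nat) (al : seq (nat * g)).
Hypothesis al_ok : okst l al.
Variables (x : nat) (v : g).
Hypothesis xv : (x, v) \in al.

Lemma above_holds al' w : above G l al al' -> ((x, w) \in al') = (w == v).
Proof.
move=> [ok [be E]]; have xv' : (x, v) \in al' by rewrite E mem_cat xv orbT.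
by apply/idP/eqP => [xw|-> //]; apply: okst_fun ok xw xv'.
Qed.

(** If the walk ended in vain, [v] would differ from all visited nodes, yet the guide visits every
    node. *)
Lemma find_total i u : all_good g ->
  den (gfind Gdet i0 i l x) (u, al) (Some tt) (move_head u i v, al).
Proof.
move=> good.
have [vs r vis] := good (tnth u i).
have [|||o [u' [d [w Ew] h]]] := @walk_total _ _ Gdet _ i0 i l _ _ al_ok
  _ (mbind (mtst (TPeb Sigma i x)) (fun b : bool =>
    ret (if b then Some tt else None)))
  (fun u' => exists w, u' = move_head u i w) (fun w => w <> v)
  (fun w _ u' => tnth u' i = v) _ u vs _ _ r.
- by move=> _ w' [w ->]; exists w'; rewrite move_headK.
- move=> u1 al' J1 /above_holds hold.
  have [b [Eb d]] := den_tst_ex (TPeb Sigma i x) (u1, al').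
  exists (if b then Some tt else None), u1; split=> //.
    by apply: den_bindI d _; apply: den_retI.
  rewrite /= hold in Eb; case: b Eb {d} => -[h1 h2]; first by apply/eqP/h1.
  by split=> // /eqP /h2.
- by exists (tnth u i); rewrite move_head_id.
case: o h d => [[] [vs1 [w' [vs2 [_ _]]]]|].
  by rewrite {}Ew tnth_move_head eqxx => ->.
by move=> /(_ v (vis v)).
Qed.

(** The check of the guide rests on this: even on an arbitrary graph, success is a witness that the
    guide gets from the current node to [v]. *)
Lemma find_partial i u o u' al1 :
  den (gfind Gdet i0 i l x) (u, al) o (u', al1) ->
  [/\ al1 = al, u' = move_head u i (tnth u' i) & o ->
      tnth u' i = v /\ gvisits (start G (tnth u i)) v].
Proof.
move=> d; have [|||E [w Ew] h] := @walk_partial _ _ Gdet _ i0 i l _ _ al_ok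
  _ (mbind (mtst (TPeb Sigma i x)) (fun b : bool =>
    ret (if b then Some tt else None)))
  (fun u' => exists w, u' = move_head u i w) (fun _ => True)
  (fun w _ u' => tnth u' i = v /\ w = v) _ _ _ _ _ _ _ d.
- by move=> _ w' [w ->]; exists w'; rewrite move_headK.
- move=> u1 al' o1 u2 al'' J1 /above_holds hold.
  move=> /den_bind[b [c1 [/den_tst[Eb ->] /den_ret [-> [-> ->]]]]].
  split=> //; rewrite /= hold in Eb; case: b Eb => -[h1 h2] //.
  by have /eqP := h1 isT.
- by exists (tnth u i); rewrite move_head_id.
split=> //; first by rewrite Ew tnth_move_head eqxx.
by case: o h {d} => // -[[w' vis [-> E']]] _; rewrite -E'.
Qed.

End Find.

(** Divergence serves as rejection: it leaves no completed run, so whatever follows a search may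
    assume its success. *)
Definition abort : machine unit :=
  mloop (fun _ : unit => ret (inl tt : unit + unit)) tt.

Lemma abort_den (g : graph Sigma) (c : cfg k g nat) o c' : ~ den abort c o c'.
Proof. by move=> /den_loop; elim=> [s c1 o1 c2 /den_ret []|]. Qed.

Definition mfind i l x : machine unit :=
  mbind (gfind Gdet i0 i l x) (fun o => if o then ret tt else abort).

Lemma mfind_total (g : graph Sigma) l (al : seq (nat * g)) x v i u :
  okst l al -> (x, v) \in al -> all_good g ->
  den (mfind i l x) (u, al) tt (move_head u i v, al).
Proof.
move=> ok xv good; apply: den_bindI (find_total ok xv i u good) _.
exact: den_retI.
Qed.

Lemma mfind_partial (g : graph Sigma) l (al : seq (nat * g)) x v i u o u' al1 :
  okst l al -> (x, v) \in al -> den (mfind i l x) (u, al) o (u', al1) ->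
  [/\ al1 = al, u' = move_head u i v & gvisits (start G (tnth u i)) v].
Proof.
move=> ok xv /den_bind[o1 [[u1 al2] [/(find_partial ok xv) [-> E h]]]].
case: o1 h => [o1 /(_ isT)[E1 vis]|_ h]; last by case: (abort_den h).
by move=> /den_ret[_ [-> ->]]; split=> //; rewrite -E1.
Qed.

Definition adj (g : graph Sigma) (d : bool) (s : Sigma) (x y : g) : bool :=
  if d then edge s y x else edge s x y.

Lemma adj_fun (g : graph Sigma) d s (x y z : g) :
  adj d s x y -> adj d s x z -> y = z.
Proof. by case: d; [apply: edge_in_inj | apply: edge_out_inj]. Qed.

Lemma adjC (g : graph Sigma) d s (x y : g) : adj (~~ d) s x y = adj d s y x.
Proof. by case: d. Qed.

Definition tst_adj (d : bool) s : machine bool :=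
  mtst (if d then TInEdge nat i0 s else TOutEdge nat i0 s).

Definition move_adj (d : bool) s : machine unit :=
  act (if d then InMove nat i0 s else OutMove nat i0 s).

Lemma den_move_adj (g : graph Sigma) d s u (al : seq (nat * g)) o c' :
  den (move_adj d s) (u, al) o c' <->
  exists2 w, adj d s (tnth u i0) w & c' = (move_head u i0 w, al).
Proof.
case: c' => u' al'; rewrite /move_adj /adj den_act; case: d => /=; split.
- by move=> [w [e -> ->]]; exists w.
- by move=> [w e [-> ->]]; exists w.
- by move=> [w [e -> ->]]; exists w.
- by move=> [w e [-> ->]]; exists w.
Qed.

(** Pebble [l] is left on the neighbour, the head returns to [z], and from there the guide has to
    find [l]: success means that it visits the neighbour. The head is then on the neighbour again,
    so the reverse move restores its position. *)
Definition check_edge l z (d : bool) s : machine unit :=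
  mbind (tst_adj d s) (fun b : bool =>
    if b then
      (move_adj d s;; act (Drop Sigma i0 l);;
       mfind i0 l.+1 z;; mfind i0 l.+1 l;;
       act (Retrieve l);; move_adj (~~ d) s)
    else ret tt).

Lemma check_edge_total (g : graph Sigma) l (al : seq (nat * g)) z v d s u :
  okst l al -> (z, v) \in al -> all_good g ->
  den (check_edge l z d s) (u, al) tt (u, al).
Proof.
move=> ok zv good.
have [b [Eb db]] :=
  den_tst_ex (if d then TInEdge nat i0 s else TOutEdge nat i0 s) (u, al).
apply: den_bindI db _; case: b Eb => Eb; last exact: den_retI.
have [w e] : exists w, adj d s (tnth u i0) w.
  by rewrite /adj; case: (d) Eb => -[/(_ isT)].
have mv : den (move_adj d s) (u, al) tt (move_head u i0 w, al).
  by apply/den_move_adj; exists w.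
apply: den_bindI mv _; apply: den_bindI (den_drop _ _ _) _.
  exact: okst_notin ok _.
have ok' : okst l.+1 ((l, tnth (move_head u i0 w) i0) :: al).
  by apply: okst_cons ok _; rewrite leqnn ltnSn.
have zv' : (z, v) \in (l, tnth (move_head u i0 w) i0) :: al.
  by rewrite inE zv orbT.
apply: den_bindI (mfind_total _ _ ok' zv' good) _.
apply: den_bindI (mfind_total _ _ ok' (mem_head _ _) good) _.
apply: den_bindI (den_retrieve _ _ _ _) _.
rewrite !move_headK; apply/den_move_adj; exists (tnth u i0).
  by rewrite adjC !tnth_move_head eqxx.
by rewrite !move_headK move_head_id.
Qed.

Lemma check_edge_partial (g : graph Sigma) l (al : seq (nat * g)) z v d s u o
    u' al' :
  okst l al -> (z, v) \in al -> den (check_edge l z d s) (u, al) o (u', al') ->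
  [/\ al' = al, u' = u &
    forall w, adj d s (tnth u i0) w -> gvisits (start G v) w].
Proof.
move=> ok zv /den_bind[b [c1 [/den_tst[Eb ->]]]]; case: b Eb => Eb; last first.
  move=> /den_ret[_ [-> ->]]; split=> // w.
  rewrite /adj; case: d Eb => /= -[_ h] e.
    by have := h (ex_intro _ w e).
  by have := h (ex_intro _ w e).
move=> /den_bind[_ [c2 [/den_move_adj[w e ->]]]].
move=> /den_bind[_ [[u2 al2] [/den_drop_inv[_ -> ->]]]].
rewrite tnth_move_head eqxx.
have ok' : okst l.+1 ((l, w) :: al).
  by apply: okst_cons ok _; rewrite leqnn ltnSn.
have zv' : (z, v) \in (l, w) :: al by rewrite inE zv orbT.
move=> /den_bind[_ [[u3 al3] [/(mfind_partial ok' zv')[-> -> _]]]].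
move=> /den_bind[_ [[u4 al4] [/(mfind_partial ok' (mem_head _ _))[-> -> vis]]]].
move=> /den_bind[_ [[u5 al5] [/den_retrieve_inv[_ -> ->]]]].
move=> /den_move_adj[w']; rewrite tnth_move_head eqxx => e' [-> ->].
have -> : w' = tnth u i0 by apply: adj_fun e' _; rewrite adjC.
split=> //; first by rewrite !move_headK move_head_id.
move=> w1 e1; rewrite (adj_fun e1 e).
by move: vis; rewrite !tnth_move_head eqxx.
Qed.

Fixpoint mseq (ms : seq (machine unit)) : machine unit :=
  if ms is m :: ms' then m;; mseq ms' else ret tt.

Definition check_node l z : machine unit :=
  mseq [seq check_edge l z ds.1 ds.2 | ds <- enum {: bool * Sigma}].

Lemma check_node_total (g : graph Sigma) l (al : seq (nat * g)) z v u :
  okst l al -> (z, v) \in al -> all_good g ->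
  den (check_node l z) (u, al) tt (u, al).
Proof.
move=> ok zv good; rewrite /check_node.
elim: (enum _) => [|[d s] dss IH] /=; first exact: den_retI.
by apply: den_bindI IH; apply: check_edge_total ok zv good.
Qed.

Lemma check_node_partial (g : graph Sigma) l (al : seq (nat * g)) z v u o u'
    al' :
  okst l al -> (z, v) \in al -> den (check_node l z) (u, al) o (u', al') ->
  [/\ al' = al, u' = u &
    forall d s w, adj d s (tnth u i0) w -> gvisits (start G v) w].
Proof.
move=> ok zv; rewrite /check_node => h.
suff [-> -> H] : [/\ al' = al, u' = u &
    forall ds w, ds \in enum {: bool * Sigma} ->
      adj ds.1 ds.2 (tnth u i0) w -> gvisits (start G v) w].
  by split=> // d s w; apply: (H (d, s)); rewrite mem_enum.
elim: (enum _) h => [|[d s] dss IH] /=; first by move=> /den_ret[_ [-> ->]].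
move=> /den_bind[_ [[u1 al1] [/(check_edge_partial ok zv)[-> -> H]]]].
move=> /IH[-> -> H']; split=> // ds w.
by rewrite inE => /orP[/eqP -> /H //|/H' h /h].
Qed.

(* With the head and the pebble z on the same node v, this halts only if the
   set of nodes visited by the guide from v is closed under adjacency. *)
Definition check_visits l z : machine (option unit) :=
  walk Gdet i0 i0 l (check_node (l + nX) z;; ret None).

Lemma check_visits_total (g : graph Sigma) l (al : seq (nat * g)) z v u :
  okst l al -> (z, v) \in al -> all_good g ->
  exists u', den (check_visits l z) (u, al) None (u', al).
Proof.
move=> ok zv good; have [vs r _] := good (tnth u i0).
have [|||o [u' [d _ h]]] := @walk_total _ _ Gdet _ i0 i0 l _ _ ok unit
  (check_node (l + nX) z;; ret None) (fun=> True) (fun=> True)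
  (fun _ _ _ => False) _ u vs _ _ r => //.
  move=> u1 al1 _ [ok1 [be E]]; exists None, u1; split=> //.
  have zv1 : (z, v) \in al1 by rewrite E mem_cat zv orbT.
  apply: den_bindI (check_node_total u1 ok1 zv1 good) _; exact: den_retI.
by exists u'; case: o h d => // b [vs1 [w [vs2 []]]].
Qed.

Lemma closed_visits_all (g : graph Sigma) (v : g) vs :
  vrun (start G v) vs ->
  (forall x, x \in vs -> forall d s w, adj d s x w -> gvisits (start G v) w) ->
  visits_all v.
Proof.
move=> r closed; exists vs => // w.
have in_v : v \in vs.
  by apply: (vrun_visits Gdet r); exists (start G v) => //; apply: rt_refl.
have /connectP[p pth ->] := weakly_connected v w.
have H x : x \in vs ->
    path (fun a b => [exists s, edge s a b || edge s b a]) x p ->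
    last x p \in vs.
  elim: p x {pth} => [//|y p IH] x in_x /= /andP[/existsP[s e]].
  apply: IH; apply: (vrun_visits Gdet r); case/orP: e => e.
    by apply: (closed _ in_x false s).
  by apply: (closed _ in_x true s).
exact: H.
Qed.

Lemma check_visits_partial (g : graph Sigma) l (al : seq (nat * g)) z v u o u'
    al' :
  okst l al -> (z, v) \in al -> tnth u i0 = v ->
  den (check_visits l z) (u, al) o (u', al') ->
  al' = al /\ visits_all v.
Proof.
move=> ok zv E d.
have [|||-> _ h] := @walk_partial _ _ Gdet _ i0 i0 l _ _ ok unit
  (check_node (l + nX) z;; ret None) (fun=> True)
  (fun x => forall d s w, adj d s x w -> gvisits (start G v) w)
  (fun _ _ _ => False) _ _ _ _ _ _ _ d => //.
  move=> u1 al1 o1 u2 al2 _ [ok1 [be E1]].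
  have zv1 : (z, v) \in al1 by rewrite E1 mem_cat zv orbT.
  move=> /den_bind[_ [[u3 al3] [/(check_node_partial ok1 zv1)[-> -> H]]]].
  by move=> /den_ret[-> [-> ->]].
split=> //; case: o h {d} => [b [] //|[vs r H]].
by rewrite E in r; apply: closed_visits_all r H.
Qed.

(* Halts only if all nodes are good, so that an automaton that starts with it
   has the same acceptance from all nodes even where the guide fails. *)
Definition check l : machine (option unit) :=
  walk Gdet i0 i0 l (act (Drop Sigma i0 (l + nX));;
    check_visits (l + nX).+1 (l + nX);; mfind i0 (l + nX).+1 (l + nX);;
    act (Retrieve (l + nX));; ret None).

Lemma check_total (g : graph Sigma) l (al : seq (nat * g)) u :
  okst l al -> all_good g -> exists u', den (check l) (u, al) None (u', al).
Proof.
move=> ok good; have [vs r _] := good (tnth u i0).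
have [|||o [u' [d _ h]]] := @walk_total _ _ Gdet _ i0 i0 l _ _ ok unit
  (act (Drop Sigma i0 (l + nX));;
    check_visits (l + nX).+1 (l + nX);; mfind i0 (l + nX).+1 (l + nX);;
    act (Retrieve (l + nX));; ret None)
  (fun=> True) (fun=> True) (fun _ _ _ => False) _ u vs _ _ r => //.
  move=> u1 al1 _ [ok1 _].
  have ok2 : okst (l + nX).+1 ((l + nX, tnth u1 i0) :: al1).
    by apply: okst_cons ok1 _; rewrite leqnn ltnSn.
  have [u2 d2] := check_visits_total u1 ok2 (mem_head _ _) good.
  exists None, (move_head u2 i0 (tnth u1 i0)).
  split=> //; last by rewrite tnth_move_head eqxx.
  apply: den_bindI (den_drop _ _ _) _; first exact: okst_notin ok1 _.
  apply: den_bindI d2 _.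
  apply: den_bindI (mfind_total _ _ ok2 (mem_head _ _) good) _.
  by apply: den_bindI (den_retrieve _ _ _ _) _; apply: den_retI.
by exists u'; case: o h d => // b [vs1 [w [vs2 []]]].
Qed.

Lemma check_partial (g : graph Sigma) l (al : seq (nat * g)) u o u' al' :
  okst l al -> den (check l) (u, al) o (u', al') ->
  al' = al /\ all_good g.
Proof.
move=> ok d.
have [|||-> _ h] := @walk_partial _ _ Gdet _ i0 i0 l _ _ ok unit
  (act (Drop Sigma i0 (l + nX));;
    check_visits (l + nX).+1 (l + nX);; mfind i0 (l + nX).+1 (l + nX);;
    act (Retrieve (l + nX));; ret None) (fun=> True)
  (@visits_all g) (fun _ _ _ => False) _ _ _ _ _ _ _ d => //.
  move=> u1 al1 o1 u2 al2 _ [ok1 _].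
  have ok2 : okst (l + nX).+1 ((l + nX, tnth u1 i0) :: al1).
    by apply: okst_cons ok1 _; rewrite leqnn ltnSn.
  move=> /den_bind[_ [[u3 al3] [/den_drop_inv[_ -> ->]]]].
  move=> /den_bind[o4 [[u4 al4] [h d4]]]; move: d4.
  have [E vis] := check_visits_partial ok2 (mem_head _ _) erefl h.
  rewrite {h}E.
  move=> /den_bind[_ [[u5 al5] [/(mfind_partial ok2 (mem_head _ _))[-> -> _]]]].
  move=> /den_bind[_ [[u6 al6] [/den_retrieve_inv[_ -> ->]]]].
  move=> /den_ret[-> [-> ->]]; split=> //.
  by rewrite tnth_move_head eqxx.
split=> //; case: o h {d} => [b [] //|[vs r H] v].
(* The initial node lies on its own run, hence has been checked itself. So this run visits all
   nodes, and each of them has been checked. *)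
have in_r : tnth u i0 \in vs.
  apply: (vrun_visits Gdet r); exists (start G (tnth u i0)) => //.
  exact: rt_refl.
by have [vs' r' all_v] := H _ in_r; apply: H; rewrite (vrun_det r r').
Qed.

End Check.

(** * Evaluation of formulas *)

Section Upd.

Variable T : Type.
Implicit Types (nu : nat -> T) (xs ys : seq nat) (a b : seq T).

Lemma upd1 nu x v z : upd nu [:: x] [:: v] z = if z == x then v else nu z.
Proof. by rewrite /upd /= eq_sym; case: eqP. Qed.

Lemma upd_out nu xs a z :
  size a = size xs -> z \notin xs -> upd nu xs a z = nu z.
Proof. by move=> E h; rewrite /upd memNindex // -E nth_default. Qed.

Lemma upd_cat nu xs ys a b : size a = size xs -> size b = size ys ->
  {in xs, forall z, z \notin ys} ->
  upd nu (xs ++ ys) (a ++ b) = upd (upd nu xs a) ys b.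
Proof.
move=> Ea Eb dis; apply: funext => z; rewrite /upd index_cat nth_cat Ea.
case: (boolP (z \in xs)) => h.
  rewrite index_mem h [RHS]nth_default //.
  by rewrite (memNindex (dis _ h)) Eb.
rewrite ltnNge leq_addr /= addKn; congr (nth _ b _).
by rewrite memNindex // nth_default // Ea.
Qed.

Lemma upd_cons nu x xs v a : size a = size xs -> x \notin xs ->
  upd nu (x :: xs) (v :: a) = upd (upd nu [:: x] [:: v]) xs a.
Proof.
move=> E nin; rewrite -(@upd_cat nu [:: x] xs [:: v] a) // => z.
by rewrite inE => /eqP ->.
Qed.

Lemma upd_map nu xs a : size a = size xs -> uniq xs ->
  map (upd nu xs a) xs = a.
Proof.
elim: xs a => [|x xs IH] [|v a] //= [E] /andP[nin un].
rewrite {1}/upd /= eqxx /=; congr cons; rewrite -[RHS](IH _ E un).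
apply/eq_in_map => z zin; rewrite /upd /=; case: eqP => [E'|_] /=.
  by rewrite E' zin in nin.
by apply: set_nth_default; rewrite E index_mem.
Qed.

Lemma upd_map_out nu xs ys a : size a = size xs ->
  {in ys, forall z, z \notin xs} -> map (upd nu xs a) ys = map nu ys.
Proof. by move=> E dis; apply/eq_in_map => z /dis; apply: upd_out. Qed.

End Upd.

Section Evaluation.

Variables (Sigma : finType) (G : automaton Sigma 1).
Hypothesis Gdet : deterministic G.
Variables (k : nat) (i0 : 'I_k).

Notation machine := (machine Sigma k).
Notation ret := (mret Sigma i0).
Notation act := (@mact Sigma k).
Notation "m1 ;; m2" := (mbind m1 (fun _ => m2))
  (at level 100, m2 at level 200, right associativity).
Notation nX := #|pebble G|.
Notation mfind := (mfind Gdet i0).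

(** Predicates of a valuation, uniform in the graph: auxiliary relations such as the order of first
    visits need not be formulas. *)
Definition vpred : Type := forall g : graph Sigma, (nat -> g) -> Prop.

Definition env (g : graph Sigma) (D : seq nat) (e : nat -> nat) (nu : nat -> g)
    (al : seq (nat * g)) : Prop :=
  forall z, z \in D -> (e z, nu z) \in al.

(* The variables in D are represented by pebbles, according to e; all pebbles
   present are below l, so those from l on are free for use. *)
Definition evaluable (D : seq nat) (P : vpred) : Prop :=
  forall (e : nat -> nat) (l : nat), exists m : machine bool,
    forall g : graph Sigma, all_good G g ->
    forall (nu : nat -> g) u al, okst l al -> env D e nu al ->
    exists (b : bool) u', (b <-> P g nu) /\ den m (u, al) b (u', al).

Lemma evaluable_sub D D' P :
  {subset D <= D'} -> evaluable D P -> evaluable D' P.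
Proof.
move=> sub ev e l; have [m M] := ev e l; exists m => g good nu u al ok en.
by apply: M => // z /sub; apply: en.
Qed.

Lemma evaluable_ext D (P Q : vpred) :
  (forall (g : graph Sigma) (nu : nat -> g), P g nu <-> Q g nu) ->
  evaluable D P -> evaluable D Q.
Proof.
move=> PQ ev e l; have [m M] := ev e l; exists m => g good nu u al ok en.
by have [b [u' [h d]]] := M g good nu u al ok en; exists b, u'; rewrite -PQ.
Qed.

(** A renaming of variables only changes which pebble represents which variable. *)
Lemma evaluable_subst (th : nat -> nat) D P :
  evaluable D P -> evaluable (map th D) (fun g nu => P g (nu \o th)).
Proof.
move=> ev e l; have [m M] := ev (e \o th) l; exists m => g good nu u al ok en.
apply: M => // z zD; exact/en/map_f.
Qed.

Lemma evaluable_not D P :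
  evaluable D P -> evaluable D (fun g nu => ~ P g nu).
Proof.
move=> ev e l; have [m M] := ev e l.
exists (mbind m (fun b => ret (~~ b))) => g good nu u al ok en.
have [b [u' [h d]]] := M g good nu u al ok en.
exists (~~ b), u'; split; last by apply: den_bindI d _; apply: den_retI.
by rewrite -h; split=> /negP.
Qed.

Lemma evaluable_and D P Q : evaluable D P -> evaluable D Q ->
  evaluable D (fun g nu => P g nu /\ Q g nu).
Proof.
move=> evP evQ e l; have [m M] := evP e l; have [m' M'] := evQ e l.
exists (mbind m (fun b : bool => if b then m' else ret false)).
move=> g good nu u al ok en.
have [b [u' [h d]]] := M g good nu u al ok en.
case: b h d => -[h h'] d; last first.
  exists false, u'; split; last by apply: den_bindI d _; apply: den_retI.
  by split=> // -[/h'].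
have [b [u2 [h2 d2]]] := M' g good nu u' al ok en.
exists b, u2; split; last by apply: den_bindI d _.
by rewrite h2; split=> [|[]] // q; split=> //; apply: h.
Qed.

Lemma env_holds (g : graph Sigma) D e (nu : nat -> g) l al z v :
  okst l al -> env D e nu al -> z \in D -> (e z, v) \in al <-> nu z = v.
Proof.
move=> ok en zD; split=> [h|<-]; last exact: en.
exact: okst_fun ok (en _ zD) h.
Qed.

Lemma evaluable_eq x y : evaluable [:: x; y] (fun g nu => nu x = nu y).
Proof.
move=> e l; exists (mfind i0 l (e x);; mtst (TPeb Sigma i0 (e y))).
move=> g good nu u al ok en.
have xD : x \in [:: x; y] by rewrite mem_head.
have yD : y \in [:: x; y] by rewrite !inE eqxx orbT.
have d := mfind_total Gdet i0 i0 u ok (en _ xD) good.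
have [b [h d']] := den_tst_ex (TPeb Sigma i0 (e y)) (move_head u i0 (nu x), al).
exists b, (move_head u i0 (nu x)); split; last by apply: den_bindI d _.
rewrite h /= tnth_move_head eqxx (env_holds _ ok en yD).
by split=> ->.
Qed.

Lemma evaluable_label s x : evaluable [:: x] (fun g nu => label (nu x) = s).
Proof.
move=> e l; exists (mfind i0 l (e x);; mtst (TLab nat i0 s)).
move=> g good nu u al ok en.
have d := mfind_total Gdet i0 i0 u ok (en _ (mem_head _ _)) good.
have [b [h d']] := den_tst_ex (TLab nat i0 s) (move_head u i0 (nu x), al).
exists b, (move_head u i0 (nu x)); split; last by apply: den_bindI d _.
by rewrite h /= tnth_move_head eqxx.
Qed.

Lemma evaluable_edge s x y :
  evaluable [:: x; y] (fun g nu => edge s (nu x) (nu y)).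
Proof.
move=> e l; exists (mfind i0 l (e x);;
  mbind (mtst (TOutEdge nat i0 s)) (fun b : bool =>
    if b then (act (OutMove nat i0 s);; mtst (TPeb Sigma i0 (e y)))
    else ret false)).
move=> g good nu u al ok en.
have xD : x \in [:: x; y] by rewrite mem_head.
have yD : y \in [:: x; y] by rewrite !inE eqxx orbT.
have d := mfind_total Gdet i0 i0 u ok (en _ xD) good.
set u1 := move_head u i0 (nu x) in d.
have E1 : tnth u1 i0 = nu x by rewrite tnth_move_head eqxx.
have [b [h d']] := den_tst_ex (TOutEdge nat i0 s) (u1, al).
case: b h d' => -[h h'] d'; last first.
  exists false, u1; split; last first.
    by apply: den_bindI d _; apply: den_bindI d' _; apply: den_retI.
  by split=> // ed; apply: h'; exists (nu y); rewrite /= E1.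
have [//|v /=] := h; rewrite E1 => ev.
have dm : den (act (OutMove nat i0 s)) (u1, al) tt (move_head u1 i0 v, al).
  by apply/den_act; exists v; rewrite /= E1.
have [b [h2 d2]] := den_tst_ex (TPeb Sigma i0 (e y)) (move_head u1 i0 v, al).
exists b, (move_head u1 i0 v); split; last first.
  by apply: den_bindI d _; apply: den_bindI d' _; apply: den_bindI dm _.
rewrite h2 /= tnth_move_head eqxx (env_holds _ ok en yD).
by split=> [->|ed] //; apply: edge_out_inj ed ev.
Qed.

(** The order of visits depends on where the guide starts, hence the parameter [r]; [index] picks
    the first visit. *)
Definition earlier (g : graph Sigma) (r x y : g) : Prop :=
  exists2 vs, vrun (start G r) vs & index x vs < index y vs.

Lemma evaluable_earlier r x y :
  evaluable [:: r; x; y] (fun g nu => earlier (nu r) (nu x) (nu y)).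
Proof.
move=> e l.
(* [y] is tested first, so a node carrying both pebbles gives [false]: the order is strict. *)
pose body := mbind (mtst (TPeb Sigma i0 (e y))) (fun b : bool =>
  if b then ret (Some false) else
  mbind (mtst (TPeb Sigma i0 (e x))) (fun b : bool =>
  ret (if b then Some true else None))).
exists (mfind i0 l (e r);; mbind (walk Gdet i0 i0 l body)
  (fun o => ret (o == Some true))) => g good nu u al ok en.
have rD : r \in [:: r; x; y] by rewrite mem_head.
have xD : x \in [:: r; x; y] by rewrite !inE eqxx !orbT.
have yD : y \in [:: r; x; y] by rewrite !inE eqxx !orbT.
have d := mfind_total Gdet i0 i0 u ok (en _ rD) good.
set u1 := move_head u i0 (nu r) in d.
have E1 : tnth u1 i0 = nu r by rewrite tnth_move_head eqxx.
have [vs run all_vs] := good (nu r).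
rewrite -E1 in run.
have [|||o [u' [d' _ h]]] := @walk_total _ _ Gdet _ i0 i0 l _ _ ok _
  body (fun=> True) (fun v => v <> nu x /\ v <> nu y)
  (fun v b _ => if b then v = nu x /\ v <> nu y else v = nu y) _ u1 vs _ _ run.
- by [].
- move=> u2 al2 _ ab.
  have [by' [hy dy]] := den_tst_ex (TPeb Sigma i0 (e y)) (u2, al2).
  have [bx [hx dx]] := den_tst_ex (TPeb Sigma i0 (e x)) (u2, al2).
  have {}hy : by' = (tnth u2 i0 == nu y).
    by rewrite -(above_holds (en _ yD) _ ab); apply/idP/idP => /hy.
  have {}hx : bx = (tnth u2 i0 == nu x).
    by rewrite -(above_holds (en _ xD) _ ab); apply/idP/idP => /hx.
  exists (if by' then Some false else if bx then Some true else None), u2.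
  split=> //.
    apply: den_bindI dy _; case: (by'); first exact: den_retI.
    by apply: den_bindI dx _; apply: den_retI.
  rewrite hy hx; case: eqP => // ny; case: eqP => // nx.
- by [].
exists (o == Some true), u'; split; last first.
  by apply: den_bindI d _; apply: den_bindI d' _; apply: den_retI.
rewrite E1 in run.
have -> : earlier (nu r) (nu x) (nu y) <-> index (nu x) vs < index (nu y) vs.
  split=> [[vs' run']|lt]; last by exists vs.
  by rewrite (vrun_det Gdet run run').
case: o h {d'} => [b [vs1 [v [vs2 [-> out h]]]]|/(_ _ (all_vs (nu x)))[] //].
have nx : nu x \notin vs1 by apply/negP => /out[].
have ny : nu y \notin vs1 by apply/negP => /out[].
rewrite !index_cat (negbTE nx) (negbTE ny) ltn_add2l /=.
case: b h => [[-> /eqP/negbTE nxy]|->]; first by rewrite eqxx nxy !eqxx.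
by rewrite eqxx.
Qed.

Fixpoint place (l : nat) (x : 'I_k -> nat) (js : seq 'I_k) : machine unit :=
  if js is j :: js' then mfind j l (x j);; place l x js' else ret tt.

Lemma place_total (g : graph Sigma) l (al : seq (nat * g)) x (v : k.-tuple g)
    u :
  okst l al -> all_good G g -> (forall j, (x j, tnth v j) \in al) ->
  den (place l x (enum 'I_k)) (u, al) tt (v, al).
Proof.
move=> ok good xv.
suff H js : den (place l x js) (u, al) tt
    ([tuple if j \in js then tnth v j else tnth u j | j < k], al).
  have := H (enum 'I_k); congr den; congr pair.
  by apply: eq_from_tnth => j; rewrite tnth_mktuple mem_enum.
elim: js u => [|j js IH] u /=.
  have -> : [tuple if j \in [::] then tnth v j else tnth u j | j < k] = u.
    by apply: eq_from_tnth => j; rewrite tnth_mktuple.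
  exact: den_retI.
apply: den_bindI (mfind_total _ _ _ _ ok (xv j) good) _.
have := IH (move_head u j (tnth v j)); congr den; congr pair.
apply: eq_from_tnth => j'; rewrite !tnth_mktuple inE.
by case: (eqVneq j' j) => [->|]; case: (_ \in _).
Qed.

(* On success the heads are left on the values found for bs, which thus survive
   the retrieval of all the pebbles dropped during the search. *)
Lemma search_gen D P (bs : k.-tuple nat) (zs : seq nat) e l :
  evaluable (D ++ bs) P -> uniq zs ->
  exists m : machine bool, forall g : graph Sigma, all_good G g ->
    forall (nu : nat -> g) u al, okst l al ->
    env [seq z <- D ++ bs | z \notin zs] e nu al ->
    exists b u', den m (u, al) b (u', al) /\
      if b then exists a : seq g, [/\ size a = size zs, P g (upd nu zs a) &
                                      u' = map_tuple (upd nu zs a) bs]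
      else forall a : seq g, size a = size zs -> ~ P g (upd nu zs a).
Proof.
move=> ev; elim: zs e l => [|z zs IH] e l /= => [_|/andP[nin un]].
  have [m M] := ev e l.
  exists (mbind m (fun b : bool => if b then
    (place l (fun j => e (tnth bs j)) (enum 'I_k);; ret true) else ret false)).
  move=> g good nu u al ok; rewrite filter_predT => en.
  have [b [u' [h d]]] := M g good nu u al ok en.
  case: b h d => -[h h'] d; last first.
    exists false, u'; split; first by apply: den_bindI d _; apply: den_retI.
    by case=> // _ /h'.
  exists true, (map_tuple nu bs); split; last first.
    by exists [::]; split=> //; apply: h.
  apply: den_bindI d _.
  apply: den_bindI (place_total (v := map_tuple nu bs) _ ok good _) _.
    move=> j; rewrite tnth_map; apply: en.
    by rewrite mem_cat mem_tnth orbT.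
  exact: den_retI.
(* The walk itself occupies the nX pebbles from [l] on; the next one, [y], marks the value tried for
   [z]. On failure head [i0] is brought back to it, as the walk resumes there; on success the heads
   are left alone. *)
pose y := l + nX.
have [m M] := IH (fun x => if x == z then y else e x) y.+1 un.
pose body : machine (option unit) :=
  (act (Drop Sigma i0 y);; mbind m (fun b : bool =>
    if b then (act (Retrieve y);; ret (Some tt))
    else (mfind i0 y.+1 y;; act (Retrieve y);; ret None))).
exists (mbind (walk Gdet i0 i0 l body) (fun o => ret (o == Some tt))).
move=> g good nu u al ok en.
have [vs run all_vs] := good (tnth u i0).
have [|||o [u' [d' _ h]]] := @walk_total _ _ Gdet _ i0 i0 l _ _ ok _
  body (fun=> True)
  (fun v => forall a : seq g, size a = size zs ->
     ~ P g (upd nu (z :: zs) (v :: a)))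
  (fun v _ u' => exists a : seq g, [/\ size a = size zs,
     P g (upd nu (z :: zs) (v :: a)) &
     u' = map_tuple (upd nu (z :: zs) (v :: a)) bs]) _ u vs _ _ run => //.
  move=> u1 al1 _ [ok1 [be E1]].
  have ok2 : okst y.+1 ((y, tnth u1 i0) :: al1).
    by apply: okst_cons ok1 _; rewrite !leqnn.
  have [|b [u2 [d h]]] := M g good (upd nu [:: z] [:: tnth u1 i0]) u1 _ ok2.
    move=> x; rewrite mem_filter upd1 => /andP[xzs xD].
    case: eqP => [_|/eqP xz]; first exact: mem_head.
    rewrite inE E1 mem_cat en ?orbT // mem_filter inE negb_or.
    by rewrite xz xzs xD.
  have dd := den_drop i0 u1 (okst_notin ok1 (leqnn y)).
  case: b h d => [[a [Ea Pa ->]]|h] d.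
    exists (Some tt), (map_tuple (upd (upd nu [:: z] [:: tnth u1 i0]) zs a) bs).
    split=> //; last by exists a; rewrite upd_cons.
    apply: den_bindI dd _; apply: den_bindI d _.
    by apply: den_bindI (den_retrieve _ _ _ _) _; apply: den_retI.
  exists None, (move_head u2 i0 (tnth u1 i0)); split=> //.
    apply: den_bindI dd _; apply: den_bindI d _.
    apply: den_bindI (mfind_total _ _ _ _ ok2 (mem_head _ _) good) _.
    by apply: den_bindI (den_retrieve _ _ _ _) _; apply: den_retI.
  split; first by rewrite tnth_move_head eqxx.
  by move=> a Ea; rewrite upd_cons //; apply: h.
exists (o == Some tt), u'; split.
  by apply: den_bindI d' _; apply: den_retI.
case: o h {d'} => [[] [vs1 [v [vs2 [_ _ [a [Ea Pa ->]]]]]]|h] /=.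
  by exists (v :: a); rewrite /= Ea.
by case=> [//|v a] [Ea]; apply: h.
Qed.

Lemma evaluable_ex D x P : evaluable (x :: D) P ->
  evaluable D (fun g nu => exists a, P g (upd nu [:: x] [:: a])).
Proof.
move=> ev e l.
(* Only the truth value is wanted, so any tuple of variables in scope will do as the target of the
   heads. *)
have ev' : evaluable (D ++ nseq_tuple k x) P.
  apply: evaluable_sub ev => z; rewrite mem_cat inE => /orP[/eqP ->|->] //.
  by rewrite mem_nseq eqxx (leq_trans _ (ltn_ord i0)) ?orbT.
have [m M] := search_gen e l ev' (isT : uniq [:: x]).
exists m => g good nu u al ok en.
have [|b [u' [d h]]] := M g good nu u al ok.
  move=> z; rewrite mem_filter mem_cat mem_nseq inE => /andP[/negbTE zx].
  by rewrite zx andbF orbF; apply: en.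
exists b, u'; split=> //; case: b h {d} => h.
  by case: h => -[|a [|? ?]] [] // _ Pa _; split=> // _; exists a.
by split=> // -[a] /(h [:: a] erefl).
Qed.

End Evaluation.

(** * Definable families and blocks of variables *)

(** Satisfied by both [evaluable] and [definable], so that first-order constructions are carried out
    once for the two directions. *)
Record closed_family (Sigma : finType) (F : seq nat -> vpred Sigma -> Prop) :
    Prop := ClosedFamily {
  fam_sub : forall D D' P, {subset D <= D'} -> F D P -> F D' P;
  fam_ext : forall D P Q,
    (forall (g : graph Sigma) nu, P g nu <-> Q g nu) -> F D P -> F D Q;
  fam_not : forall D P, F D P -> F D (fun g nu => ~ P g nu);
  fam_and : forall D P Q, F D P -> F D Q ->
    F D (fun g nu => P g nu /\ Q g nu);
  fam_ex : forall D x P, F (x :: D) P ->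
    F D (fun g nu => exists a, P g (upd nu [:: x] [:: a]));
  fam_eq : forall x y, F [:: x; y] (fun g nu => nu x = nu y)
}.

Section Family.

Variables (Sigma : finType) (F : seq nat -> vpred Sigma -> Prop).
Hypothesis FC : closed_family F.
Implicit Types (D : seq nat) (P Q : vpred Sigma).

Lemma fam_or D P Q : F D P -> F D Q -> F D (fun g nu => P g nu \/ Q g nu).
Proof.
move=> hP hQ; apply: (fam_ext FC) (fam_not FC (fam_and FC (fam_not FC hP)
  (fam_not FC hQ))) => g nu.
split=> [n|[p|q] []//]; apply: contrapT => /not_orP; exact: n.
Qed.

(** The equation [0 = 0] has a free variable, which is quantified away; this is sound because graphs
    are nonempty. *)
Lemma fam_True D : F D (fun _ _ => True).
Proof.
apply: (fam_sub FC (D := [::])) => //.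
apply: (fam_ext FC) (fam_ex FC (x := 0) (fam_sub FC _ (fam_eq FC 0 0))).
  move=> g nu; split=> // _; have [a _] := card_gt0P (graph_nonempty g).
  by exists a.
by move=> z; rewrite !inE orbb.
Qed.

Lemma fam_False D : F D (fun _ _ => False).
Proof.
by apply: (fam_ext FC) (fam_not FC (fam_True D)) => g nu; split=> // -[].
Qed.

(** [X] depends on neither graph nor valuation, so excluded middle selects one of the two constant
    predicates. *)
Lemma fam_Prop (X : Prop) D : F D (fun _ _ => X).
Proof.
have [x|x] := EM X.
  by apply: (fam_ext FC) (fam_True D).
by apply: (fam_ext FC) (fam_False D).
Qed.

Lemma fam_in (T : Type) (s : seq T) D (P : T -> vpred Sigma) :
  (forall x, F D (P x)) -> F D (fun g nu => exists2 x, List.In x s & P x g nu).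
Proof.
move=> hP; elim: s => [|x s IH].
  by apply: (fam_ext FC) (fam_False D) => g nu; split=> // -[].
apply: (fam_ext FC) (fam_or (hP x) IH) => g nu; split.
  by move=> [p|[y h p]]; [exists x => //; left | exists y => //; right].
by move=> [y [<-|h] p]; [left | right; exists y].
Qed.

Lemma fam_exists (T : finType) D (P : T -> vpred Sigma) :
  (forall x, F D (P x)) -> F D (fun g nu => exists x, P x g nu).
Proof.
move=> hP; apply: (fam_ext FC) (fam_in (enum T) hP) => g nu.
split=> [[x _ p]|[x p]]; first by exists x.
exists x => //; have : x \in enum T by rewrite mem_enum.
elim: (enum T) => //= y s IH; rewrite inE => /orP[/eqP ->|/IH h].
  by left.
by right.
Qed.

Lemma fam_forall (T : finType) D (P : T -> vpred Sigma) :
  (forall x, F D (P x)) -> F D (fun g nu => forall x, P x g nu).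
Proof.
move=> hP; have h x := fam_not FC (hP x).
apply: (fam_ext FC) (fam_not FC (fam_exists h)) => g nu.
split=> [n x|p [x]]; last by apply.
by apply: contrapT => np; apply: n; exists x.
Qed.

Lemma fam_all D x P : F (x :: D) P ->
  F D (fun g nu => forall a, P g (upd nu [:: x] [:: a])).
Proof.
move=> hP.
apply: (fam_ext FC) (fam_not FC (fam_ex FC (fam_not FC hP))) => g nu.
split=> [n a|p [a]]; last by apply.
by apply: contrapT => np; apply: n; exists a.
Qed.

Lemma fam_exs (zs : seq nat) D P : uniq zs -> F (zs ++ D) P ->
  F D (fun g nu => exists2 a : seq g, size a = size zs & P g (upd nu zs a)).
Proof.
elim: zs D P => [|z zs IH] D P /=.
  move=> _ hP; apply: (fam_ext FC) hP => g nu.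
  by split=> [p|[[|//] _ p]] //; exists [::].
move=> /andP[nin un] hP.
have {}hP : F (zs ++ z :: D) P.
  by apply: (fam_sub FC) hP => x; rewrite !(inE, mem_cat) orbCA.
apply: (fam_ext FC) (fam_ex FC (IH _ _ un hP)) => g nu; split.
  by move=> [v [a Ea p]]; exists (v :: a); [rewrite /= Ea | rewrite upd_cons].
move=> [[//|v a] [Ea] p]; exists v, a => //.
by rewrite -upd_cons.
Qed.

End Family.

(** * Tuple variables as blocks of k variables *)

Section Blocks.

Variables (k M : nat).
Hypothesis M_gt0 : 0 < M.

(* The variables below M are left to individual nodes; those from M on are
   divided into blocks of k variables, one for each k-tuple of nodes. *)
Definition block (j : nat) : k.-tuple nat := [tuple M + (j * k + i) | i < k].

Lemma mem_block j z :
  (z \in block j) = (M <= z) && (k > 0) && ((z - M) %/ k == j).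
Proof.
apply/mapP/andP => [[i _ ->]|[/andP[le k0] /eqP <-]].
  have k0 : 0 < k by apply: leq_ltn_trans (ltn_ord i).
  by rewrite leq_addr k0 addKn divnMDl // divn_small ?addn0.
have lt : (z - M) %% k < k by rewrite ltn_mod.
exists (Ordinal lt); first by rewrite mem_enum.
by rewrite /= -divn_eq subnKC.
Qed.

Lemma block_uniq j : uniq (block j).
Proof.
rewrite map_inj_uniq ?enum_uniq // => i i' /addnI /addnI; exact: val_inj.
Qed.

Lemma block_ge j z : z \in block j -> M <= z.
Proof. by rewrite mem_block => /andP[/andP[]]. Qed.

Lemma block_disjoint j j' z : j != j' -> z \in block j -> z \notin block j'.
Proof.
rewrite !mem_block => ne /andP[-> /eqP ->] /=.
by rewrite (negbTE ne).
Qed.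

Definition tau (T : Type) (nu : nat -> T) (j : nat) : k.-tuple T :=
  map_tuple nu (block j).

(** Sending the variables from [M] on to the value of 0 hides the blocks from the individual part,
    whence [trunc_upd]. Variable 0 thereby becomes a default, and only variables x with 0 < x < M
    are rebound in [trunc_upd_low]. *)
Definition trunc (T : Type) (nu : nat -> T) (z : nat) : T :=
  if z < M then nu z else nu 0.

Definition upt (T : Type) (t : nat -> k.-tuple T) (j : nat) (a : k.-tuple T)
    (j' : nat) : k.-tuple T :=
  if j' == j then a else t j'.

Lemma tnth_tau T (nu : nat -> T) j i : tnth (tau nu j) i = nu (M + (j * k + i)).
Proof. by rewrite tnth_map tnth_mktuple. Qed.

Lemma tau_upd T (nu : nat -> T) j (a : k.-tuple T) :
  tau (upd nu (block j) a) = upt (tau nu) j a.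
Proof.
apply: funext => j'; apply: val_inj; rewrite /upt /=.
have Ea : size a = size (block j) by rewrite !size_tuple.
case: eqP => [->|/eqP ne]; first by rewrite upd_map // block_uniq.
by rewrite upd_map_out // => z; apply: block_disjoint.
Qed.

Lemma tau_upd_low T (nu : nat -> T) x v : x < M ->
  tau (upd nu [:: x] [:: v]) = tau nu.
Proof.
move=> lt; apply: funext => j; apply: val_inj; apply: upd_map_out => // z.
move=> /block_ge; rewrite inE; case: eqP => // -> /(leq_trans lt).
by rewrite ltnn.
Qed.

Lemma trunc_upd T (nu : nat -> T) j (a : k.-tuple T) :
  trunc (upd nu (block j) a) = trunc nu.
Proof.
have Ea : size a = size (block j) by rewrite !size_tuple.
apply: funext => z; rewrite /trunc; case: ifP => lt; apply: upd_out => //.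
  by apply/negP => /block_ge; rewrite leqNgt lt.
by apply/negP => /block_ge; rewrite leqNgt M_gt0.
Qed.

Lemma trunc_upd_low T (nu : nat -> T) x v : 0 < x < M ->
  trunc (upd nu [:: x] [:: v]) = upd (trunc nu) [:: x] [:: v].
Proof.
move=> /andP[x0 xM]; apply: funext => z; rewrite /trunc !upd1.
case: (eqVneq z x) => [->|]; first by rewrite xM.
by case: ifP => // _ _; case: eqP x0 => // <-.
Qed.

Section BlockFamily.

Variables (Sigma : finType) (F : seq nat -> vpred Sigma -> Prop).
Hypothesis FC : closed_family F.

Definition tpred : Type :=
  forall g : graph Sigma, (nat -> g) -> (nat -> k.-tuple g) -> Prop.

(** A two-sorted view of [F]: [D] lists the individual variables, [J] the indices of the tuple
    variables on which [T] may depend. *)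
Definition bfam (D J : seq nat) (T : tpred) : Prop :=
  F (D ++ flatten [seq val (block j) | j <- J])
    (fun g nu => T g (trunc nu) (tau nu)).

Lemma bfam_sub D D' J J' T :
  {subset D <= D'} -> {subset J <= J'} -> bfam D J T -> bfam D' J' T.
Proof.
move=> sD sJ; apply: (fam_sub FC) => z; rewrite !mem_cat.
move=> /orP[/sD ->//|/flatten_mapP[j jJ zj]].
by apply/orP; right; apply/flatten_mapP; exists j; first exact: sJ.
Qed.

Lemma bfam_pair D J j j' T :
  bfam D [:: j; j'] T -> j \in J -> j' \in J -> bfam D J T.
Proof.
move=> h jJ jJ'; apply: (bfam_sub _ _ h) => // z.
by rewrite !inE => /orP[] /eqP ->.
Qed.

Lemma bfam_ext D J (T T' : tpred) :
  (forall (g : graph Sigma) nu t, T g nu t <-> T' g nu t) ->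
  bfam D J T -> bfam D J T'.
Proof. by move=> E; apply: (fam_ext FC) => g nu. Qed.

Lemma bfam_not D J T : bfam D J T -> bfam D J (fun g nu t => ~ T g nu t).
Proof. exact: (fam_not FC). Qed.

Lemma bfam_and D J T T' : bfam D J T -> bfam D J T' ->
  bfam D J (fun g nu t => T g nu t /\ T' g nu t).
Proof. exact: (fam_and FC). Qed.

Lemma bfam_or D J T T' : bfam D J T -> bfam D J T' ->
  bfam D J (fun g nu t => T g nu t \/ T' g nu t).
Proof. exact: (fam_or FC). Qed.

Lemma bfam_imply D J T T' : bfam D J T -> bfam D J T' ->
  bfam D J (fun g nu t => T g nu t -> T' g nu t).
Proof.
move=> h h'; apply: bfam_ext (bfam_or (bfam_not h) h') => g nu t.
split=> [[n|p] //|i]; have [p|n] := EM (T g nu t); [right | left] => //.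
exact: i.
Qed.

Lemma bfam_exists (I : finType) D J (T : I -> tpred) :
  (forall i, bfam D J (T i)) -> bfam D J (fun g nu t => exists i, T i g nu t).
Proof. exact: (fam_exists FC). Qed.

Lemma bfam_forall (I : finType) D J (T : I -> tpred) :
  (forall i, bfam D J (T i)) -> bfam D J (fun g nu t => forall i, T i g nu t).
Proof. exact: (fam_forall FC). Qed.

Lemma bfam_Prop (X : Prop) D J : bfam D J (fun _ _ _ => X).
Proof. exact: (fam_Prop FC). Qed.

Lemma bfam_ex D J j T : bfam D (j :: J) T ->
  bfam D J (fun g nu t => exists c, T g nu (upt t j c)).
Proof.
move=> h; have {}h : F (block j ++ (D ++ flatten [seq val (block j) | j <- J]))
    (fun g nu => T g (trunc nu) (tau nu)).
  by apply: (fam_sub FC) h => z; rewrite /= !mem_cat orbCA.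
apply: (fam_ext FC) (fam_exs FC (block_uniq j) h) => g nu; split.
  move=> [a Ea]; have Ea' : size a == k by rewrite Ea size_tuple.
  rewrite -[a]/(val (Tuple Ea')) trunc_upd tau_upd => p.
  by exists (Tuple Ea').
move=> [c p]; exists c; first by rewrite !size_tuple.
by rewrite trunc_upd tau_upd.
Qed.

Lemma bfam_all D J j T : bfam D (j :: J) T ->
  bfam D J (fun g nu t => forall c, T g nu (upt t j c)).
Proof.
move=> h; apply: bfam_ext (bfam_not (bfam_ex (bfam_not h))) => g nu t.
split=> [n c|p [c]]; last by apply.
by apply: contrapT => np; apply: n; exists c.
Qed.

Lemma upt_at T (t : nat -> k.-tuple T) h c : upt t h c h = c.
Proof. by rewrite /upt eqxx. Qed.

Lemma upt_ne T (t : nat -> k.-tuple T) h c j : j != h -> upt t h c j = t j.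
Proof. by rewrite /upt => /negbTE ->. Qed.

(** Stated with [R] on tuples instead of block indices, so that the bound block can be chosen
    different from [j] and [j']. *)
Lemma bfam_ex2 D j j'
    (R : forall g : graph Sigma, (nat -> g) -> k.-tuple g -> k.-tuple g ->
       k.-tuple g -> Prop) :
  (forall h, h != j -> h != j' ->
     bfam D [:: h; j; j'] (fun g nu t => R g nu (t h) (t j) (t j'))) ->
  bfam D [:: j; j'] (fun g nu t => exists c, R g nu c (t j) (t j')).
Proof.
pose h := (j + j').+1 => hR.
have ne : h != j by rewrite gtn_eqF // ltnS leq_addr.
have ne' : h != j' by rewrite gtn_eqF // ltnS leq_addl.
have H := bfam_ex (hR h ne ne').
have {H} := bfam_ext _ H; apply => g nu t.
rewrite eq_sym in ne; rewrite eq_sym in ne'.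
split=> -[c p]; exists c; move: p;
  by rewrite upt_at (upt_ne _ _ ne) (upt_ne _ _ ne').
Qed.

Lemma bfam_all2 D j j'
    (R : forall g : graph Sigma, (nat -> g) -> k.-tuple g -> k.-tuple g ->
       k.-tuple g -> Prop) :
  (forall h, h != j -> h != j' ->
     bfam D [:: h; j; j'] (fun g nu t => R g nu (t h) (t j) (t j'))) ->
  bfam D [:: j; j'] (fun g nu t => forall c, R g nu c (t j) (t j')).
Proof.
move=> hR; have h := bfam_not (bfam_ex2
  (R := fun g nu c a b => ~ R g nu c a b) (fun h n n' => bfam_not (hR h n n'))).
apply: bfam_ext h => g nu t; split=> [n c|p [c]]; last by apply.
by apply: contrapT => np; apply: n; exists c.
Qed.

Lemma bfam_ex_low D J x T : 0 < x < M -> bfam (x :: D) J T ->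
  bfam D J (fun g nu t => exists v, T g (upd nu [:: x] [:: v]) t).
Proof.
move=> /[dup] x0M /andP[_ xM] h; apply: (fam_ext FC) (fam_ex FC h) => g nu.
by split=> -[v p]; exists v; move: p; rewrite tau_upd_low // trunc_upd_low.
Qed.

Lemma bfam_of D J (P : vpred Sigma) T :
  F (D ++ flatten [seq val (block j) | j <- J]) P ->
  (forall (g : graph Sigma) (nu : nat -> g),
    P g nu <-> T g (trunc nu) (tau nu)) ->
  bfam D J T.
Proof. by move=> h E; apply: (fam_ext FC) h. Qed.

Lemma tnth_block j i : tnth (block j) i = M + (j * k + i).
Proof. by rewrite tnth_mktuple. Qed.

Lemma bfam_eq_at (j j' : nat) (i i' : 'I_k) :
  bfam [::] [:: j; j'] (fun g nu t => tnth (t j) i = tnth (t j') i').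
Proof.
have h := fam_eq FC (tnth (block j) i) (tnth (block j') i').
apply: bfam_of (fam_sub FC _ h) _.
  move=> z; rewrite !inE /= cats0 mem_cat => /orP[] /eqP ->.
    by rewrite mem_tnth.
  by rewrite mem_tnth orbT.
by move=> g nu; rewrite !tnth_tau !tnth_block.
Qed.

Lemma bfam_eq (j j' : nat) : bfam [::] [:: j; j'] (fun g nu t => t j = t j').
Proof.
have h := fam_forall FC (fun i => bfam_eq_at j j' i i).
apply: (fam_ext FC) h => g nu; split=> [E|-> //].
exact: eq_from_tnth.
Qed.

Lemma bfam_eq_low (j : nat) (i : 'I_k) x : x < M ->
  bfam [:: x] [:: j] (fun g nu t => nu x = tnth (t j) i).
Proof.
move=> xM; apply: bfam_of (fam_sub FC _ (fam_eq FC x (tnth (block j) i))) _.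
  move=> z; rewrite !inE /= cats0 => /orP[] /eqP ->; first by rewrite eqxx.
  by rewrite mem_tnth orbT.
by move=> g nu; rewrite tnth_tau tnth_block /trunc xM.
Qed.

End BlockFamily.

End Blocks.

(** * Depth-first search *)

Lemma clos_rt_step T (R : T -> T -> Prop) x y :
  clos_refl_trans T R x y ->
  x = y \/ exists2 z, R x z & clos_refl_trans T R z y.
Proof.
move=> /clos_rt_rt1n_iff [|z w r h]; first by left.
by right; exists z => //; apply/clos_rt_rt1n_iff.
Qed.

Lemma clos_rt_last T (R : T -> T -> Prop) x y :
  clos_refl_trans T R x y ->
  x = y \/ exists2 z, clos_refl_trans T R x z & R z y.
Proof.
move=> /clos_rt_rtn1_iff [|z w r h]; first by left.
by right; exists z => //; apply/clos_rt_rtn1_iff.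
Qed.

Lemma clos_rt_cons T (R : T -> T -> Prop) x y z :
  R x y -> clos_refl_trans T R y z -> clos_refl_trans T R x z.
Proof. by move=> r; apply: rt_trans; apply: rt_step. Qed.

Section DFS.

Variables (T : finType) (child lt : T -> T -> Prop) (u t : T).
Hypothesis parent_fun : forall a b c, child a b -> child a c -> b = c.
Hypothesis root : forall a, ~ child t a.
Hypothesis lt_irr : forall a, ~ lt a a.
Hypothesis lt_trans : forall a b c, lt a b -> lt b c -> lt a c.
Hypothesis lt_total : forall a b, a = b \/ lt a b \/ lt b a.

(** Mind the directions: [child b a] makes [a] the parent of [b], while [first_child a b] and
    [next_sibling a b] lead from [a] to [b]. *)
Definition first_child (a b : T) : Prop :=
  child b a /\ forall c, child c a -> ~ lt c b.

Definition siblings (a b : T) : Prop := exists p, child a p /\ child b p.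

Definition next_sibling (a b : T) : Prop :=
  [/\ siblings a b, lt a b & forall c, siblings a c /\ lt a c -> ~ lt c b].

(* In a state (true, a) the subtree below a is still to be searched for u, in
   a state (false, a) it has been searched in vain. *)
Definition dfs_step (c c' : bool * T) : Prop :=
  match c, c' with
  | (true, a), (true, b) => a <> u /\ first_child a b
  | (true, a), (false, b) => [/\ a <> u, b = a & forall c, ~ child c a]
  | (false, a), (true, b) => a <> t /\ next_sibling a b
  | (false, a), (false, b) =>
      [/\ a <> t, child a b & forall c, ~ next_sibling a c]
  end.

Local Notation below := (clos_refl_trans T child).
Local Notation dfs := (clos_refl_trans (bool * T) dfs_step).

(** The number of predecessors increases strictly along [lt], so a candidate with the fewest is
    minimal. *)
Lemma lt_min (Q : T -> Prop) a : Q a ->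
  exists2 m, Q m & forall c, Q c -> ~ lt c m.
Proof.
move=> Qa; pose key x := #|[set c | `[< lt c x >]]|.
have Qa' : `[< Q a >] by apply/asboolP.
case: (@arg_minnP _ a (fun x => `[< Q x >]) key Qa') => m /asboolP Qm min.
exists m => // c /asboolP /min; rewrite leqNgt => /negP h l; apply: h.
apply: proper_card; apply/properP; split.
  apply/subsetP => x; rewrite !inE => /asboolP xc.
  exact/asboolP/(lt_trans xc).
by exists c; rewrite !inE; [apply/asboolP | apply/asboolP/lt_irr].
Qed.

Lemma min_fun (Q : T -> Prop) a b :
  Q a -> Q b -> (forall c, Q c -> ~ lt c a) -> (forall c, Q c -> ~ lt c b) ->
  a = b.
Proof.
move=> Qa Qb ma mb; have [//|[l|l]] := lt_total a b.
  by case: (mb _ Qa l).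
by case: (ma _ Qb l).
Qed.

Lemma dfs_step_fun c c1 c2 : dfs_step c c1 -> dfs_step c c2 -> c1 = c2.
Proof.
case: c => -[] a; case: c1 => -[] b1; case: c2 => -[] b2 /=.
- move=> [_ [h1 m1]] [_ [h2 m2]]; congr pair.
  exact: (min_fun (Q := child^~ a)).
- by move=> [_ [h1 _]] [_ _ n]; case: (n _ h1).
- by move=> [_ _ n] [_ [h1 _]]; case: (n _ h1).
- by move=> [_ -> _] [_ -> _].
- move=> [_ [s1 l1 m1]] [_ [s2 l2 m2]]; congr pair.
  exact: (min_fun (Q := fun c => siblings a c /\ lt a c)).
- by move=> [_ h] [_ _ n]; case: (n _ h).
- by move=> [_ _ n] [_ h]; case: (n _ h).
- by move=> [_ h1 _] [_ h2 _]; rewrite (parent_fun h1 h2).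
Qed.

(** Parents are unique, so going up from a cycle one stays on it, whereas [t] is reached and has no
    parent. *)
Lemma no_cycle a b : below a t -> child b a -> ~ below a b.
Proof.
move=> at_ ba ab.
have H x : below a x -> below x b.
  move=> /clos_rt_rtn1_iff; elim=> {x} [//|x y xy _ IH].
  case: (clos_rt_step IH) => [E|[z xz zb]].
    by rewrite E in xy; rewrite (parent_fun xy ba).
  by rewrite (parent_fun xy xz).
case: (clos_rt_step (H t at_)) => [E|[z tz _]]; last exact: root tz.
by rewrite -E in ba; apply: root ba.
Qed.

Definition searched a : Prop :=
  (below u a -> dfs (true, a) (true, u)) /\
  (~ below u a -> dfs (true, a) (false, a)).

(** Induction on the number of children of [a] after [b]: once [b] has been searched in vain, the
    search goes on with the least of these, or returns to [a] if there are none. *)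
Lemma searched_siblings a :
  below a t -> (forall b, child b a -> searched b) ->
  forall b, child b a ->
  ((exists2 c, child c a & (c = b \/ lt b c) /\ below u c) ->
    dfs (true, b) (true, u)) /\
  ((forall c, child c a -> c = b \/ lt b c -> ~ below u c) ->
    dfs (true, b) (false, a)).
Proof.
move=> at_ IH b; move: {2}#|_| (leqnn #|[set c | `[< child c a /\ lt b c >]]|).
move=> n; elim: n b => [|n IHn] b le ba.
  have nolater c : child c a -> ~ lt b c.
    move=> ca bc; move: le; rewrite leqn0 cards_eq0 => /eqP /setP /(_ c).
    by rewrite !inE => /asboolPn [].
  have [h1 h2] := IH _ ba; split.
    by move=> [c ca [[-> //|/(nolater _ ca)[]]]].
  move=> none; have nb := none _ ba (or_introl erefl).
  apply: rt_trans (h2 nb) (rt_step _ _ _ _ _); split=> //.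
    by move=> E; rewrite E in ba; apply: root ba.
  move=> c [[p [bp cp]] bc _]; apply: nolater bc.
  by rewrite (parent_fun ba bp).
have bt : b <> t by move=> E; rewrite E in ba; apply: root ba.
have sibE c : siblings b c <-> child c a.
  split=> [[p [bp cp]]|ca]; first by rewrite (parent_fun ba bp).
  by exists a.
have [h1 h2] := IH _ ba.
have [ub|nub] := EM (below u b).
  by split=> [_|none]; [apply: h1 | case: (none b ba (or_introl erefl))].
have {}h2 := h2 nub.
have [[c0 [c0a bc0]]|nolater] := EM (exists c, child c a /\ lt b c); last first.
  split=> [[c ca [[->//|bc _]]]|_]; first by case: nolater; exists c.
  apply: rt_trans h2 (rt_step _ _ _ _ _); split=> // c [/sibE ca bc _].
  by case: nolater; exists c.
have [c [ca bc] min] := lt_min (Q := fun c => child c a /\ lt b c)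
  (conj c0a bc0).
have step : dfs_step (false, b) (true, c).
  split=> //; split=> //; first exact/sibE.
  by move=> d [/sibE da bd]; apply: min.
have toc : dfs (true, b) (true, c) by apply: rt_trans h2 (rt_step _ _ _ _ step).
have later d : child d a -> lt b d -> d = c \/ lt c d.
  move=> da bd; have [->|[dc|cd]] := lt_total d c; [by left | | by right].
  by case: (min d (conj da bd) dc).
have [|h3 h4] := IHn c _ ca.
  rewrite -ltnS; apply: leq_trans le; apply: proper_card; apply/properP; split.
    apply/subsetP => d; rewrite !inE => /asboolP[da cd]; apply/asboolP.
    by split=> //; apply: lt_trans cd.
  exists c; rewrite inE; first exact/asboolP.
  by apply/asboolP => -[_ /lt_irr].
split.
  move=> [d da [[->//|bd] ud]]; apply: rt_trans toc (h3 _).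
  by exists d => //; split=> //; apply: later.
move=> none; apply: rt_trans toc (h4 _) => d da h; apply: (none d da).
by right; case: h => [->//|]; apply: lt_trans.
Qed.

(** Induction on the size of the subtree, which shrinks from [a] to a child because [a] is not below
    its child. *)
Lemma all_searched a : below a t -> searched a.
Proof.
move: {2}#|_| (leqnn #|[set x | `[< below x a >]]|) => n.
elim: n a => [|n IHn] a le at_.
  move: le; rewrite leqn0 cards_eq0 => /eqP /setP /(_ a).
  by rewrite !inE => /asboolPn[]; apply: rt_refl.
have IH b : child b a -> searched b.
  move=> ba; apply: IHn; last exact: clos_rt_cons ba _.
  rewrite -ltnS; apply: leq_trans le; apply: proper_card; apply/properP; split.
    apply/subsetP => d; rewrite !inE => /asboolP db; apply/asboolP.
    by apply: rt_trans db (rt_step _ _ _ _ ba).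
  exists a; rewrite inE; first by apply/asboolP; apply: rt_refl.
  by apply/asboolP; apply: no_cycle.
have [<-|ne] := EM (u = a).
  by split=> [_|[]]; apply: rt_refl.
have {}ne : a <> u by move=> E; apply: ne.
have [[b0 b0a]|nochild] := EM (exists b, child b a); last first.
  split=> [h|_]; first (case: (clos_rt_last h) => [E|[b _ ba]]).
  - by case: ne.
  - by case: nochild; exists b.
  - apply: rt_step; split=> // b ba; by apply: nochild; exists b.
have [b ba min] := lt_min (Q := child^~ a) b0a.
have step : dfs_step (true, a) (true, b) by [].
have [h1 h2] := searched_siblings at_ IH ba; split.
  move=> h; case: (clos_rt_last h) => [E|[c uc ca]]; first by case: ne.
  apply: clos_rt_cons step (h1 _); exists c => //; split=> //.
  by have [->|[cb|bc]] := lt_total c b; [left | case: (min c) | right].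
move=> nu; apply: clos_rt_cons step (h2 _) => c ca _ uc; apply: nu.
exact: rt_trans uc (rt_step _ _ _ _ ca).
Qed.

(** The search ends in [(true, u)] or [(false, t)], where the guards of [dfs_step] forbid any move;
    the mode reached is the answer. *)
Lemma dfs_correct : exists d, [/\ dfs (true, t) d,
  forall d', ~ dfs_step d d' & d.1 <-> below u t].
Proof.
have [h1 h2] := all_searched (rt_refl _ _ t).
have [ut|nut] := EM (below u t).
  exists (true, u); split=> //; first exact: h1.
  by case=> -[] b [].
exists (false, t); split=> //; first exact: h2.
by case=> -[] b [].
Qed.

End DFS.

(** * Iteration *)

Section Lex.

Variables (T : Type) (k : nat) (R : T -> T -> Prop).
Hypothesis R_irr : forall a, ~ R a a.
Hypothesis R_trans : forall a b c, R a b -> R b c -> R a c.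
Hypothesis R_total : forall a b, a = b \/ R a b \/ R b a.

Definition lex (a b : k.-tuple T) : Prop :=
  exists i, R (tnth a i) (tnth b i) /\
            forall j : 'I_k, j < i -> tnth a j = tnth b j.

Lemma lex_irr a : ~ lex a a.
Proof. by move=> [i [/R_irr]]. Qed.

Lemma lex_trans a b c : lex a b -> lex b c -> lex a c.
Proof.
move=> [i [ab eab]] [j [bc ebc]]; have [ij|ji|/val_inj E] := ltngtP i j.
- exists i; rewrite -ebc //; split=> // h hi.
  by rewrite eab // ebc // (ltn_trans hi).
- exists j; rewrite eab //; split=> // h hj.
  by rewrite eab ?ebc // (ltn_trans hj).
- rewrite -{j}E in bc ebc; exists i; split; first exact: R_trans bc.
  by move=> h hi; rewrite eab // ebc.
Qed.

Lemma lex_total a b : a = b \/ lex a b \/ lex b a.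
Proof.
have [[i0 d0]|same] := EM (exists i, tnth a i <> tnth b i); last first.
  left; apply: eq_from_tnth => i; apply: contrapT => d.
  by apply: same; exists i.
have d0' : `[< tnth a i0 <> tnth b i0 >] by apply/asboolP.
case: (@arg_minnP _ i0 (fun i => `[< tnth a i <> tnth b i >])
  (@nat_of_ord k) d0') => i /asboolP d min; right.
have eq (j : 'I_k) : j < i -> tnth a j = tnth b j.
  move=> ji; apply: contrapT => /asboolP /min; by rewrite leqNgt ji.
have [//|[ab|ba]] := R_total (tnth a i) (tnth b i).
  by left; exists i.
by right; exists i; split=> // j /eq ->.
Qed.

End Lex.

Lemma sat_ext (Sigma : finType) (k : nat) (g : graph Sigma)
    (phi : formula Sigma k) (nu nu' : nat -> g) :
  {in fv phi, nu =1 nu'} -> sat nu phi <-> sat nu' phi.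
Proof.
elim: phi nu nu' => /= [s x|s x y|x y|p IH|p IHp q IHq|p IHp q IHq|x p IH|x p IH
    |xs ys p IH us vs] nu nu' E.
- by rewrite E ?mem_head.
- by rewrite !E // !inE eqxx ?orbT.
- by rewrite !E // !inE eqxx ?orbT.
- by rewrite (IH _ _ E).
- rewrite (IHp nu nu') ?(IHq nu nu') // => z h; apply: E;
  by rewrite mem_cat h ?orbT.
- rewrite (IHp nu nu') ?(IHq nu nu') // => z h; apply: E;
  by rewrite mem_cat h ?orbT.
- have H a : sat (upd nu [:: x] [:: a]) p <-> sat (upd nu' [:: x] [:: a]) p.
    apply: IH => z h; rewrite !upd1; case: eqP => // /eqP zx.
    by apply: E; rewrite mem_filter zx.
  by split=> -[a /H h]; exists a.
- have H a : sat (upd nu [:: x] [:: a]) p <-> sat (upd nu' [:: x] [:: a]) p.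
    apply: IH => z h; rewrite !upd1; case: eqP => // /eqP zx.
    by apply: E; rewrite mem_filter zx.
  by split=> h a; apply/H.
- have -> : map_tuple nu us = map_tuple nu' us.
    apply: val_inj; apply/eq_in_map => z h; apply: E.
    by rewrite !mem_cat h orbT.
  have -> : map_tuple nu vs = map_tuple nu' vs.
    apply: val_inj; apply/eq_in_map => z h; apply: E.
    by rewrite !mem_cat h !orbT.
  suff -> : (fun a b : k.-tuple g => sat (upd nu (xs ++ ys) (a ++ b)) p) =
            (fun a b : k.-tuple g => sat (upd nu' (xs ++ ys) (a ++ b)) p) by [].
  apply: funext => a; apply: funext => b; apply: propext; apply: IH => z h.
  have Es : size (a ++ b) = size (xs ++ ys) by rewrite !size_cat !size_tuple.
  have [zin|zout] := boolP (z \in xs ++ ys).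
    by rewrite /upd; apply: set_nth_default; rewrite Es index_mem.
  by rewrite !upd_out //; apply: E; rewrite mem_cat mem_filter zout h.
Qed.

Section Iterate.

Variables (Sigma : finType) (G : automaton Sigma 1).
Hypothesis Gdet : deterministic G.
Variables (k : nat) (i0 : 'I_k).

Notation machine := (machine Sigma k).
Notation ret := (mret Sigma i0).
Notation act := (@mact Sigma k).
Notation "m1 ;; m2" := (mbind m1 (fun _ => m2))
  (at level 100, m2 at level 200, right associativity).
Notation evaluable := (evaluable G k).

Lemma evaluable_family : closed_family evaluable.
Proof.
split.
- exact: evaluable_sub.
- exact: evaluable_ext.
- exact: (evaluable_not i0).
- exact: (evaluable_and i0).
- exact: (evaluable_ex Gdet i0).
- exact: (evaluable_eq Gdet i0).
Qed.

(** The tail is dropped first, so that [retrieve_all] can pop from the front of the list. *)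
Fixpoint drop_all (l : nat) (js : seq 'I_k) : machine unit :=
  if js is j :: js' then drop_all l js';; act (Drop Sigma j (l + j))
  else ret tt.

Fixpoint retrieve_all (l : nat) (js : seq 'I_k) : machine unit :=
  if js is j :: js' then act (Retrieve (l + j));; retrieve_all l js'
  else ret tt.

Section Dropped.

Variables (g : graph Sigma) (l : nat) (al : seq (nat * g)).
Hypothesis ok : okst l al.

Definition dropped (u : k.-tuple g) (js : seq 'I_k) : seq (nat * g) :=
  [seq (l + nat_of_ord j, tnth u j) | j <- js].

Lemma dropped_fst u js :
  map fst (dropped u js) = [seq l + nat_of_ord j | j <- js].
Proof. by rewrite -map_comp. Qed.

Lemma dropped_ok u js : uniq js -> okst (l + k) (dropped u js ++ al).
Proof.
move=> un; apply: (okst_cat ok); last exact: leq_addr.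
  rewrite dropped_fst map_inj_uniq // => j j' /addnI; exact: val_inj.
rewrite dropped_fst; apply/allP => _ /mapP[j _ ->].
by rewrite leq_addr ltn_add2l ltn_ord.
Qed.

Lemma drop_all_den u js : uniq js ->
  den (drop_all l js) (u, al) tt (u, dropped u js ++ al).
Proof.
elim: js => [|j js IH] /=; first by move=> _; apply: den_retI.
move=> /andP[nin un]; apply: den_bindI (IH un) _; apply: den_drop.
rewrite map_cat mem_cat dropped_fst negb_or (okst_notin ok) ?leq_addr // andbT.
rewrite (mem_map (f := fun i : 'I_k => l + i)) // => j1 j2 /addnI.
exact: val_inj.
Qed.

Lemma retrieve_all_den u u' js :
  den (retrieve_all l js) (u', dropped u js ++ al) tt (u', al).
Proof.
elim: js => [|j js IH] /=; first exact: den_retI.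
by apply: den_bindI IH; apply: den_retrieve.
Qed.

End Dropped.

Variables (D : seq nat) (xs ys us : k.-tuple nat).
Variable psi : bool -> bool -> vpred Sigma.
Hypothesis psi_ev : forall m m', evaluable ((D ++ xs) ++ ys) (psi m m').
Hypothesis xs_uniq : uniq xs.
Hypothesis ys_uniq : uniq ys.
Hypothesis xs_ys : {in xs, forall z, z \notin ys}.

Definition iter_step (g : graph Sigma) (nu : nat -> g)
    (c c' : bool * k.-tuple g) : Prop :=
  psi c.1 c'.1 (upd nu (xs ++ ys) (c.2 ++ c'.2)).

(* The current tuple is held by the heads between two rounds, and marked with
   pebbles during a round. *)
Lemma evaluable_iter (P : vpred Sigma) :
  {in D, forall z, z \notin xs} ->
  (forall g : graph Sigma, all_good G g -> forall nu : nat -> g,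
     (forall c c1 c2, iter_step nu c c1 -> iter_step nu c c2 -> c1 = c2) /\
     exists d, [/\ clos_refl_trans _ (iter_step nu) (true, map_tuple nu us) d,
       forall d', ~ iter_step nu d d' & d.1 <-> P g nu]) ->
  evaluable (D ++ us) P.
Proof.
move=> D_xs spec e l.
(* During a round the variables [xs] are represented by the k pebbles from [l] on, which mark the
   current tuple. *)
pose e' z := if z \in xs then l + index z xs else e z.
(* [ys] is both the tuple searched for and the target of the heads: success leaves the heads on the
   next tuple. *)
have sg m m' := search_gen Gdet i0 e' (l + k) (psi_ev m m') ys_uniq.
have [S hS] := choice (fun mm : bool * bool => sg mm.1 mm.2).
pose body (m : bool) : machine (bool + bool) :=
  (drop_all l (enum 'I_k);;
   mbind (S (m, true)) (fun b : bool => if b then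
     (retrieve_all l (enum 'I_k);; ret (inl true)) else
   mbind (S (m, false)) (fun b : bool =>
     (retrieve_all l (enum 'I_k);; ret (if b then inl false else inr m))))).
exists (place Gdet i0 l (fun j => e (tnth us j)) (enum 'I_k);; mloop body true).
move=> g good nu u al ok en.
have [fun_step [d [run dead dP]]] := spec g good nu.
have st m a : exists r u', den (body m) (a, al) r (u', al) /\
    match r with
    | inl m' => iter_step nu (m, a) (m', u')
    | inr m' => m' = m /\ forall c, ~ iter_step nu (m, a) c
    end.
  pose al1 := dropped l a (enum 'I_k) ++ al.
  have ok1 : okst (l + k) al1 by apply: dropped_ok; rewrite ?enum_uniq.
  have en1 : env [seq z <- (D ++ xs) ++ ys | z \notin ys] e' (upd nu xs a) al1.
    move=> z; rewrite mem_filter mem_cat => /andP[/negbTE zy].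
    rewrite zy orbF => zD; rewrite /e' /al1 mem_cat; case: ifP => zx.
      have lt : index z xs < k.
        by rewrite -[X in _ < X](size_tuple xs) index_mem.
      apply/orP; left; apply/mapP.
      exists (Ordinal lt); first by rewrite mem_enum.
      congr pair; rewrite /upd (tnth_nth (nu z)) //.
    rewrite upd_out ?size_tuple ?zx //; apply/orP; right; apply: en.
    by move: zD; rewrite !mem_cat zx orbF => ->.
  have stepE m' (b : k.-tuple g) : iter_step nu (m, a) (m', b) <->
      psi m m' (upd (upd nu xs a) ys b).
    by rewrite /iter_step /= upd_cat ?size_tuple.
  have dd : den (drop_all l (enum 'I_k)) (a, al) tt (a, al1).
    by apply: drop_all_den; rewrite ?enum_uniq.
  have found m' u2 : (exists b : seq g, [/\ size b = size ys,
       psi m m' (upd (upd nu xs a) ys b) &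
       u2 = map_tuple (upd (upd nu xs a) ys b) ys]) -> 
       iter_step nu (m, a) (m', u2).
    move=> [b [Eb p ->]]; apply/stepE.
    by rewrite /= upd_map.
  have none m' : (forall b : seq g, size b = size ys ->
      ~ psi m m' (upd (upd nu xs a) ys b)) ->
      forall b, ~ iter_step nu (m, a) (m', b).
    by move=> h b /stepE; apply: h; rewrite !size_tuple.
  have [b1 [u1 [d1 h1]]] := hS (m, true) g good _ a _ ok1 en1.
  case: b1 d1 h1 => /= d1 h1.
    exists (inl true), u1; split; last exact: found.
    apply: den_bindI dd _; apply: den_bindI d1 _.
    by apply: den_bindI (retrieve_all_den _ _ _ _ _) _; apply: den_retI.
  have [b2 [u2 [d2 h2]]] := hS (m, false) g good _ u1 _ ok1 en1.
  exists (if b2 then inl false else inr m), u2; split.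
    apply: den_bindI dd _; apply: den_bindI d1 _; apply: den_bindI d2 _.
    by apply: den_bindI (retrieve_all_den _ _ _ _ _) _; apply: den_retI.
  case: b2 h2 {d2} => h2; first exact: found.
  by split=> // -[[] c]; apply: none.
have {}run : exists u', loop_den body true (map_tuple nu us, al) d.1 (u', al).
  move/clos_rt_rt1n_iff: run dead => run.
  have -> : map_tuple nu us = (true, map_tuple nu us).2 by [].
  have E : true = (true, map_tuple nu us).1 by [].
  rewrite [X in loop_den _ X]E {E}.
  elim: run {dP} => {d} [[m a]|[m a] c d s _ IH] dead /=.
    have [r [u' [dr]]] := st m a; case: r dr => [m'|m'] dr h.
      by case: (dead _ h).
    by case: h => E _; rewrite E in dr; exists u'; apply: loop_stop dr.
  have [r [u' [dr]]] := st m a; case: r dr => [m'|m'] dr h; last first.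
    by case: (h.2 _ s).
  have [u2 lp] := IH dead; exists u2; apply: loop_cont dr _.
  by rewrite -(fun_step _ _ _ h s) in lp.
have [u' lp] := run; exists d.1, u'; split=> //.
apply: den_bindI (place_total (v := map_tuple nu us) Gdet i0 _ ok good _) _.
  by move=> j; rewrite tnth_map; apply: en; rewrite mem_cat mem_tnth orbT.
exact/den_loop.
Qed.

End Iterate.

(** * Evaluation of transitive closures *)

Lemma clos_rt_mono T (R R' : T -> T -> Prop) x y :
  (forall a b, R a b -> clos_refl_trans T R' a b) ->
  clos_refl_trans T R x y -> clos_refl_trans T R' x y.
Proof.
move=> sub; elim=> {x y} [x y /sub //|x|x y z _ h1 _ h2].
  exact: rt_refl.
exact: rt_trans h1 h2.
Qed.

Section Closure.

Variables (Sigma : finType) (G : automaton Sigma 1).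
Hypothesis Gdet : deterministic G.
Variables (k : nat) (i0 : 'I_k).
Notation evaluable := (evaluable G k).

Let EF := evaluable_family Gdet i0.

Section Earlier.

Variables (g : graph Sigma) (good : all_good G g) (r : g).

Lemma earlier_key : exists2 key : g -> nat, injective key &
  forall x y, earlier G r x y <-> key x < key y.
Proof.
have [vs run all_vs] := good r; exists (fun x => index x vs).
  by move=> x y E; rewrite -(nth_index r (all_vs x)) E nth_index.
move=> x y; split=> [[vs' run']|h]; last by exists vs.
by rewrite (vrun_det Gdet run run').
Qed.

Lemma earlier_irr x : ~ earlier G r x x.
Proof. by have [key _ E] := earlier_key; rewrite E ltnn. Qed.

Lemma earlier_trans x y z :
  earlier G r x y -> earlier G r y z -> earlier G r x z.
Proof. by have [key _ E] := earlier_key; rewrite !E; apply: ltn_trans. Qed.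

Lemma earlier_total x y : x = y \/ earlier G r x y \/ earlier G r y x.
Proof.
have [key inj E] := earlier_key; rewrite !E.
by case: (ltngtP (key x) (key y)) => [h|h|/inj]; auto.
Qed.

End Earlier.

Section TC.

Variables (p : formula Sigma k) (xs ys us vs : k.-tuple nat).
Hypothesis p_ev : evaluable (fv p) (fun g nu => sat nu p).
Hypothesis p_fun : functional xs ys p.

Let D := [seq z <- fv p | z \notin xs ++ ys] ++ us ++ vs.
Let M := (\max_(z <- fv p ++ us ++ vs) z).+1.

Notation block := (block k M).
Notation tau := (tau k M).
Notation trunc := (trunc M).
Notation bfam := (@bfam k M Sigma evaluable).

Lemma below_M z : z \in fv p ++ us ++ vs -> z < M.
Proof. by move=> h; rewrite ltnS; apply: (@leq_bigmax_seq _ _ xpredT id z). Qed.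

Lemma D_below z : z \in D -> z < M.
Proof.
rewrite !mem_cat mem_filter => h; apply: below_M; rewrite !mem_cat.
by case/orP: h => [/andP[_ ->]//|->]; rewrite orbT.
Qed.

Definition tc_rel (g : graph Sigma) (nu : nat -> g) (a b : k.-tuple g) : Prop :=
  sat (upd nu (xs ++ ys) (a ++ b)) p.

(** The successor is the parent, unique as [p] is functional. Removing the edges that leave the
    target makes it a root. *)
Definition tc_child (g : graph Sigma) (nu : nat -> g) (a b : k.-tuple g) :
    Prop :=
  tc_rel nu a b /\ a <> map_tuple nu vs.

(** The guide must start at the same node in all comparisons; the value of a variable of [us] is
    pebbled throughout the search. *)
Definition tc_before (g : graph Sigma) (nu : nat -> g) (a b : k.-tuple g) :
    Prop :=
  lex (earlier G (nu (tnth us i0))) a b.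

Definition tc_dfs (g : graph Sigma) (nu : nat -> g) (c c' : bool * k.-tuple g) :
    Prop :=
  dfs_step (tc_child nu) (tc_before nu) (map_tuple nu us) (map_tuple nu vs)
    c c'.

Lemma bfam_rel j j' : bfam D [:: j; j'] (fun g nu t => tc_rel nu (t j) (t j')).
Proof.
(* A substitution turns [xs] and [ys] into two blocks; the other variables are treated as in
   [trunc]. *)
pose th := upd (fun z => if z < M then z else 0) (xs ++ ys)
  (block j ++ block j').
apply: (bfam_of EF (fam_sub EF _ (evaluable_subst th p_ev))).
  move=> _ /mapP[z zp ->].
  have sz : size (block j ++ block j') = size (xs ++ ys).
    by rewrite !size_cat !size_tuple.
  have [zin|zout] := boolP (z \in xs ++ ys).
    rewrite mem_cat /= cats0; apply/orP; right.
    by rewrite /th /upd mem_nth // sz index_mem.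
  rewrite /th upd_out // below_M; last by rewrite mem_cat zp.
  by rewrite !mem_cat mem_filter zout zp.
move=> g nu; rewrite /tc_rel.
suff -> : nu \o th = upd (trunc nu) (xs ++ ys) (tau nu j ++ tau nu j') by [].
apply: funext => z; rewrite /th /upd /= -map_cat.
have [lt|le] := ltnP (index z (xs ++ ys)) (size (block j ++ block j')).
  by rewrite (nth_map 0) // (set_nth_default 0).
by rewrite !nth_default ?size_map // /trunc; case: ifP.
Qed.

Lemma bfam_eq_vars j (ws : k.-tuple nat) : {subset ws <= D} ->
  bfam D [:: j] (fun g nu t => t j = map_tuple nu ws).
Proof.
move=> sub.
have h i : bfam D [:: j] (fun g nu t => nu (tnth ws i) = tnth (t j) i).
  have lt := D_below (sub _ (mem_tnth i ws)).
  apply: (bfam_sub EF _ _ (bfam_eq_low EF j i lt)) => //.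
  by move=> z; rewrite inE => /eqP ->; apply/sub/mem_tnth.
apply: (fam_ext EF) (fam_forall EF h) => g nu; split=> [E|E i].
  by apply: eq_from_tnth => i; rewrite [RHS]tnth_map E.
by rewrite E tnth_map.
Qed.

Lemma us_D : {subset us <= D}.
Proof. by move=> z h; rewrite !mem_cat h orbT. Qed.

Lemma vs_D : {subset vs <= D}.
Proof. by move=> z h; rewrite !mem_cat h !orbT. Qed.

Lemma subset_fst (j j' : nat) : {subset [:: j] <= [:: j; j']}.
Proof. by move=> z; rewrite !inE => ->. Qed.

Lemma subset_swap (j j' : nat) : {subset [:: j'; j] <= [:: j; j']}.
Proof. by move=> z; rewrite !inE orbC. Qed.

Lemma bfam_child j j' :
  bfam D [:: j; j'] (fun g nu t => tc_child nu (t j) (t j')).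
Proof.
apply: (bfam_and EF (bfam_rel j j')); apply: (bfam_not EF).
exact: (bfam_sub EF _ (@subset_fst j j') (bfam_eq_vars j vs_D)).
Qed.

Lemma bfam_before j j' :
  bfam D [:: j; j'] (fun g nu t => tc_before nu (t j) (t j')).
Proof.
pose r := tnth us i0; have rD : r \in D by apply/us_D/mem_tnth.
apply: (bfam_exists EF) => i; apply: (bfam_and EF).
  apply: (bfam_of EF (fam_sub EF _
    (evaluable_earlier Gdet i0 r (tnth (block j) i) (tnth (block j') i)))).
    move=> z; rewrite !inE /= cats0 !mem_cat => /or3P[] /eqP ->.
    - by have := rD; rewrite !mem_cat => ->.
    - by rewrite mem_tnth orbT.
    - by rewrite mem_tnth !orbT.
  by move=> g nu; rewrite !tnth_tau !tnth_block /trunc (D_below rD).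
apply: (bfam_forall EF) => i'; apply: (bfam_imply EF).
  exact: (bfam_Prop _ _ EF (i' < i)).
by apply: (bfam_sub EF _ _ (bfam_eq_at _ EF j j' i' i')).
Qed.

Lemma bfam_siblings j j' :
  bfam D [:: j; j'] (fun g nu t => siblings (tc_child nu) (t j) (t j')).
Proof.
apply: (bfam_ex2 (isT : 0 < M) EF
  (R := fun g nu c a b => tc_child nu a c /\ tc_child nu b c)).
move=> h _ _; apply: (bfam_and EF).
  by apply: (bfam_pair EF (bfam_child j h)); rewrite !inE eqxx ?orbT.
by apply: (bfam_pair EF (bfam_child j' h)); rewrite !inE eqxx ?orbT.
Qed.

Lemma bfam_swap (R : forall g : graph Sigma, (nat -> g) -> k.-tuple g ->
    k.-tuple g -> Prop) j j' :
  (forall j j', bfam D [:: j; j'] (fun g nu t => R g nu (t j) (t j'))) ->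
  bfam D [:: j; j'] (fun g nu t => R g nu (t j') (t j)).
Proof. by move=> h; apply: (bfam_sub EF _ (@subset_swap j j') (h j' j)). Qed.

Lemma bfam_first_child j j' :
  bfam D [:: j; j'] (fun g nu t =>
    first_child (tc_child nu) (tc_before nu) (t j) (t j')).
Proof.
apply: (bfam_and EF); first exact: (bfam_swap (R := tc_child) _ _ bfam_child).
apply: (bfam_all2 (isT : 0 < M) EF
  (R := fun g nu c a b => tc_child nu c a -> ~ tc_before nu c b)) => h _ _.
apply: (bfam_imply EF).
  by apply: (bfam_pair EF (bfam_child h j)); rewrite !inE eqxx ?orbT.
apply: (bfam_not EF).
by apply: (bfam_pair EF (bfam_before h j')); rewrite !inE eqxx ?orbT.
Qed.

Lemma bfam_next_sibling j j' :
  bfam D [:: j; j'] (fun g nu t =>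
    next_sibling (tc_child nu) (tc_before nu) (t j) (t j')).
Proof.
have h1 := bfam_and EF (bfam_siblings j j') (bfam_before j j').
have h2 : bfam D [:: j; j'] (fun g nu t =>
    forall c, siblings (tc_child nu) (t j) c /\ tc_before nu (t j) c ->
      ~ tc_before nu c (t j')).
  apply: (bfam_all2 (isT : 0 < M) EF (R := fun g nu c a b =>
    siblings (tc_child nu) a c /\ tc_before nu a c ->
    ~ tc_before nu c b)) => h _ _.
  apply: (bfam_imply EF); first apply: (bfam_and EF).
  - by apply: (bfam_pair EF (bfam_siblings j h)); rewrite !inE eqxx ?orbT.
  - by apply: (bfam_pair EF (bfam_before j h)); rewrite !inE eqxx ?orbT.
  apply: (bfam_not EF).
  by apply: (bfam_pair EF (bfam_before h j')); rewrite !inE eqxx ?orbT.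
apply: (bfam_ext EF _ (bfam_and EF h1 h2)) => g nu t.
by split=> [[[]]|[]].
Qed.

Lemma bfam_dfs m m' :
  bfam D [:: 0; 1] (fun g nu t => tc_dfs nu (m, t 0) (m', t 1)).
Proof.
have eq_u : bfam D [:: 0; 1] (fun g nu t => t 0 <> map_tuple nu us).
  apply/(bfam_not EF).
  by apply: (bfam_sub EF _ (@subset_fst 0 1) (bfam_eq_vars 0 us_D)).
have eq_v : bfam D [:: 0; 1] (fun g nu t => t 0 <> map_tuple nu vs).
  apply/(bfam_not EF).
  by apply: (bfam_sub EF _ (@subset_fst 0 1) (bfam_eq_vars 0 vs_D)).
case: m; case: m'.
- exact: (bfam_and EF eq_u (bfam_first_child 0 1)).
- have eq01 : bfam D [:: 0; 1] (fun g nu t => t 1 = t 0).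
    by apply: (bfam_sub EF _ (@subset_swap 0 1) (bfam_eq _ _ EF 1 0)).
  have none : bfam D [:: 0; 1] (fun g nu t => forall c, ~ tc_child nu c (t 0)).
    apply: (bfam_all2 (isT : 0 < M) EF
      (R := fun g nu c a b => ~ tc_child nu c a)) => h _ _.
    apply: (bfam_not EF).
    by apply: (bfam_pair EF (bfam_child h 0)); rewrite !inE eqxx ?orbT.
  apply: (bfam_ext EF _ (bfam_and EF eq_u (bfam_and EF eq01 none))) => g nu t.
  by split=> [[? []]|[]].
- exact: (bfam_and EF eq_v (bfam_next_sibling 0 1)).
- have none : bfam D [:: 0; 1] (fun g nu t =>
      forall c, ~ next_sibling (tc_child nu) (tc_before nu) (t 0) c).
    apply: (bfam_all2 (isT : 0 < M) EF (R := fun g nu c a b =>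
      ~ next_sibling (tc_child nu) (tc_before nu) a c)) => h _ _.
    apply: (bfam_not EF).
    by apply: (bfam_pair EF (bfam_next_sibling 0 h)); rewrite !inE eqxx ?orbT.
  apply: (bfam_ext EF _ (bfam_and EF eq_v
    (bfam_and EF (bfam_child 0 1) none))) => g nu t.
  by split=> [[? []]|[]].
Qed.

(** A path to the target can be cut at its first arrival there, and then uses no edge leaving the
    target. *)
Lemma below_rel (g : graph Sigma) (nu : nat -> g) a :
  clos_refl_trans _ (tc_child nu) a (map_tuple nu vs) <->
  clos_refl_trans _ (tc_rel nu) a (map_tuple nu vs).
Proof.
split; first by apply: clos_rt_mono => x y [h _]; apply: rt_step.
move Et: (map_tuple nu vs) => t /clos_rt_rt1n_iff r; move: Et.
elim: r => {a t} [a|a b t ab _ IH] Et; first exact: rt_refl.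
have [->|ne] := EM (a = t); first exact: rt_refl.
by apply: clos_rt_cons (IH Et); split=> //; rewrite Et.
Qed.

Lemma evaluable_tc : evaluable (fv (FTC xs ys p us vs))
  (fun g nu => sat nu (FTC xs ys p us vs)).
Proof.
have block01 : {in block 0, forall z, z \notin block 1}.
  by move=> z; apply: block_disjoint.
have size_block j (T : Type) (a : k.-tuple T) : size a = size (block j).
  by rewrite !size_tuple.
have psi_ev m m' : evaluable (D ++ block 0 ++ block 1)
    (fun g nu => tc_dfs (trunc nu) (m, tau nu 0) (m', tau nu 1)).
  apply: (fam_sub EF _ (bfam_dfs m m')) => z.
  by rewrite /= cats0.
have {}psi_ev m m' : evaluable ((D ++ block 0) ++ block 1)
    (fun g nu => tc_dfs (trunc nu) (m, tau nu 0) (m', tau nu 1)).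
  by rewrite -catA; apply: psi_ev.
(* The search starts at the root, so the initial tuple of the iteration is [vs]. *)
apply: (fam_sub EF (D := D ++ vs)).
  by move=> z; rewrite mem_cat => /orP[//|/vs_D].
apply: (evaluable_iter Gdet i0 psi_ev (block_uniq _ _ _) block01).
  move=> z /D_below lt; apply/negP => /block_ge.
  by rewrite leqNgt lt.
move=> g good nu.
have stepE : iter_step (block 0) (block 1)
   (fun m m' (g : graph Sigma) (nu : nat -> g) =>
      tc_dfs (trunc nu) (m, tau nu 0) (m', tau nu 1)) nu = tc_dfs (trunc nu).
  apply: funext => -[m a]; apply: funext => -[m' b].
  rewrite /iter_step /=.
  rewrite (upd_cat _ (size_block _ _ _) (size_block _ _ _) block01).
  by rewrite !trunc_upd // !tau_upd.
have trunc_D z : z \in D -> trunc nu z = nu z by rewrite /trunc => /D_below ->.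
have Eus : map_tuple (trunc nu) us = map_tuple nu us.
  by apply: val_inj; apply/eq_in_map => z /us_D /trunc_D.
have Evs : map_tuple (trunc nu) vs = map_tuple nu vs.
  by apply: val_inj; apply/eq_in_map => z /vs_D /trunc_D.
have relE : tc_rel (trunc nu) = tc_rel nu.
  apply: funext => a; apply: funext => b; apply: propext.
  apply: sat_ext => z zp.
  have Es : size (a ++ b) = size (xs ++ ys) by rewrite !size_cat !size_tuple.
  have [zin|zout] := boolP (z \in xs ++ ys).
    by rewrite /upd; apply: set_nth_default; rewrite Es index_mem.
  by rewrite !upd_out // trunc_D // mem_cat mem_filter zout zp.
have child_fun : forall a b c,
    tc_child (trunc nu) a b -> tc_child (trunc nu) a c -> b = c.
  by move=> a b c [ab _] [ac _]; apply: p_fun ab ac.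
have root a : ~ tc_child (trunc nu) (map_tuple (trunc nu) vs) a by case.
have irr a : ~ tc_before (trunc nu) a a.
  by apply: lex_irr => x; apply: earlier_irr good _ _.
have trans a b c : tc_before (trunc nu) a b -> tc_before (trunc nu) b c ->
    tc_before (trunc nu) a c.
  by apply: lex_trans => x y z; apply: earlier_trans good _ _ _ _.
have total a b : a = b \/ tc_before (trunc nu) a b \/ tc_before (trunc nu) b a.
  by apply: lex_total => x y; apply: earlier_total good _ _ _.
rewrite stepE; split.
  by move=> c c1 c2; apply: (dfs_step_fun child_fun total).
have [d [run dead h]] :=
  dfs_correct (map_tuple (trunc nu) us) child_fun root irr trans total.
exists d; split=> //.
  by rewrite -Evs.
by rewrite h Evs Eus -Evs below_rel Evs relE; apply: iff_refl.
Qed.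

End TC.

Lemma evaluable_sat (phi : formula Sigma k) : FO_DTC phi ->
  evaluable (fv phi) (fun g nu => sat nu phi).
Proof.
elim: phi => /= [s x|s x y|x y|p IH|p IHp q IHq|p IHp q IHq|x p IH|x p IH
    |xs ys p IH us vs].
- by move=> _; apply: evaluable_label.
- by move=> _; apply: evaluable_edge.
- by move=> _; apply: evaluable_eq.
- by move=> /IH; apply: (fam_not EF).
- move=> [/IHp hp /IHq hq]; apply: (fam_and EF).
    by apply: (fam_sub EF _ hp) => z h; rewrite mem_cat h.
  by apply: (fam_sub EF _ hq) => z h; rewrite mem_cat h orbT.
- move=> [/IHp hp /IHq hq]; apply: (fam_or EF).
    by apply: (fam_sub EF _ hp) => z h; rewrite mem_cat h.
  by apply: (fam_sub EF _ hq) => z h; rewrite mem_cat h orbT.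
- move=> /IH h; apply: (fam_ex EF (fam_sub EF _ h)) => z zp.
  by rewrite inE mem_filter zp andbT orbN.
- move=> /IH h; apply: (fam_all EF (fam_sub EF _ h)) => z zp.
  by rewrite inE mem_filter zp andbT orbN.
- by move=> [_ _ p_fun /IH h]; apply: evaluable_tc.
Qed.

End Closure.

Theorem formula_to_automaton (Sigma : finType) (F : graph Sigma -> Prop)
    (k : nat) (phi : formula Sigma k) :
  searchable F -> 0 < k -> FO_DTC phi -> closed_formula phi ->
  exists A : automaton Sigma k, deterministic A /\
    forall g : graph Sigma, F g -> (accepts A g <-> models g phi).
Proof.
move=> [G Gdet guide] k_gt0 phi_dtc phi_closed.
pose i0 := Ordinal k_gt0.
have [m M] := evaluable_sat Gdet i0 phi_dtc id 0.
pose prog : machine Sigma k bool := mbind (check Gdet i0 0) (fun _ => m).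
pose A := compiled prog.
(* The right-hand side does not mention [u], and the equivalence holds in every graph, not just in
   [F]: this is the independence of the initial node. *)
have accE (g : graph Sigma) (u : g) : acc A u <-> all_good G g /\ models g phi.
  rewrite compiled_acc.
  have en (nu : nat -> g) : env (fv phi) id nu [::].
    by rewrite phi_closed.
  split=> [[v /den_bind[o [[u1 al1] [dc d]]]]|[good sg]].
    have [E good] := check_partial (isT : okst 0 (Nil (nat * g))) dc.
    rewrite {}E in d; split=> // nu.
    have [b [u' [h d']]] := M g good nu u1 [::] isT (en nu).
    by apply/h; have [<- _] := den_det d d'.
  have [u1 d1] := check_total Gdet i0 (nseq_tuple k u)
    (isT : okst 0 (Nil (nat * g))) good.
  have [b [u2 [h d2]]] := M g good (fun=> u) u1 [::] isT (en _).
  exists u2; apply: den_bindI d1 _.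
  by have -> : true = b by apply/esym/h/sg.
have indep (g : graph Sigma) (u1 u2 : g) : acc A u1 -> acc A u2.
  by move=> /accE h; apply/accE.
exists (Automaton indep); split.
  by move=> p chi1 q1 chi2 q2; apply: compiled_det.
move=> g Fg; have good : all_good G g.
  by move=> v; apply: guides_visits_all; apply: guide.
split=> [acc_all|sg u]; last by apply/accE.
have [u _] := card_gt0P (graph_nonempty g).
by have /accE[] := acc_all u.
Qed.

(** * Elimination of states *)

Section Definable.

Variables (Sigma : finType) (k : nat).

Definition definable (D : seq nat) (P : vpred Sigma) : Prop :=
  exists phi : formula Sigma k, [/\ FO_DTC phi, {subset fv phi <= D} &
    forall (g : graph Sigma) (nu : nat -> g), sat nu phi <-> P g nu].

Lemma definable_family : closed_family definable.
Proof.
split.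
- move=> D D' P sub [phi [h1 h2 h3]]; exists phi; split=> // z /h2; exact: sub.
- move=> D P Q E [phi [h1 h2 h3]]; exists phi; split=> // g nu.
  by rewrite h3.
- move=> D P [phi [h1 h2 h3]]; exists (FNot phi); split=> // g nu /=.
  by rewrite h3.
- move=> D P Q [phi [h1 h2 h3]] [psi [h4 h5 h6]]; exists (FAnd phi psi).
  split=> // [z|g nu /=]; last by rewrite h3 h6.
  by rewrite mem_cat => /orP[/h2|/h5].
- move=> D x P [phi [h1 h2 h3]]; exists (FEx x phi); split=> // [z|g nu /=].
    by rewrite mem_filter => /andP[zx /h2]; rewrite inE (negbTE zx).
  by split=> -[a h]; exists a; apply/h3.
- by move=> x y; exists (FEq Sigma k x y); split.
Qed.

Let DF := definable_family.

Lemma definable_label s x : definable [:: x] (fun g nu => label (nu x) = s).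
Proof. by exists (FLab k s x); split. Qed.

Lemma definable_edge s x y :
  definable [:: x; y] (fun g nu => edge s (nu x) (nu y)).
Proof. by exists (FEdg k s x y); split. Qed.

Variable M : nat.
Hypothesis M_gt0 : 0 < M.

Notation block := (block k M).
Notation tau := (tau k M).
Notation trunc := (trunc M).
Notation bfam := (@bfam k M Sigma definable).

Definition trel : Type :=
  forall g : graph Sigma, (nat -> g) -> k.-tuple g -> k.-tuple g -> Prop.

(** Asking for all pairs of blocks takes the place of substitution: the relation can be used at any
    two tuple variables. *)
Definition rdef (D : seq nat) (R : trel) : Prop :=
  forall j j', bfam D [:: j; j'] (fun g nu t => R g nu (t j) (t j')).

Lemma rdef_ext D (R R' : trel) :
  (forall (g : graph Sigma) (nu : nat -> g) u v, R g nu u v <-> R' g nu u v) ->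
  rdef D R -> rdef D R'.
Proof. by move=> E h j j'; apply: (bfam_ext DF _ (h j j')). Qed.

Lemma rdef_sub D D' (R : trel) : {subset D <= D'} -> rdef D R -> rdef D' R.
Proof. by move=> sub h j j'; apply: (bfam_sub DF sub _ (h j j')). Qed.

Lemma rdef_comp D (R R' : trel) : rdef D R -> rdef D R' ->
  rdef D (fun g nu u v => exists z, R g nu u z /\ R' g nu z v).
Proof.
move=> h h' j j'; apply: (bfam_ex2 M_gt0 DF
  (R := fun g nu c a b => R g nu a c /\ R' g nu c b)) => i _ _.
apply: (bfam_and DF).
  by apply: (bfam_pair DF (h _ _)); rewrite !inE eqxx ?orbT.
by apply: (bfam_pair DF (h' _ _)); rewrite !inE eqxx ?orbT.
Qed.

Lemma rdef_or D (R R' : trel) : rdef D R -> rdef D R' ->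
  rdef D (fun g nu u v => R g nu u v \/ R' g nu u v).
Proof. by move=> h h' j j'; apply: (bfam_or DF (h j j') (h' j j')). Qed.

Lemma rdef_and D (R R' : trel) : rdef D R -> rdef D R' ->
  rdef D (fun g nu u v => R g nu u v /\ R' g nu u v).
Proof. by move=> h h' j j'; apply: (bfam_and DF (h j j') (h' j j')). Qed.

Lemma rdef_not D (R : trel) : rdef D R -> rdef D (fun g nu u v => ~ R g nu u v).
Proof. by move=> h j j'; apply: (bfam_not DF (h j j')). Qed.

Lemma rdef_Prop (X : Prop) D : rdef D (fun _ _ _ _ => X).
Proof. by move=> j j'; apply: (bfam_Prop _ _ DF X). Qed.

Lemma rdef_exists (I : finType) D (R : I -> trel) :
  (forall i, rdef D (R i)) -> rdef D (fun g nu u v => exists i, R i g nu u v).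
Proof. by move=> h j j'; apply: (bfam_exists DF) => i; apply: h. Qed.

Lemma rdef_forall (I : finType) D (R : I -> trel) :
  (forall i, rdef D (R i)) -> rdef D (fun g nu u v => forall i, R i g nu u v).
Proof. by move=> h j j'; apply: (bfam_forall DF) => i; apply: h. Qed.

Lemma rdef_in (T : Type) (s : seq T) D (R : T -> trel) :
  (forall x, rdef D (R x)) ->
  rdef D (fun g nu u v => exists2 x, List.In x s & R x g nu u v).
Proof. by move=> h j j'; apply: (fam_in DF s (fun x => h x j j')). Qed.

Lemma rdef_eq : rdef [::] (fun g nu u v => v = u).
Proof.
move=> j j'; apply: (bfam_sub DF _ _ (bfam_eq _ _ DF j' j)) => // z.
by rewrite !inE orbC.
Qed.

Lemma rdef_eq_at i : rdef [::] (fun g nu u v => tnth v i = tnth u i).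
Proof.
move=> j j'; apply: (bfam_sub DF _ _ (bfam_eq_at _ DF j' j i i)) => // z.
by rewrite !inE orbC.
Qed.

Lemma rdef_eq_low i x : x < M ->
  rdef [:: x] (fun g nu u v => nu x = tnth u i).
Proof.
move=> lt j j'; apply: (bfam_sub DF _ _ (bfam_eq_low DF j i lt)) => // z.
by rewrite !inE => ->.
Qed.

Lemma rdef_label s i : rdef [::] (fun g nu u v => label (tnth u i) = s).
Proof.
move=> j j'; apply: (bfam_of DF (fam_sub DF _
  (definable_label s (tnth (block j) i)))).
  by move=> z; rewrite inE /= cats0 mem_cat => /eqP ->; rewrite mem_tnth.
by move=> g nu; rewrite tnth_tau tnth_block.
Qed.

Lemma rdef_edge s i i' :
  rdef [::] (fun g nu u v => edge s (tnth u i) (tnth v i')).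
Proof.
move=> j j'; apply: (bfam_of DF (fam_sub DF _
  (definable_edge s (tnth (block j) i) (tnth (block j') i')))).
  move=> z; rewrite !inE /= cats0 mem_cat => /orP[] /eqP ->.
    by rewrite mem_tnth.
  by rewrite mem_tnth orbT.
by move=> g nu; rewrite !tnth_tau !tnth_block.
Qed.

Lemma rdef_converse D (R : trel) : rdef D R ->
  rdef D (fun g nu u v => R g nu v u).
Proof.
move=> h j j'; apply: (bfam_sub DF _ _ (h j' j)) => // z.
by rewrite !inE orbC.
Qed.

Lemma rdef_dom D (R : trel) : rdef D R ->
  rdef D (fun g nu u v => exists w, R g nu u w).
Proof.
move=> h j j'; apply: (bfam_ex2 M_gt0 DF (R := fun g nu c a b => R g nu a c)).
move=> i _ _.
by apply: (bfam_pair DF (h _ _)); rewrite !inE eqxx ?orbT.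
Qed.

Lemma rdef_ex_low D x (R : trel) : 0 < x < M -> rdef (x :: D) R ->
  rdef D (fun g nu u v => exists w, R g (upd nu [:: x] [:: w]) u v).
Proof. by move=> lt h j j'; apply: (bfam_ex_low DF lt (h j j')). Qed.

(** Trivial equations make given variables occur free, as [FO_DTC] demands of the variables bound by
    a closure. *)
Definition pad (phi : formula Sigma k) (xs : seq nat) : formula Sigma k :=
  foldr (fun x => FAnd (FEq Sigma k x x)) phi xs.

Lemma fv_pad phi xs z : (z \in fv (pad phi xs)) = (z \in xs) || (z \in fv phi).
Proof. by elim: xs => //= x xs IH; rewrite !inE IH orbA orbb orbA. Qed.

Lemma sat_pad (g : graph Sigma) (nu : nat -> g) phi xs :
  sat nu (pad phi xs) <-> sat nu phi.
Proof. by elim: xs => //= x xs IH; rewrite IH; split=> // -[]. Qed.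

Lemma FO_DTC_pad phi xs : FO_DTC phi -> FO_DTC (pad phi xs).
Proof. by move=> h; elim: xs. Qed.

Lemma rdef_star D (R : trel) :
  (forall (g : graph Sigma) (nu : nat -> g) u v w,
     R g nu u v -> R g nu u w -> v = w) ->
  rdef D R -> rdef D (fun g nu => clos_refl_trans _ (R g nu)).
Proof.
move=> R_fun h j j'.
(* The closure binds blocks 0 and 1, whereas [j] and [j'] are read outside it; so they may coincide
   with these or with each other. *)
have [phi [dtc sub E]] := h 0 1.
pose psi := pad phi (block 0 ++ block 1).
have block01 : {in block 0, forall z, z \notin block 1}.
  by move=> z; apply: block_disjoint.
have size_block i (T : Type) (a : k.-tuple T) : size a = size (block i).
  by rewrite !size_tuple.
have psiE (g : graph Sigma) (nu : nat -> g) (a b : k.-tuple g) :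
    sat (upd nu (block 0 ++ block 1) (a ++ b)) psi <-> R g (trunc nu) a b.
  rewrite sat_pad E (upd_cat _ (size_block _ _ _) (size_block _ _ _) block01).
  by rewrite !trunc_upd // !tau_upd.
exists (FTC (block 0) (block 1) psi (block j) (block j')); split.
- split.
  + rewrite cat_uniq !block_uniq andbT; apply/hasPn => z z1.
    by apply/negP => /block01; rewrite z1.
  + by move=> z zin; rewrite fv_pad zin.
  + by move=> g nu a b b' /psiE h1 /psiE h2; apply: R_fun h1 h2.
  + exact: FO_DTC_pad.
- move=> z; rewrite /= cats0 !mem_cat => /orP[|->]; last by rewrite orbT.
  rewrite mem_filter fv_pad => /andP[nin]; rewrite (negbTE nin) /= => /sub.
  by rewrite /= cats0 mem_cat (negbTE nin) orbF => ->.
move=> g nu /=.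
suff -> : (fun a b : k.-tuple g =>
    sat (upd nu (block 0 ++ block 1) (a ++ b)) psi) = R g (trunc nu) by [].
by apply: funext => a; apply: funext => b; apply: propext.
Qed.

(** * Kleene's algorithm for relations indexed by pairs of states *)

Section Kleene.

Variable Q : finType.

(** Nonempty paths from [p] to [q] with inner states in [rs]; the second case splits a path at its
    first and last passage through [r]. *)
Fixpoint kleene (T : Type) (E : Q -> Q -> T -> T -> Prop) (rs : seq Q)
    (p q : Q) (u v : T) : Prop :=
  match rs with
  | [::] => E p q u v
  | r :: rs' => kleene E rs' p q u v \/
      exists z, kleene E rs' p r u z /\
        exists z', clos_refl_trans T (kleene E rs' r r) z z' /\
          kleene E rs' r q z' v
  end.

Section Path.

Variables (T : Type) (E : Q -> Q -> T -> T -> Prop).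

Definition kstep (c c' : Q * T) : Prop := E c.1 c'.1 c.2 c'.2.

Inductive kpath (rs : seq Q) : Q * T -> Q * T -> Prop :=
  | kpath_one c c' : kstep c c' -> kpath rs c c'
  | kpath_cons c c1 c' :
      kstep c c1 -> c1.1 \in rs -> kpath rs c1 c' -> kpath rs c c'.

Lemma kpath_inv rs c c' : kpath rs c c' ->
  kstep c c' \/ exists c1, [/\ kstep c c1, c1.1 \in rs & kpath rs c1 c'].
Proof. by case=> {c c'} [c c' s|c c1 c' s h1 h]; [left | right; exists c1]. Qed.

Lemma kpath_cat rs c c1 c' :
  kpath rs c c1 -> c1.1 \in rs -> kpath rs c1 c' -> kpath rs c c'.
Proof.
move=> h; elim: h c' => {c c1} [c c1 s|c c2 c1 s in2 _ IH] c' in1 h'.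
  exact: kpath_cons s in1 h'.
by apply: kpath_cons s in2 _; apply: IH.
Qed.

Lemma kpath_sub rs rs' c c' : {subset rs <= rs'} -> kpath rs c c' ->
  kpath rs' c c'.
Proof.
move=> sub; elim=> {c c'} [c c' s|c c1 c' s in1 _ IH]; first exact: kpath_one.
by apply: kpath_cons s _ IH; apply: sub.
Qed.

Lemma kleeneP rs p q u v : kleene E rs p q u v <-> kpath rs (p, u) (q, v).
Proof.
elim: rs p q u v => [|r rs IH] p q u v /=.
  split=> [h|h]; first exact: kpath_one.
  by case: (kpath_inv h) => [|[c1 []]].
have sub : {subset rs <= r :: rs} by move=> x h; rewrite inE h orbT.
have in_r (w : T) : (r, w).1 \in r :: rs by rewrite mem_head.
split.
  move=> [/IH|[z [/IH h1 [z' [h2 /IH h3]]]]]; first exact: kpath_sub.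
  apply: (kpath_cat (kpath_sub sub h1) (in_r _)).
  move/clos_rt_rt1n_iff: h2 h1 => h2 _.
  elim: h2 h3 => {z z'} [z|z z1 z' s _ IH2] h3; first exact: kpath_sub h3.
  move/IH: s => s.
  exact: (kpath_cat (kpath_sub sub s) (in_r _) (IH2 h3)).
move Ec: (p, u) => c; move Ec': (q, v) => c' h.
elim: h p u Ec Ec' => {c c'} [c c' s|c c1 c' s in1 _ IH1] p u Ec Ec'.
  by left; apply/IH; rewrite Ec Ec'; apply: kpath_one.
case: c1 s in1 IH1 => p1 u1 s; rewrite inE => in1 /(_ _ _ erefl Ec') h1.
have [/eqP E1|nr] := boolP (p1 == r).
  have h0 : kleene E rs p r u u1.
    by apply/IH; rewrite Ec -E1; apply: kpath_one.
  right; exists u1; split=> //; rewrite E1 in h1.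
  case: h1 => [h1|[z [h1 [z' [h2 h3]]]]].
    by exists u1; split=> //; apply: rt_refl.
  by exists z'; split=> //; apply: clos_rt_cons h1 h2.
move: in1; rewrite (negbTE nr) /= => in1.
case: h1 => [/IH h1|[z [/IH h1 h2]]].
  by left; apply/IH; rewrite Ec; apply: kpath_cons s in1 h1.
right; exists z; split=> //; apply/IH; rewrite Ec.
exact: kpath_cons s in1 h1.
Qed.

Lemma kleene_star p q u v :
  clos_refl_trans _ kstep (p, u) (q, v) <->
  (p = q /\ v = u) \/ kleene E (enum Q) p q u v.
Proof.
rewrite kleeneP; split=> [/clos_rt_rt1n_iff|].
  move Ec: (p, u) => c; move Ec': (q, v) => c' h.
  have [E1|h'] : c = c' \/ kpath (enum Q) c c'.
    elim: h {Ec Ec'} => {c c'} [c|c c1 c2 s _ [<-|h]]; [by left | |]; right.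
      exact: kpath_one.
    by apply: kpath_cons s _ h; rewrite mem_enum.
  by left; move: E1; rewrite -Ec -Ec' => -[-> ->].
by right.
move=> [[-> ->]|]; first exact: rt_refl.
elim=> {p q u v} [c c' s|c c1 c' s _ _ IH]; first exact: rt_step.
exact: clos_rt_cons s IH.
Qed.

Hypothesis kstep_fun : forall c c1 c2, kstep c c1 -> kstep c c2 -> c1 = c2.

(* As q is not in rs, the path stops at its first visit to q. *)
Lemma kleene_fun rs p q u v w :
  q \notin rs -> kleene E rs p q u v -> kleene E rs p q u w -> v = w.
Proof.
move=> nin /kleeneP + /kleeneP.
move Ec: (p, u) => c; move Ec': (q, v) => c' h.
elim: h p u v Ec Ec' => {c c'} [c c' s|c c1 c' s in1 _ IH] p u v Ec Ec' h.
  case: (kpath_inv h) => [s'|[c1 [s' in1 _]]].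
    by have := kstep_fun s s'; rewrite -Ec' => -[].
  by move: in1; rewrite -(kstep_fun s s') -Ec' (negbTE nin).
case: (kpath_inv h) => [s'|[c2 [s' in2 h2]]].
  by move: in1; rewrite (kstep_fun s s') (negbTE nin).
rewrite -(kstep_fun s s') in h2.
by case: c1 {s in1 s'} IH h2 => p1 u1 IH h2; apply: IH h2.
Qed.

End Path.

(** As [rs] has no repetition, [r] is not an inner state of the loops at [r]: these are first
    returns, so their closure is deterministic. *)
Lemma rdef_kleene D (E : forall g : graph Sigma, (nat -> g) -> Q -> Q ->
    k.-tuple g -> k.-tuple g -> Prop) rs :
  (forall (g : graph Sigma) (nu : nat -> g) c c1 c2,
     kstep (E g nu) c c1 -> kstep (E g nu) c c2 -> c1 = c2) ->
  (forall p q, rdef D (fun g nu => E g nu p q)) -> uniq rs ->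
  forall p q, rdef D (fun g nu => kleene (E g nu) rs p q).
Proof.
move=> E_fun hE; elim: rs => [//|r rs IH] /= /andP[nin un] p q.
have {}IH := IH un; apply: rdef_or => //; apply: rdef_comp => //.
apply: rdef_comp => //; apply: rdef_star => // g nu u v w.
by move=> h1 h2; exact: (kleene_fun (E_fun g nu) nin h1 h2).
Qed.

Lemma rdef_kleene_star D (E : forall g : graph Sigma, (nat -> g) -> Q -> Q ->
    k.-tuple g -> k.-tuple g -> Prop) p q :
  (forall (g : graph Sigma) (nu : nat -> g) c c1 c2,
     kstep (E g nu) c c1 -> kstep (E g nu) c c2 -> c1 = c2) ->
  (forall p q, rdef D (fun g nu => E g nu p q)) ->
  rdef D (fun g nu u v => clos_refl_trans _ (kstep (E g nu)) (p, u) (q, v)).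
Proof.
move=> E_fun hE.
apply: (rdef_ext (R := fun g nu u v =>
  (p = q /\ v = u) \/ kleene (E g nu) (enum Q) p q u v)).
  by move=> g nu u v; rewrite kleene_star.
apply: rdef_or; last exact: rdef_kleene E_fun hE (enum_uniq _) p q.
apply: rdef_and; first exact: rdef_Prop.
exact: rdef_sub rdef_eq.
Qed.

End Kleene.

End Definable.

(** * Macro steps *)

Section Automaton.

Variables (Sigma : finType) (k : nat) (A : automaton Sigma k).
Hypothesis Adet : deterministic A.
Notation X := (pebble A).

Section MacroStep.

Variable g : graph Sigma.

(* A macro step keeps the pebble stack al: it is either a single step, or a
   computation that drops a pebble, works above it and finally retrieves it.
   The nesting depth is bounded by n, hence by the number of pebbles. *)
Fixpoint mstep (n : nat) (al : stack A g) (c c' : state A * k.-tuple g) :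
    Prop :=
  (exists2 chi, instr c.1 chi c'.1 & peffect chi (c.2, al) (c'.2, al)) \/
  match n with
  | 0 => False
  | n'.+1 => exists i x p q,
      [/\ instr c.1 (Drop Sigma i x) p, x \notin map fst al,
          clos_refl_trans _ (mstep n' ((x, tnth c.2 i) :: al))
            (p, c.2) (q, c'.2)
        & instr q (Retrieve x) c'.1]
  end.

Lemma cons_neq (T : Type) (x : T) s : x :: s <> s.
Proof. by move=> /(congr1 size) /= /eqP; rewrite eqn_leq ltnn. Qed.

Lemma instr_det p chi1 q1 chi2 q2 :
  instr (p : state A) chi1 q1 -> instr p chi2 q2 ->
  (chi1, q1) = (chi2, q2) \/ opposite chi1 chi2.
Proof.
move=> h1 h2; have [E|d] := EM ((chi1, q1) = (chi2, q2)); first by left.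
by right; apply: Adet h1 h2 d.
Qed.

(** By determinism [Retrieve] is the only instruction at [q], and it would change [al]. Hence the
    retrieval of the top pebble marks the end of an inner computation. *)
Lemma retrieve_dead n al q x q' u c :
  instr (q : state A) (Retrieve x) q' -> ~ mstep n al (q, u) c.
Proof.
move=> h; have bad chi q1 : instr q chi q1 -> chi = Retrieve x.
  by move=> h1; have [[]|[t [[_ //]|[_ //]]]] := instr_det h1 h.
case: n => [|n] /= [[chi /bad -> [_ [v]]]|] //.
- by move=> E; case: (cons_neq (esym E)).
- by move=> E; case: (cons_neq (esym E)).
- by move=> [i [y [p [q1 [/bad]]]]].
Qed.

Lemma star_dead_fun T (R : T -> T -> Prop) a b c :
  (forall x y z, R x y -> R x z -> y = z) ->
  clos_refl_trans T R a b -> clos_refl_trans T R a c ->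
  (forall x, ~ R b x) -> (forall x, ~ R c x) -> b = c.
Proof.
move=> R_fun /clos_rt_rt1n_iff; elim=> {a b} [a|a a1 b s _ IH] h db dc.
  by case: (clos_rt_step h) => [//|[z s _]]; case: (db _ s).
case: (clos_rt_step h) => [E|[z s' h']].
  by rewrite E in s; case: (dc _ s).
by apply: IH => //; rewrite (R_fun _ _ _ s s').
Qed.

Lemma basic_fun al (c c1 c2 : state A * k.-tuple g) chi1 chi2 :
  instr c.1 chi1 c1.1 -> peffect chi1 (c.2, al) (c1.2, al) ->
  instr c.1 chi2 c2.1 -> peffect chi2 (c.2, al) (c2.2, al) -> c1 = c2.
Proof.
move=> h1 e1 h2 e2.
have [[E1 E2]|[t [[E1 E2]|[E1 E2]]]] := instr_det h1 h2.
- rewrite E1 in e1; have [E3] := peffect_fun e1 e2.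
  by case: c1 c2 E2 E3 {h1 h2 e1 e2} => [? ?] [? ?] /= -> ->.
- by move: e1 e2; rewrite E1 E2 => -[h _ _] [].
- by move: e1 e2; rewrite E1 E2 => -[h _ _] [].
Qed.

Lemma basic_drop (al : stack A g) r chi i x p q u v :
  instr r chi q -> instr r (Drop Sigma i x) p -> ~ peffect chi (u, al) (v, al).
Proof.
move=> h1 h2; have [[-> _]|[t [[_ //]|[_ //]]]] := instr_det h1 h2.
by move=> [_ _ /= E]; case: (cons_neq (esym E)).
Qed.

(** In the nested case both inner computations end where no macro step is possible, and a functional
    relation leads to at most one such dead end. *)
Lemma mstep_fun n al c c1 c2 :
  mstep n al c c1 -> mstep n al c c2 -> c1 = c2.
Proof.
elim: n al c c1 c2 => [|n IH] al c c1 c2 /=.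
  by move=> [[chi1 h1 e1]|//] [[chi2 h2 e2]|//]; apply: basic_fun h1 e1 h2 e2.
move=> [[chi1 h1 e1]|[i1 [x1 [p1 [q1 [d1 _ r1 t1]]]]]].
  move=> [[chi2 h2 e2]|[i2 [x2 [p2 [q2 [d2 _ _ _]]]]]].
    exact: basic_fun h1 e1 h2 e2.
  by case: (basic_drop h1 d2 e1).
move=> [[chi2 h2 e2]|[i2 [x2 [p2 [q2 [d2 _ r2 t2]]]]]].
  by case: (basic_drop h2 d1 e2).
have [[Ei Ex Ep]|[t [[//]|[//]]]] := instr_det d1 d2.
rewrite {}Ei {}Ex {}Ep in d1 r1 t1.
have [Eq Eu] : (q1, c1.2) = (q2, c2.2).
  apply: star_dead_fun (IH _) r1 r2 _ _ => c'.
    exact: retrieve_dead t1.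
  exact: retrieve_dead t2.
rewrite Eq in t1; have [[E]|[t [[//]|[//]]]] := instr_det t1 t2.
by case: c1 c2 E Eu {r1 r2 t1 t2} => [? ?] [? ?] /= -> ->.
Qed.

Local Notation cfg p u al := (@Config _ _ A g p u al).
Local Notation steps := (clos_refl_trans _ (@step _ _ A g)).

Lemma mstep_steps n al p u q v :
  mstep n al (p, u) (q, v) -> steps (cfg p u al) (cfg q v al).
Proof.
elim: n al p u q v => [|n IH] al p u q v /=.
  by move=> [[chi h e]|//]; apply: rt_step; apply/stepE; exists chi.
move=> [[chi h e]|[i [x [p1 [q1 [d nin r t]]]]]].
  by apply: rt_step; apply/stepE; exists chi.
apply: (@rt_trans _ _ _ (cfg p1 u ((x, tnth u i) :: al))).
  by apply: rt_step; apply/stepE; exists (Drop Sigma i x).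
apply: (@rt_trans _ _ _ (cfg q1 v ((x, tnth u i) :: al))); last first.
  apply: rt_step; apply/stepE; exists (Retrieve x) => //.
  by split=> //; exists (tnth u i).
suff H c c' : clos_refl_trans _ (mstep n ((x, tnth u i) :: al)) c c' ->
    steps (cfg c.1 c.2 ((x, tnth u i) :: al))
      (cfg c'.1 c'.2 ((x, tnth u i) :: al)).
  exact: (H _ _ r).
elim=> {c c'} [[p2 u2] [q2 v2] /IH //|c|c c' c'' _ h1 _ h2].
  exact: rt_refl.
exact: rt_trans h1 h2.
Qed.

Fixpoint nsteps (m : nat) (c c' : config A g) : Prop :=
  if m is m'.+1 then exists2 c1, step c c1 & nsteps m' c1 c' else c = c'.

Lemma steps_nsteps c c' : steps c c' -> exists m, nsteps m c c'.
Proof.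
move=> /clos_rt_rt1n_iff; elim=> {c c'} [c|c c1 c' s _ [m h]].
  by exists 0.
by exists m.+1, c1.
Qed.

(** Strong induction on the length of a run that empties the stack: it makes macro steps over [al]
    until it ends or retrieves the top of [al]. After a [Drop] the hypothesis is used twice, for the
    inner part and for what follows the matching retrieval; [n] bounds the number of pebbles
    left. *)
Lemma nsteps_mstep m n al p u q v :
  nsteps m (cfg p u al) (cfg q v [::]) -> #|X| <= n + size al ->
  uniq (map fst al) ->
  exists q1 v1, clos_refl_trans _ (mstep n al) (p, u) (q1, v1) /\
    ([/\ al = [::], q1 = q & v1 = v] \/
     exists x w al' q2 m', [/\ al = (x, w) :: al', instr q1 (Retrieve x) q2,
       nsteps m' (cfg q2 v1 al') (cfg q v [::]) & m' < m]).
Proof.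
elim/ltn_ind: m n al p u => -[|m] IH n al p u /=.
  by move=> [-> -> ->] _ _; exists q, v; split; [apply: rt_refl | left].
move=> [[p1 u1 al1] /stepE [/= chi h e] run] le un.
have basic : al1 = al -> exists q1 v1,
    clos_refl_trans _ (mstep n al) (p, u) (q1, v1) /\
    ([/\ al = [::], q1 = q & v1 = v] \/
     exists x w al' q2 m', [/\ al = (x, w) :: al', instr q1 (Retrieve x) q2,
       nsteps m' (cfg q2 v1 al') (cfg q v [::]) & m' < m.+1]).
  move=> E; rewrite {}E in e run.
  have [q1 [v1 [st fin]]] := IH m (ltnSn m) n al p1 u1 run le un.
  exists q1, v1; split.
    apply: clos_rt_cons st.
    have s : exists2 chi, instr p chi p1 & peffect chi (u, al) (u1, al).
      by exists chi.
    by case: (n) => [|n'] /=; left.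
  case: fin => [|[x [w [al' [q2 [m' [E1 E2 E3 E4]]]]]]]; [by left | right].
  by exists x, w, al', q2, m'; split=> //; apply: ltnW.
case: chi h e basic => [i s|i s|i x|x|t|t] h e basic; rewrite /= in e.
- by apply: basic; case: e => w [].
- by apply: basic; case: e => w [].
- case: e => nin Eu Eal; rewrite /= in Eu Eal; rewrite {}Eu {}Eal in run.
  (* The dropped pebble is not among those of [al], so some pebble is left and [n] is positive. *)
  have sz : size al < #|X|.
    have un' : uniq (x :: map fst al) by rewrite /= nin.
    have := max_card (mem (x :: map fst al)).
    by rewrite (card_uniqP un') /= size_map.
  case: n le basic => [|n] le _; first by rewrite leqNgt sz in le.
  have [||q1 [v1 [st [[//]|]]]] := IH m (ltnSn m) n _ p1 u run.
  + by rewrite /= addnS.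
  + by rewrite /= nin.
  move=> [y [w [al' [q2 [m' [[Ey Ew Eal] ret run' lt]]]]]].
  rewrite -{}Ey -{}Eal in ret run'.
  have [q3 [v3 [st3 fin]]] := IH m' (ltnW lt) n.+1 al q2 v1 run' le un.
  exists q3, v3; split.
    by apply: clos_rt_cons st3; right; exists i, x, p1, q1.
  case: fin => [|[z [w' [al3 [q4 [m3 [E1 E2 E3 E4]]]]]]]; [by left | right].
  exists z, w', al3, q4, m3; split=> //.
  by apply: ltn_trans E4 _; apply: ltnW.
- case: e => Eu [w Eal]; rewrite /= in Eu Eal.
  exists p, u; split; first exact: rt_refl.
  right; exists x, w, al1, p1, m; split=> //.
  by rewrite -Eu.
- by apply: basic; case: e.
- by apply: basic; case: e.
Qed.

Lemma steps_mstep p u q v :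
  steps (cfg p u [::]) (cfg q v [::]) <->
  clos_refl_trans _ (mstep #|X| [::]) (p, u) (q, v).
Proof.
split=> [/steps_nsteps[m run]|].
  have [||q1 [v1 [st [[_ <- <-] //|]]]] := nsteps_mstep (n := #|X|) run => //.
    by rewrite addn0.
  by move=> [x [w [al' [q2 [m' [//]]]]]].
suff H c c' : clos_refl_trans _ (mstep #|X| [::]) c c' ->
    steps (cfg c.1 c.2 [::]) (cfg c'.1 c'.2 [::]) by move=> /H.
elim=> {c c'} [[p2 u2] [q2 v2] /mstep_steps //|c|c c' c'' _ h1 _ h2].
  exact: rt_refl.
exact: rt_trans h1 h2.
Qed.

End MacroStep.

End Automaton.

(** * Automata as formulas *)

Section AutomatonFormula.

Variables (Sigma : finType) (k : nat) (A : automaton Sigma k).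
Hypothesis Adet : deterministic A.
Notation X := (pebble A).
Notation Q := (state A).

Let M : nat := #|X|.+1.
Let M_gt0 : 0 < M. Proof. by []. Qed.

(** Numbering starts at 1 because variable 0 is the default of [trunc]. *)
Definition pvar (x : X) : nat := (enum_rank x).+1.

Lemma pvar_bounds x : 0 < pvar x < M.
Proof. by rewrite /= ltnS ltn_ord. Qed.

(** The names on the stack are fixed for each formula; only the positions of the pebbles are
    variables. *)
Definition pstack (g : graph Sigma) (nu : nat -> g) (S : seq X) : stack A g :=
  [seq (x, nu (pvar x)) | x <- S].

Lemma pstack_fst (g : graph Sigma) (nu : nat -> g) S :
  map fst (pstack nu S) = S.
Proof. by rewrite -map_comp map_id. Qed.

Lemma mem_pstack (g : graph Sigma) (nu : nat -> g) S x v :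
  (x, v) \in pstack nu S <-> x \in S /\ v = nu (pvar x).
Proof.
split=> [/mapP[y yS [-> ->]]|[xS ->]]; first by [].
by apply/mapP; exists x.
Qed.

Lemma pstack_upd (g : graph Sigma) (nu : nat -> g) S x v : x \notin S ->
  pstack (upd nu [:: pvar x] [:: v]) (x :: S) = (x, v) :: pstack nu S.
Proof.
move=> nin; rewrite /pstack /= upd1 eqxx; congr cons.
apply/eq_in_map => y yS; rewrite upd1; case: eqP => // -[E].
by rewrite -(enum_rank_inj (val_inj E)) yS in nin.
Qed.

Notation rdef := (@rdef Sigma k M).

Lemma rdef_nil D (R : trel Sigma k) : rdef [::] R -> rdef D R.
Proof. exact: rdef_sub. Qed.

Lemma rdef_pholds S t :
  rdef (map pvar S) (fun g nu u v => pholds t (u, pstack nu S)).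
Proof.
case: t => [i s|i x|i s|i s] /=.
- by apply: rdef_nil; apply: rdef_label.
- apply: (rdef_ext (R := fun g nu u v => x \in S /\ nu (pvar x) = tnth u i)).
    move=> g nu u v; rewrite mem_pstack.
    by split=> -[-> ->].
  case: (boolP (x \in S)) => xS; last first.
    apply: (rdef_ext (R := fun _ _ _ _ => False)); last exact: rdef_Prop.
    by move=> g nu u v; split=> // -[].
  apply: rdef_and; first exact: rdef_Prop.
  have /andP[_ lt] := pvar_bounds x.
  apply: (rdef_sub _ (rdef_eq_low Sigma i lt)) => z; rewrite inE => /eqP ->.
  exact: map_f.
(* [rdef_dom] quantifies over tuples, so the neighbour is made the i-th entry of one. *)
- apply: rdef_nil; apply: (rdef_ext (R := fun g nu u v =>
    exists w : k.-tuple g, edge s (tnth w i) (tnth u i))).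
    move=> g nu u v; split=> [[w e]|[w e]]; first by exists (tnth w i).
    by exists (nseq_tuple k w); rewrite tnth_nseq.
  by apply: rdef_dom; first by []; apply: rdef_converse; apply: rdef_edge.
- apply: rdef_nil; apply: (rdef_ext (R := fun g nu u v =>
    exists w : k.-tuple g, edge s (tnth u i) (tnth w i))).
    move=> g nu u v; split=> [[w e]|[w e]]; first by exists (tnth w i).
    by exists (nseq_tuple k w); rewrite tnth_nseq.
  by apply: rdef_dom; first by []; apply: rdef_edge.
Qed.

Lemma move_headP (g : graph Sigma) (u v : k.-tuple g) i :
  v = move_head u i (tnth v i) <->
  forall j, j != i -> tnth v j = tnth u j.
Proof.
split=> [-> j /negbTE ne|h]; first by rewrite tnth_move_head ne.
apply: eq_from_tnth => j; rewrite tnth_move_head.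
by case: (eqVneq j i) => [->|/h].
Qed.

Lemma rdef_moved i :
  rdef [::] (fun g nu u v => v = move_head u i (tnth v i)).
Proof.
apply: (rdef_ext (R := fun g nu u v =>
  forall j, j == i \/ tnth v j = tnth u j)).
  move=> g nu u v; rewrite move_headP; split=> h j; last first.
    by have [->|ne] := eqVneq j i; [left | right; apply: h].
  by case: (h j) => [-> //|].
apply: rdef_forall => j; apply: rdef_or; first exact: rdef_Prop.
exact: rdef_eq_at.
Qed.

Lemma rdef_peffect S chi :
  rdef (map pvar S)
    (fun g nu u v => peffect chi (u, pstack nu S) (v, pstack nu S)).
Proof.
case: chi => [i s|i s|i x|x|t|t] /=.
- apply: (rdef_ext (R := fun g nu u v =>
    edge s (tnth v i) (tnth u i) /\ v = move_head u i (tnth v i))).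
    move=> g nu u v; split=> [[e E]|[w [e E _]]]; first by exists (tnth v i).
    by rewrite E tnth_move_head eqxx.
  apply: rdef_nil; apply: rdef_and; last exact: rdef_moved.
  by apply: rdef_converse; apply: rdef_edge.
- apply: (rdef_ext (R := fun g nu u v =>
    edge s (tnth u i) (tnth v i) /\ v = move_head u i (tnth v i))).
    move=> g nu u v; split=> [[e E]|[w [e E _]]]; first by exists (tnth v i).
    by rewrite E tnth_move_head eqxx.
  apply: rdef_nil; apply: rdef_and; last exact: rdef_moved.
  exact: rdef_edge.
- apply: (rdef_ext (R := fun _ _ _ _ => False)); last exact: rdef_Prop.
  by move=> g nu u v; split=> // -[_ _ E]; case: (cons_neq (esym E)).
- apply: (rdef_ext (R := fun _ _ _ _ => False)); last exact: rdef_Prop.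
  by move=> g nu u v; split=> // -[_ [w E]]; case: (cons_neq (esym E)).
- apply: (rdef_ext (R := fun g nu u v => pholds t (u, pstack nu S) /\ v = u)).
    by move=> g nu u v; split=> [[]|[]].
  apply: rdef_and; first exact: rdef_pholds.
  by apply: rdef_nil; apply: rdef_eq.
- apply: (rdef_ext (R := fun g nu u v => ~ pholds t (u, pstack nu S) /\ v = u)).
    by move=> g nu u v; split=> [[]|[]].
  apply: rdef_and; first by apply: rdef_not; apply: rdef_pholds.
  by apply: rdef_nil; apply: rdef_eq.
Qed.

Lemma kstep_mstep (g : graph Sigma) n (al : stack A g) :
  kstep (fun p q u v => mstep n al (p, u) (q, v)) = mstep n al.
Proof. by apply: funext => -[p u]; apply: funext => -[q v]. Qed.

Lemma rdef_instr S p q (R : action Sigma X k -> trel Sigma k) :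
  (forall chi, rdef (map pvar S) (R chi)) ->
  rdef (map pvar S) (fun g nu u v =>
    exists2 chi, instr p chi q & R chi g nu u v).
Proof.
move=> hR; have [l lP] := instr_finite Adet p.
apply: (rdef_ext (R := fun g nu u v => exists2 cq, List.In cq l &
  cq.2 = q /\ R cq.1 g nu u v)).
  move=> g nu u v; split=> [[[chi q'] /= /lP h [<- r]]|[chi /lP h r]].
    by exists chi.
  by exists (chi, q).
apply: rdef_in => -[chi q'] /=; apply: rdef_and; last exact: hR.
exact: rdef_Prop.
Qed.

Lemma rdef_mstep_star n S :
  (forall p q, rdef (map pvar S)
     (fun g nu u v => mstep n (pstack nu S) (p, u) (q, v))) ->
  forall p q, rdef (map pvar S) (fun g nu u v =>
    clos_refl_trans _ (mstep n (pstack nu S)) (p, u) (q, v)).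
Proof.
move=> h p q.
have h' := rdef_kleene_star M_gt0 (E := fun (g : graph Sigma) (nu : nat -> g)
  p q u v => mstep n (pstack nu S) (p, u) (q, v)) p q _ h.
apply: rdef_ext (h' _) => [g nu u v|g nu c c1 c2].
  by rewrite kstep_mstep.
by rewrite kstep_mstep; apply: (mstep_fun Adet).
Qed.

Lemma rdef_mstep n S p q :
  rdef (map pvar S)
    (fun g nu u v => mstep n (pstack nu S) (p, u) (q, v)).
Proof.
have basic S' p' q' : rdef (map pvar S') (fun g nu u v =>
    exists2 chi, instr p' chi q' &
    peffect chi (u, pstack nu S') (v, pstack nu S')).
  by apply: rdef_instr => chi; apply: rdef_peffect.
elim: n S p q => [|n IH] S p q /=.
  by apply: rdef_or => //; apply: rdef_Prop.
apply: rdef_or => //.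
apply: rdef_exists => i; apply: rdef_exists => x.
apply: rdef_exists => p1; apply: rdef_exists => q1.
have [xS|xS] := boolP (x \in S).
  apply: (rdef_ext (R := fun _ _ _ _ => False)); last exact: rdef_Prop.
  by move=> g nu u v; split=> // -[_]; rewrite pstack_fst xS.
have lt := pvar_bounds x.
have st := @rdef_mstep_star n (x :: S) (IH _) p1 q1.
(* Dropping [x] amounts to binding its variable to the node under head [i]. *)
have h : rdef (map pvar S) (fun g nu u v => exists w,
    upd nu [:: pvar x] [:: w] (pvar x) = tnth u i /\
    clos_refl_trans _ (mstep n (pstack (upd nu [:: pvar x] [:: w]) (x :: S)))
      (p1, u) (q1, v)).
  apply: (rdef_ex_low lt (R := fun g nu u v => nu (pvar x) = tnth u i /\
    clos_refl_trans _ (mstep n (pstack nu (x :: S))) (p1, u) (q1, v))).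
  apply: rdef_and => //; have /andP[_ lt'] := lt.
  apply: (rdef_sub _ (rdef_eq_low Sigma i lt')) => z.
  by rewrite !inE => ->.
apply: (rdef_ext (R := fun g nu u v =>
  (instr p (Drop Sigma i x) p1 /\ instr q1 (Retrieve x) q) /\
  exists w, upd nu [:: pvar x] [:: w] (pvar x) = tnth u i /\
    clos_refl_trans _ (mstep n (pstack (upd nu [:: pvar x] [:: w]) (x :: S)))
      (p1, u) (q1, v))); last by apply: rdef_and => //; apply: rdef_Prop.
move=> g nu u v; rewrite pstack_fst; split.
  move=> [[h1 h2] [w [E]]]; rewrite pstack_upd // upd1 eqxx in E *.
  by rewrite E.
move=> [h1 _ h2 h3]; split=> //; exists (tnth u i).
by rewrite pstack_upd // upd1 eqxx.
Qed.

Definition enabled (g : graph Sigma) (u : k.-tuple g) (chi : action Sigma X k) :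
    Prop := exists c, peffect chi (u, [::] : stack A g) c.

Lemma rdef_enabled chi : rdef [::] (fun g nu u v => enabled u chi).
Proof.
have pholds_ok t : rdef [::] (fun g nu u v => pholds t (u, [::] : stack A g)).
  exact: (rdef_pholds [::] t).
rewrite /enabled; case: chi => [i s|i s|i x|x|t|t] /=.
- apply: (rdef_ext _ (pholds_ok (TInEdge X i s))) => g nu u v /=.
  split=> [[w e]|[c [w [e _ _]]]]; last by exists w.
  by exists (move_head u i w, [::]), w.
- apply: (rdef_ext _ (pholds_ok (TOutEdge X i s))) => g nu u v /=.
  split=> [[w e]|[c [w [e _ _]]]]; last by exists w.
  by exists (move_head u i w, [::]), w.
- apply: (rdef_ext (R := fun _ _ _ _ => True)); last exact: rdef_Prop.
  by move=> g nu u v; split=> // _; exists (u, [:: (x, tnth u i)]).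
- apply: (rdef_ext (R := fun _ _ _ _ => False)); last exact: rdef_Prop.
  by move=> g nu u v; split=> // -[c [_ []]].
- apply: (rdef_ext _ (pholds_ok t)) => g nu u v.
  by split=> [h|[c []]] //; exists (u, [::]).
- apply: (rdef_ext _ (rdef_not (pholds_ok t))) => g nu u v.
  by split=> [h|[c []]] //; exists (u, [::]).
Qed.

Lemma haltingP (g : graph Sigma) q (u : k.-tuple g) :
  halting (@Config _ _ A g q u [::]) <->
  ~ exists q', exists2 chi, instr q chi q' & enabled u chi.
Proof.
split=> [h [q' [chi ins [[v al] e]]]|h c' /stepE[chi ins e]].
  by apply: (h (@Config _ _ A g q' v al)); apply/stepE; exists chi.
by apply: h; exists (cstate c'), chi => //; exists (cfg_of c').
Qed.

Lemma rdef_halting q :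
  rdef [::] (fun g nu u v => halting (@Config _ _ A g q u [::])).
Proof.
apply: (rdef_ext _ (rdef_not _)) => [g nu u v|].
  symmetry; exact: haltingP.
apply: rdef_exists => q'.
exact: (rdef_instr (S := [::]) q q' (fun chi => rdef_enabled chi)).
Qed.

Lemma accE (g : graph Sigma) (u : g) :
  acc A u <-> exists q, q \in final A /\ exists v : k.-tuple g,
    clos_refl_trans _ (mstep #|X| [::]) (init A, nseq_tuple k u) (q, v) /\
    halting (@Config _ _ A g q v [::]).
Proof.
split=> [[q [v [fin run hlt]]]|[q [fin [v [run hlt]]]]].
  exists q; split=> //; exists v; split=> //.
  exact: (proj1 (steps_mstep (init A) (nseq_tuple k u) q v) run).
exists q, v; split=> //.
exact: (proj2 (steps_mstep (init A) (nseq_tuple k u) q v) run).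
Qed.

Lemma rdef_acc : rdef [::] (fun g nu u v => exists q, q \in final A /\
  exists v : k.-tuple g,
    clos_refl_trans _ (mstep #|X| [::]) (init A, u) (q, v) /\
    halting (@Config _ _ A g q v [::])).
Proof.
apply: rdef_exists => q; apply: rdef_and; first exact: rdef_Prop.
apply: (rdef_dom M_gt0 (R := fun g nu u v =>
   clos_refl_trans _ (mstep #|X| [::]) (init A, u) (q, v) /\
    halting (@Config _ _ A g q v [::]))).
apply: rdef_and; last by apply: rdef_converse; apply: rdef_halting.
exact: (rdef_mstep_star (rdef_mstep #|X| [::]) (init A) q).
Qed.

End AutomatonFormula.

Theorem automaton_to_formula (Sigma : finType) (k : nat)
    (A : automaton Sigma k) :
  0 < k -> deterministic A -> exists phi : formula Sigma k,
  [/\ FO_DTC phi, closed_formula phi &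
      forall g : graph Sigma, accepts A g <-> models g phi].
Proof.
move=> k_gt0 Adet; have DF := definable_family Sigma k.
set M := #|pebble A|.+1.
(* Initial head positions are the constant tuples; the closed formula says that the automaton
   accepts from all of them. *)
have same : bfam (k := k) M (definable k (Sigma := Sigma)) [::] [:: 0; 1]
    (fun g nu t => forall i j, tnth (t 0) i = tnth (t 0) j).
  apply: (bfam_forall DF) => i; apply: (bfam_forall DF) => j.
  apply: (bfam_sub DF _ _ (bfam_eq_at M DF 0 0 i j)) => // z.
  by rewrite !inE orbb => ->.
have all_acc := bfam_all (isT : 0 < M) DF (bfam_all (isT : 0 < M) DF
  (bfam_imply DF same (rdef_acc Adet 0 1))).
case: all_acc => phi [dtc sub E]; exists phi; split=> //.
  rewrite /closed_formula; case: (fv phi) sub => [//|z s] sub.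
  by have := sub z (mem_head _ _).
move=> g; split=> [all_acc nu|mod u].
  apply/E => c1 c const.
  have -> : upt (upt (tau k M nu) 1 c1) 0 c 0 =
      nseq_tuple k (tnth c (Ordinal k_gt0)).
    by apply: eq_from_tnth => i; rewrite tnth_nseq; apply: const.
  exact/accE/all_acc.
apply/accE; have /E := mod (fun=> u).
move=> /(_ (nseq_tuple k u) (nseq_tuple k u)); apply=> i j.
by rewrite /upt /= !tnth_nseq.
Qed.

Theorem theorem7p3 (Sigma : finType) (F : graph Sigma -> Prop)
    (F_searchable : searchable F) (k : nat) (k_gt0 : 0 < k) :
  (forall A : automaton Sigma k, deterministic A ->
     exists phi : formula Sigma k,
       [/\ FO_DTC phi, closed_formula phi
         & forall g : graph Sigma, F g -> (accepts A g <-> models g phi)])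
  /\
  (forall phi : formula Sigma k, FO_DTC phi -> closed_formula phi ->
     exists A : automaton Sigma k,
       deterministic A
       /\ forall g : graph Sigma, F g -> (accepts A g <-> models g phi)).
Proof.
split=> [A Adet|phi dtc closed]; last exact: formula_to_automaton.
have [phi [dtc closed E]] := automaton_to_formula k_gt0 Adet.
by exists phi; split.
Qed.
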